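(* Let $W$ be a finite Coxeter group with set of simple reflections $S$. Suppose that for every $L\subseteq S$ and every $W_L$-conjugacy class $C$ of cuspidal elements of $W_L$ with fixed representative $w_C$, there exist linear characters $\widetilde\varphi_{w_C},\widetilde\psi_{w_C}$ of $C_W(w_C)$ such that $\widetilde\Phi_L=\sum_{C\in\mathcal C_L}\operatorname{Ind}_{C_W(w_C)}^{N_W(W_L)}\widetilde\varphi_{w_C}$, $\widetilde\Psi_L=\sum_{C\in\mathcal C_L}\operatorname{Ind}_{C_W(w_C)}^{N_W(W_L)}\widetilde\psi_{w_C}$, and $\widetilde\psi_{w_C}=\widetilde\varphi_{w_C}\epsilon\alpha_L$ for all $C\in\mathcal C_L$. Then for each $w$ in a set $\mathcal R$ of representatives of the conjugacy classes of $W$ there are linear characters $\widetilde\varphi_w,\widetilde\psi_w$ of $C_W(w)$ such that (i) $\rho_W=\sum_{w\in\mathcal R}\operatorname{Ind}_{C_W(w)}^W\widetilde\varphi_w$; (ii) $\omega_W=\sum_{w\in\mathcal R}\operatorname{Ind}_{C_W(w)}^W\widetilde\psi_w$; (iii) $\widetilde\psi_w=\widetilde\varphi_w\epsilon\alpha_w$ for all $w\in\mathcal R$.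
   Context: $W$ has length function $\ell$ and acts on the right as a reflection group on $V=\mathbb R^{|S|}$ (and $V_{\mathbb C}$). Write $x^w=w^{-1}xw$, $J^w=\{s^w:s\in J\}$. $\epsilon$ is the sign character, $\rho_W$ the regular character. For $w\in W$, $\alpha_w(c)=\det(c|_{\operatorname{Fix}(w)})$ for $c\in C_W(w)$. For $J\subseteq S$: $W_J=\langle J\rangle$; $X_J=\{w:\ell(sw)>\ell(w)\ \forall s\in J\}$; $x_J=\sum_{x\in X_J}x^{-1}$; $X_J^\sharp=\{x\in X_J:J^x\subseteq S\}$; $N_J=\{x\in X_J:J^x=J\}$, so $N_W(W_J)=W_J\rtimes N_J$. With $m_{KL}=|X_K\cap X_L^\sharp|$ for $L\subseteq K$ and $0$ otherwise (an invertible matrix), elements $e_L$ are defined by $x_K=\sum_Lm_{KL}e_L$. For $L\subseteq S$, $\widetilde\Phi_L$ is the character of $N_W(W_L)$ acting by right multiplication on $e_L\mathbb CW_L$. Orlik–Solomon algebra: $T$ the reflections, $H_t$ their hyperplanes in $V_{\mathbb C}$; $A(W)$ is generated by $a_t$ ($t\in T$) with $a_ta_{t'}=-a_{t'}a_t$ and $\sum_{i=1}^p(-1)^ia_{t_1}\cdots\widehat{a_{t_i}}\cdots a_{t_p}=0$ for linearly dependent $\{H_{t_1},\dots,H_{t_p}\}$; $W$ acts by $a_t.w=a_{t^w}$; $\omega_W$ is the character of $A(W)$. For $X=\operatorname{Fix}(W_L)$ of codimension $p$, $A_X$ is the span of all $a_{t_1}\cdots a_{t_p}$ with $H_{t_1}\cap\dots\cap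 H_{t_p}=X$, and $\widetilde\Psi_L$ is the character of $N_W(W_L)$ on $A_X$. It is known that $\rho_W=\sum_{[L]}\operatorname{Ind}_{N_W(W_L)}^W\widetilde\Phi_L$ and $\omega_W=\sum_{[L]}\operatorname{Ind}_{N_W(W_L)}^W\widetilde\Psi_L$, summing over representatives of the $W$-conjugacy classes of subsets $L\subseteq S$. $\alpha_L(w)=\det(w|_{\operatorname{Fix}(W_L)})$ for $w\in N_W(W_L)$. $w\in W_L$ is cuspidal in $W_L$ if it has no nonzero fixed vector in the orthogonal complement of $\operatorname{Fix}(W_L)$; $\mathcal C_L$ is the set of $W_L$-classes of cuspidal elements of $W_L$; for such $w$, $C_W(w)\le N_W(W_L)$. *)

(* Defs.v *)
From HB Require Import structures.
From mathcomp Require Import all_boot all_order all_algebra all_fingroup all_solvable all_field all_character.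
Set Implicit Arguments. Unset Strict Implicit. Unset Printing Implicit Defensive.
Import Order.TTheory GRing.Theory Num.Theory.
Local Open Scope ring_scope.

Section Defs.
Variable gT : finGroupType.
Implicit Types (W : {group gT}) (S L J K T A : {set gT}).

(* (W,S) is a Coxeter system: S is a set of involutions generating W, and W
   has the presentation <S | (st)^{m_st} = 1> where m_st is the order of st,
   expressed through the universal property of the presentation. *)
Definition coxeter_system W S : Prop :=
  [/\ S \subset W, <<S>>%g = W :> {set gT},
      {in S, forall s, #[s]%g = 2%N} &
      forall (hT : finGroupType) (f : gT -> hT),
        {in S &, forall s t, ((f s * f t) ^+ #[(s * t)%g])%g = 1%g} ->
        exists phi : {morphism W >-> hT}, {in S, forall s, phi s = f s}].

Definition Sball S (k : nat) : {set gT} :=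
  iter k (fun A : {set gT} => A :|: (A * S)%g) [set 1%g].

Definition coxlen S (w : gT) : nat :=
  \big[minn/#|gT|]_(k < #|gT|.+1 | w \in Sball S k) k.

Definition sgnW S (w : gT) : algC := (-1) ^+ coxlen S w.

(* the invariant bilinear form B(e_s,e_t) = - cos(pi/m_st) on V = R^{|S|}
   (computed in algC: cos(pi/m) = Re(m.-root(-1)) ) *)
Definition coxB S : 'M[algC]_#|S| :=
  \matrix_(i, j) - 'Re ((#[(enum_val i * enum_val j)%g]%g).-root (-1)).

(* the matrix (for the right action on row vectors) of the reflection
   v |-> v - 2 B(v, e_s) e_s, s = enum_val i *)
Definition refl_mx S (i : 'I_#|S|) : 'M[algC]_#|S| :=
  1%:M - 2%:R *: (col i (coxB S) *m delta_mx (0 : 'I_1) i).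

Variable n : nat.
Variable rho : gT -> 'M[algC]_n.

Definition Fixw (w : gT) : 'M[algC]_n := kermx (rho w - 1%:M).
Definition FixL L : 'M[algC]_n := (\bigcap_(s in L) Fixw s)%MS.
(* determinant of the restriction of A to the (A-stable) subspace U *)
Definition restr_det (U A : 'M[algC]_n) : algC :=
  \det (row_base U *m A *m pinvmx (row_base U)).
Definition alpha_w (w c : gT) : algC := restr_det (Fixw w) (rho c).
Definition alpha_L L (c : gT) : algC := restr_det (FixL L) (rho c).

Definition orthB (Bf U : 'M[algC]_n) : 'M[algC]_n := kermx (Bf *m U^T).

Definition cuspidal (Bf : 'M[algC]_n) L (w : gT) : bool :=
  (w \in <<L>>%g) && (\rank (Fixw w :&: orthB Bf (FixL L))%MS == 0%N).

End Defs.

Definition class_transversal (gT : finGroupType) (G P R : {set gT}) : Prop :=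
  R \subset P /\ {in P, forall x, #|[set r in R | x \in (r ^: G)%g]| = 1%N}.

Section GroupAlgebra.
Variable gT : finGroupType.
Definition CW := {ffun gT -> algC^o}.
Definition gdelta (g : gT) : CW := [ffun h => (h == g)%:R].
Definition conv (a b : CW) : CW :=
  [ffun g => \sum_(h : gT) ((a h : algC) * (b (h^-1 * g)%g : algC))].

Implicit Types (W : {group gT}) (S L J K : {set gT}).

Definition Xset W S J : {set gT} :=
  [set w in W | [forall s in J, (coxlen S w < coxlen S (s * w)%g)%N]].
Definition Xsharp W S J : {set gT} :=
  [set x in Xset W S J | (J :^ x)%g \subset S].
Definition xJ W S J : CW := \sum_(x in Xset W S J) gdelta (x^-1)%g.

Lemma set0_in_powerset (S : {set gT}) : set0 \in powerset S.
Proof. by rewrite inE sub0set. Qed.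

Definition pidx S (L : {set gT}) : 'I_#|powerset S| :=
  enum_rank_in (set0_in_powerset S) L.

Definition mKL W S : 'M[algC]_#|powerset S| :=
  \matrix_(i, j) (let K : {set gT} := enum_val i in let L : {set gT} := enum_val j in
                  if L \subset K
                  then (#|Xset W S K :&: Xsharp W S L|)%:R
                  else 0).

(* e_L, defined by x_K = sum_L m_{KL} e_L *)
Definition eL W S L : CW :=
  \sum_(K in powerset S) (invmx (mKL W S) (pidx S L) (pidx S K)) *: xJ W S K.

(* trace of f on the (f-stable) subspace U *)
Definition vtr (K : fieldType) (vT : vectType K) (U : {vspace vT}) (f : vT -> vT) : K :=
  \sum_(i < \dim U) coord (vbasis U) i (f (vbasis U)`_i).

Definition PhiL W S L (g : gT) : algC :=
  vtr (span [seq conv (eL W S L) (gdelta h) | h in <<L>>%g])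
      (fun a => conv a (gdelta g)).

End GroupAlgebra.

Section OrlikSolomon.
Variable gT : finGroupType.
Definition Ext := {ffun {set gT} -> algC^o}.
Definition eb (A : {set gT}) : Ext := [ffun B => (B == A)%:R].
Definition ltT (x y : gT) : bool := (enum_rank x < enum_rank y)%N.
Definition wsign (A B : {set gT}) : algC :=
  (-1) ^+ #|[set p in setX A B | ltT p.2 p.1]|.
(* wedge of the basis elements e_A and e_B of the exterior algebra *)
Definition emul (A B : {set gT}) : Ext :=
  if [disjoint A & B] then wsign A B *: eb (A :|: B) else 0.
Definition mulE (a b : Ext) : Ext :=
  \sum_(A : {set gT}) \sum_(B : {set gT}) ((a A : algC) * (b B : algC)) *: emul A B.
(* W-action a_t.w = a_{t^w}, extended to the exterior algebra *)
Definition asign (w : gT) (A : {set gT}) : algC :=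
  (-1) ^+ #|[set p in setX A A | ltT p.1 p.2 && ltT (p.2 ^ w)%g (p.1 ^ w)%g]|.
Definition actE (w : gT) (a : Ext) : Ext :=
  \sum_(A : {set gT}) (a A : algC) *: (asign w A *: eb (A :^ w)%g).

Variable W : {group gT}.
Variable S : {set gT}.
Variable n : nat.
Variable rho : gT -> 'M[algC]_n.

Definition reflT : {set gT} := \bigcup_(w in W) (S :^ w)%g.
Definition Xint (A : {set gT}) : 'M[algC]_n := (\bigcap_(t in A) Fixw rho t)%MS.
Definition codim (U : 'M[algC]_n) : nat := (n - \rank U)%N.
Definition dependent (A : {set gT}) : bool := (codim (Xint A) < #|A|)%N.
(* sum_i (-1)^i a_{t_1} .. ^a_{t_i} .. a_{t_p}, t_1 < .. < t_p *)
Definition osrel (D : {set gT}) : Ext :=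
  \sum_(t in D) (-1) ^+ (#|[set u in D | ltT u t]|.+1) *: eb (D :\ t).
Definition ExtT : {vspace Ext} := span [seq eb A | A <- enum (powerset reflT)].
Definition OSideal : {vspace Ext} :=
  span [seq mulE (eb A) (osrel D) | A <- enum (powerset reflT),
                                    D <- enum [set D in powerset reflT | dependent D]].
(* omega_W: character of W on A(W) = ExtT / OSideal *)
Definition omegaW (w : gT) : algC :=
  vtr ExtT (actE w) - vtr OSideal (actE w).
(* Psi_L: character of N_W(W_L) on A_X, X = Fix(W_L) *)
Definition PsiL (L : {set gT}) (g : gT) : algC :=
  let X := FixL rho L in
  let EX := span [seq eb A | A <- enum [set A in powerset reflT |
                     (#|A| == codim X) && (Xint A == X)%MS]] in
  vtr (EX + OSideal)%VS (actE g) - vtr OSideal (actE g).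
End OrlikSolomon.

(* Main.v *)
Require Import Defs.
From HB Require Import structures.
From mathcomp Require Import all_boot all_order all_algebra all_fingroup all_solvable all_field all_character.
From mathcomp Require Import ring zify.
Import Order.TTheory GRing.Theory Num.Theory.
Local Open Scope ring_scope.
Set Implicit Arguments. Unset Strict Implicit. Unset Printing Implicit Defensive.

(** Both characters are graded by the parabolic subgroups [P] of [W].

    The group algebra is the sum of the spaces [e_L CW_L x], one for each
    parabolic [P = W_L^x], because the [e_L] add up to [1].  The Mackey formula
    for the [x_K] shows that [e_L] is annihilated on the right by the [x_K] of
    [W_L] with [K] proper in [L]; so the restriction of [e_L] to [W_L] is an
    idempotent up to the scalar [m_LL], the dimension of [e_L CW_L] is a trace,
    and these dimensions add up to [|W|]: the sum is direct.  The Orlik-Solomon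
    ideal is graded by flats, and by Steinberg's theorem (the pointwise
    stabilizer of a subspace is parabolic) flats are the same as parabolic
    subgroups.  Taking traces, [rho_W] and [omega_W] are the sums of the
    [Ind Phi_L] and [Ind Psi_L], hence by hypothesis sums of characters induced
    from the [C_W(w_C)].

    Every element of [W] is conjugate to some cuspidal [w_C], again by
    Steinberg's theorem, and the value at [1] of [rho_W] says that the classes
    of the [w_C] have total size [|W|].  So each class of [W] contains exactly
    one [w_C], to which the linear characters are transported.  Finally
    [Fix w_C = Fix W_L], so [alpha_L] and [alpha_w] agree. *)

(** * Traces on function spaces *)

(** Lengths are handled through positivity of roots: s lengthens w exactly when w sends the root of
    s to a nonnegative combination of simple roots. This depends on the exact entries -cos (pi /
    m_st) of the form, which are only available through [m.-root (-1)]; hence the study of the signs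
    of sin (k pi / m) inside [algC]. The number m_LL enters the dimension count for two unrelated
    reasons. It is the scale that makes the restriction of e_L to W_L idempotent, so the dimension
    is |W_L| m_LL e_L(1); and |W_L| m_LL is the number of pairs (L, x) that yield one given
    parabolic. This coincidence is what makes the dimensions add up. No quotient is formed: the
    character of a quotient is a difference of traces on stable subspaces, evaluated by projections
    of the full function space. Steinberg's theorem is proved for real vectors and reaches complex
    subspaces through real and imaginary parts. *)

Lemma sumv_dim_independent (K : fieldType) (vT : vectType K) (I : finType) (A : {pred I})
    (U : I -> {vspace vT}) (u : I -> vT) :
    (\sum_(i in A) \dim (U i) <= \dim (\sum_(i in A) U i)%VS)%N ->
    (forall i, i \in A -> u i \in U i) -> \sum_(i in A) u i = 0 ->
  forall i, i \in A -> u i = 0.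
Proof.
move=> le_dim uU u0; have dx : directv (\sum_(i in A) U i) by rewrite directvEgeq.
exact: (directv_sum_independent dx).
Qed.

Section FunctionSpaceTrace.

Variable I : finType.
Local Notation V := {ffun I -> algC^o}.

Definition fdelta (i : I) : V := [ffun j => (j == i)%:R].

Lemma fdelta_sum (v : V) : v = \sum_i (v i : algC) *: fdelta i.
Proof.
apply/ffunP=> j; rewrite sum_ffunE (bigD1 j) //= big1 => [|i neq].
  by rewrite !ffunE eqxx addr0 /GRing.scale /= mulr1.
by rewrite !ffunE eq_sym (negPf neq) scaler0.
Qed.

(** Traces on subspaces are brought back to this trace on the whole space by inserting a projection;
    cyclicity ([ftrC]) then applies without matching bases. *)
Definition ftr (f : V -> V) : algC := \sum_i (f (fdelta i) i : algC).

Lemma eq_ftr (f g : V -> V) : f =1 g -> ftr f = ftr g.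
Proof. by move=> fg; apply: eq_bigr => i _; rewrite fg. Qed.

Lemma ftrD (f g : V -> V) : ftr (fun v => f v + g v) = ftr f + ftr g.
Proof. by rewrite /ftr -big_split; apply: eq_bigr => i _; rewrite ffunE. Qed.

Lemma ftr_sum (J : finType) (A : {pred J}) (f : J -> V -> V) :
  ftr (fun v => \sum_(j in A) f j v) = \sum_(j in A) ftr (f j).
Proof.
by rewrite /ftr exchange_big; apply: eq_bigr => i _; rewrite sum_ffunE.
Qed.

Lemma linear_fdelta (f : {linear V -> V}) (v : V) i :
  f v i = \sum_j (v j : algC) * (f (fdelta j) i : algC).
Proof.
rewrite {1}(fdelta_sum v) linear_sum sum_ffunE.
by apply: eq_bigr => j _; rewrite linearZ ffunE.
Qed.

Lemma linear_fdelta_ext (f g : {linear V -> V}) :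
  (forall i, f (fdelta i) = g (fdelta i)) -> f =1 g.
Proof.
move=> fg v; rewrite [v]fdelta_sum (linear_sum f) (linear_sum g).
by apply: eq_bigr => i _; rewrite (linearZ_LR f) (linearZ_LR g) fg.
Qed.

Lemma ftrC (f g : {linear V -> V}) :
  ftr (fun v => f (g v)) = ftr (fun v => g (f v)).
Proof.
rewrite /ftr; under eq_bigr do rewrite linear_fdelta.
rewrite exchange_big; apply: eq_bigr => j _ /=.
by rewrite (linear_fdelta g); apply: eq_bigr => i _; rewrite mulrC.
Qed.

(** Since [f \o p] has its image in [U] and agrees with [f] there, it has the trace of [f] on [U],
    whichever projection [p] onto [U] is taken. *)
Lemma vtr_ftr (U : {vspace V}) (f p : {linear V -> V}) :
    (forall u, u \in U -> f u \in U) ->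
    (forall v, p v \in U) -> (forall u, u \in U -> p u = u) ->
  vtr U f = ftr (fun v => f (p v)).
Proof.
move=> fU pU pid; rewrite /vtr /ftr.
pose b := vbasis U; have bU i : b`_i \in U.
  have [lt|ge] := ltnP i (\dim U).
    by apply/vbasis_mem/mem_nth; rewrite size_tuple.
  by rewrite nth_default ?size_tuple // mem0v.
transitivity (\sum_i \sum_(k < \dim U) coord b k (p (fdelta i)) * (f b`_k i : algC)).
  rewrite exchange_big; apply: eq_bigr => k _ /=.
  rewrite -[in LHS](pid _ (fU _ (bU k))) [in LHS](fdelta_sum (f _)).
  rewrite !linear_sum; apply: eq_bigr => i _.
  by rewrite !linearZ mulrC.
apply: eq_bigr => i _.
rewrite [in RHS](coord_vbasis (pU (fdelta i))) linear_sum sum_ffunE.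
by apply: eq_bigr => k _; rewrite linearZ ffunE.
Qed.

Lemma vtr_id (U : {vspace V}) : vtr U id = (\dim U)%:R.
Proof.
rewrite /vtr -[in RHS](card_ord (\dim U)) -sumr_const.
apply: eq_bigr => i _; rewrite coord_free ?eqxx //.
by case/andP: (vbasisP U).
Qed.

Lemma vtr0 (f : V -> V) : vtr 0%VS f = 0.
Proof. by rewrite /vtr big1 // => -[i lt_i]; exfalso; move: lt_i; rewrite dimv0. Qed.

Lemma ftr_projector (U : {vspace V}) (p : {linear V -> V}) :
    (forall v, p v \in U) -> (forall u, u \in U -> p u = u) ->
  ftr p = (\dim U)%:R.
Proof. by move=> pU pid; rewrite -vtr_id; symmetry; apply: (@vtr_ftr U idfun p). Qed.

(** Here [h] and [h'] are mutually inverse only between [U] and [U'], so projections are inserted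
    around them before the trace is rotated on the whole space. *)
Lemma vtr_conj (U U' : {vspace V}) (f f' h h' : {linear V -> V}) :
    (forall u, u \in U -> f u \in U) ->
    (forall u, u \in U -> h u \in U') -> (forall u, u \in U' -> h' u \in U) ->
    (forall u, u \in U -> h' (h u) = u) -> (forall u, u \in U' -> h (h' u) = u) ->
    (forall u, u \in U' -> f' u = h (f (h' u))) ->
  vtr U' f' = vtr U f.
Proof.
move=> fU hU hU' hK hK' f'E.
rewrite (vtr_ftr (p := projv U) fU); first last.
- exact: projv_id.
- exact: memv_pi.
pose p' : 'End(V) := projv U'.
rewrite (@vtr_ftr U' f' p'); first last.
- exact: projv_id.
- exact: memv_pi.
- by move=> u uU'; rewrite f'E // hU // fU // hU'.
pose g v := f (projv U (h' (p' v))).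
transitivity (ftr (fun v => h (g v))).
  apply: eq_ftr => v; rewrite f'E ?memv_pi // /g projv_id // hU' //.
  exact: memv_pi.
rewrite (ftrC h (f \o projv U \o (h' \o p'))) /=.
rewrite (ftrC (f \o projv U) (h' \o p' \o h)) /= [RHS]ftrC.
rewrite -[LHS]/(ftr (fun v => h' (p' (h (f (projv U v)))))).
suff e v : h' (p' (h (f (projv U v)))) = projv U (f (projv U v)).
  by rewrite (eq_ftr e) (ftrC (projv U) (f \o projv U)) /= (ftrC f (projv U \o projv U)) /=;
     apply: eq_ftr => v; rewrite !(projv_id (memv_pi _ _ _)).
have fv : f (projv U v) \in U by rewrite fU // memv_pi.
by rewrite [p' _](projv_id (hU _ fv)) hK // (projv_id fv).
Qed.

Section Graded.

Variables (K : finType) (D : {set K}) (C : K -> {vspace V}) (U0 : {vspace V}).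
Hypothesis indepC : forall u : K -> V,
  (forall k, k \in D -> u k \in C k) -> \sum_(k in D) u k \in U0 ->
  forall k, k \in D -> u k = 0.

Let rest k : {vspace V} := (U0 + \sum_(j in D | j != k) C j)%VS.

Let cap_rest k : k \in D -> (C k :&: rest k = 0)%VS.
Proof.
move=> kD; apply/eqP; rewrite -subv0; apply/subvP=> u /memv_capP[uC].
case/memv_addP=> u0 u0U [v /memv_sumP[w wC ->] def_u].
pose z j := if j == k then u else - w j.
have zC j : j \in D -> z j \in C j.
  move=> jD; rewrite /z; have [->//|jk] := eqVneq j k.
  by rewrite memvN wC // jD.
rewrite memv0; apply/eqP.
rewrite -[u]/(if true then u else - w k) -[true](eqxx k) -/(z k).
apply: indepC => //; rewrite (bigD1 k) //= {1}/z eqxx def_u.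
rewrite [X in _ + X](eq_bigr (fun j => - w j)) => [|j /andP[_ /negPf jk]]; last by rewrite /z jk.
by rewrite sumrN addrK.
Qed.

Let cap_U0 : (U0 :&: \sum_(j in D) C j = 0)%VS.
Proof.
apply/eqP; rewrite -subv0; apply/subvP=> u /memv_capP[uU] /memv_sumP[w wC def_u].
rewrite memv0 def_u; apply/eqP/big1 => k kD.
by apply: indepC => //; rewrite -def_u.
Qed.

Let q k : 'End(V) := daddv_pi (C k) (rest k).
Let q0 : 'End(V) := daddv_pi U0 (\sum_(j in D) C j)%VS.

Let daddv_pi0 (A B : {vspace V}) u : (A :&: B = 0)%VS -> u \in B -> daddv_pi A B u = 0.
Proof.
move=> AB uB; have BA : (B :&: A = 0)%VS by rewrite capvC.
have := daddv_pi_add AB (w := u).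
rewrite (daddv_pi_id BA uB) => /(_ (subvP (addvSr _ _) _ uB)) /eqP.
by rewrite -[X in _ == X]add0r (inj_eq (addIr u)) => /eqP.
Qed.

Let q_id k u : k \in D -> u \in C k -> q k u = u.
Proof. by move=> kD; apply/daddv_pi_id/cap_rest. Qed.

Let q_U0 k u : k \in D -> u \in U0 -> q k u = 0.
Proof.
by move=> kD uU; apply: daddv_pi0 (cap_rest kD) _; apply: (subvP (addvSl _ _)).
Qed.

Let q_other k j u : k \in D -> j \in D -> j != k -> u \in C j -> q k u = 0.
Proof.
move=> kD jD jk uC; apply: daddv_pi0 (cap_rest kD) _.
apply/(subvP (addvSr _ _))/(subvP (sumv_sup j _ (subvv _))) => //.
by rewrite jD.
Qed.

Let q0_id u : u \in U0 -> q0 u = u.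
Proof. exact: daddv_pi_id. Qed.

Let q0_C k u : k \in D -> u \in C k -> q0 u = 0.
Proof.
by move=> kD uC; apply: daddv_pi0 => //; apply: (subvP (sumv_sup k _ (subvv _))).
Qed.

(** Modulo [U0] each summand [C k] is sent into [C (sg k)], so only the blocks with [sg k == k] lie
    on the diagonal. The group algebra is treated with [U0] zero, the Orlik-Solomon algebra with
    [U0] the ideal of relations. *)
Lemma graded_vtr (f : {linear V -> V}) (sg : K -> K) :
    (forall u, u \in U0 -> f u \in U0) ->
    (forall k u, k \in D -> u \in C k -> f u \in (C (sg k) + U0)%VS) ->
    (forall k, k \in D -> sg k \in D) ->
  vtr (U0 + \sum_(k in D) C k)%VS f - vtr U0 f
    = \sum_(k in D | sg k == k) (vtr (C k + U0)%VS f - vtr U0 f).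
Proof.
move=> fU0 fC sgD.
have tr0 : vtr U0 f = ftr (fun v => f (q0 v)).
  by apply: vtr_ftr => // v; apply: memv_pi.
have trk k : k \in D -> sg k == k ->
    vtr (C k + U0)%VS f = ftr (fun v => f (q0 v)) + ftr (fun v => f (q k v)).
  move=> kD /eqP sgk; rewrite -ftrD.
  rewrite (@vtr_ftr _ f (q0 + q k : 'End(V))%R).
  - by apply: eq_ftr => v; rewrite /= add_lfunE linearD.
  - move=> u /memv_addP[c cC [c0 c0U ->]]; rewrite linearD memvD //.
      by have := fC k c kD cC; rewrite sgk.
    by apply: (subvP (addvSr _ _)); apply: fU0.
  - move=> v; rewrite /= add_lfunE addrC memv_add ?memv_pi //.
  - move=> u /memv_addP[c cC [c0 c0U ->]]; rewrite /= add_lfunE !linearD /=.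
    by rewrite (q0_C kD cC) (q0_id c0U) (q_id kD cC) (q_U0 kD c0U) addr0 add0r addrC.
have -> : vtr (U0 + \sum_(k in D) C k)%VS f
    = ftr (fun v => f (q0 v)) + \sum_(k in D) ftr (fun v => f (q k v)).
  rewrite -ftr_sum -ftrD.
  rewrite (@vtr_ftr _ f (q0 + \sum_(k in D) q k : 'End(V))%R).
  - by apply: eq_ftr => v; rewrite /= add_lfunE linearD sum_lfunE linear_sum.
  - move=> u /memv_addP[c0 c0U [c /memv_sumP[w wC ->] ->]].
    rewrite linearD linear_sum /= memvD //.
      by apply: (subvP (addvSl _ _)); apply: fU0.
    apply: memv_suml => k kD; have := fC k _ kD (wC k kD).
    apply: subvP; rewrite subv_add addvSl andbT.
    apply: subv_trans (addvSr _ _); exact: sumv_sup (sgD _ kD) (subvv _).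
  - move=> v; rewrite /= add_lfunE sum_lfunE memv_add ?memv_pi //.
    by apply: memv_sumr => k kD; apply: memv_pi.
  - move=> u /memv_addP[c0 c0U [c /memv_sumP[w wC ->] ->]].
    rewrite /= add_lfunE !linearD /= q0_id // linear_sum /= big1 => [|k kD]; last first.
      by rewrite (q0_C kD) // wC.
    rewrite addr0 !sum_lfunE big1 ?add0r => [|k kD]; last by rewrite q_U0.
    congr (_ + _); apply: eq_bigr => k kD.
    rewrite linear_sum (bigD1 k) //= q_id ?wC // big1 ?addr0 // => j /andP[jD jk].
    by rewrite (q_other (j := j)) ?wC.
rewrite tr0 addrC addKr (bigID (fun k => sg k == k)) /= [X in _ + X]big1 ?addr0.
  by apply: eq_bigr => k /andP[kD sgk]; rewrite (trk k kD sgk) addrC addKr.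
move=> k /andP[kD sgk].
(* As [q k] is idempotent, cyclicity turns this trace into that of [q k \o f \o q k], which
   vanishes: [f] sends [C k] into another summand plus [U0], and [q k] kills both. *)
have -> : ftr (fun v => f (q k v)) = ftr (fun v => (f \o q k) (q k v)).
  by apply: eq_ftr => v /=; rewrite [q k (q k v)]q_id ?memv_pi.
rewrite (ftrC (f \o q k) (q k)) /=; apply: big1 => i _.
have /memv_addP[c cC [c0 c0U ->]] := fC k _ kD (memv_pi (C k) (rest k) (fdelta i)).
rewrite linearD /= (q_U0 kD c0U) (q_other kD (sgD _ kD) sgk cC) addr0.
by rewrite ffunE.
Qed.

End Graded.

End FunctionSpaceTrace.

(** * Roots of -1 of least argument *)

Section RootsOfMinusOne.

(** On the closed upper half of the unit circle the argument decreases as the real part grows, so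
    [z / c] has its argument between -pi and 0. *)
Lemma Im_div_le0 (z c : algC) : `|z| = 1 -> `|c| = 1 -> 0 <= 'Im z -> 0 <= 'Im c ->
  'Re c <= 'Re z -> 'Im (z / c) <= 0.
Proof.
move=> z1 c1 zI cI le_cz.
rewrite Im_div c1 expr1n divr1 subr_le0.
have sqz : 'Re z ^+ 2 + 'Im z ^+ 2 = 1 by rewrite -normC2_Re_Im z1 expr1n.
have sqc : 'Re c ^+ 2 + 'Im c ^+ 2 = 1 by rewrite -normC2_Re_Im c1 expr1n.
have eI : 'Im c ^+ 2 - 'Im z ^+ 2 = 'Re z ^+ 2 - 'Re c ^+ 2.
  by apply/eqP; rewrite subr_eq addrAC eq_sym subr_eq sqz [in X in _ == X]addrC sqc.
case: (real_ge0P (Creal_Re z)) => [z_ge0|z_lt0].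
  case: (real_ge0P (Creal_Re c)) => [c_ge0|c_lt0]; last first.
    by rewrite (le_trans (y := 0)) ?mulr_ge0 // mulr_le0_ge0 // ltW.
  apply: ler_pM => //; rewrite -(@ler_pXn2r _ 2) ?nnegrE // -subr_ge0 eI subr_ge0.
  by rewrite ler_pXn2r ?nnegrE.
have c_lt0 : 'Re c < 0 by apply: le_lt_trans z_lt0.
rewrite -lerN2 -!mulNr.
apply: ler_pM; rewrite ?lerN2 ?oppr_ge0 ?(ltW z_lt0) //.
rewrite -(@ler_pXn2r _ 2) ?nnegrE // -subr_le0 eI subr_le0 -[X in _ <= X]sqrrN -sqrrN.
by rewrite ler_pXn2r ?nnegrE ?oppr_ge0 ?lerN2 // ltW.
Qed.

Variable m : nat.
Hypothesis m_gt1 : (1 < m)%N.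
Let m_gt0 : (0 < m)%N := ltnW m_gt1.
(** The chosen root has the largest real part among those in the upper half plane: it is exp (i pi /
    m). *)
Let z : algC := m.-root (-1).

Let zm : z ^+ m = -1. Proof. exact: rootCK. Qed.
Let z_norm : `|z| = 1. Proof. by rewrite norm_rootC normrN1 rootC1. Qed.
Let zI : 0 <= 'Im z. Proof. exact: Im_rootC_ge0. Qed.
Let z0 : z != 0. Proof. by rewrite -normr_eq0 z_norm oner_eq0. Qed.

Let z2m : z ^+ (2 * m) = 1.
Proof. by rewrite mulnC exprM zm sqrrN expr1n. Qed.

Let root_norm (y : algC) : y ^+ (2 * m) = 1 -> `|y| = 1.
Proof.
move=> y1; apply/eqP; rewrite -(@pexpr_eq1 _ _ (2 * m)) ?muln_gt0 //.
by rewrite -normrX y1 normr1.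
Qed.

Let real_norm1 (y : algC) : `|y| = 1 -> 'Im y = 0 -> y = 1 \/ y = -1.
Proof.
move=> y1 /Creal_ImP yR; have : y ^+ 2 = 1 by rewrite -(real_normK yR) y1 expr1n.
by move/eqP; rewrite sqrf_eq1 => /orP[]/eqP; [left|right].
Qed.

Let Imz_gt0 : 0 < 'Im z.
Proof.
rewrite lt_def zI andbT; apply/eqP=> /(real_norm1 z_norm)[] zE.
  by move: zm => /eqP; rewrite zE expr1n -subr_eq0 opprK (pnatr_eq0 _ 2).
by have := rootC_lt0 (-1 : algC) m_gt1; rewrite -/z zE oppr_lt0 ltr01.
Qed.

(* No [2m]-th root of unity has its argument strictly between those of 1 and z:
   either it or its quotient into z would be an m-th root of -1 beating z. *)
Let arg_min (y : algC) : y ^+ (2 * m) = 1 -> 0 < 'Im y -> 'Im (z / y) <= 0.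
Proof.
move=> y2m Iy; have y1 := root_norm y2m.
case: (real_leP (Creal_Im (z / y)) (rpred0 _)) => // Izy.
have : (y ^+ m) ^+ 2 = 1 by rewrite -exprM mulnC.
move/eqP; rewrite sqrf_eq1 => /orP[]/eqP ym.
  have zym : (z / y) ^+ m = -1 by rewrite expr_div_n zm ym divr1.
  have zy1 : `|z / y| = 1 by rewrite normf_div z_norm y1 divr1.
  have := Im_div_le0 z_norm zy1 zI (ltW Izy) (rootC_Re_max m_gt0 zym (ltW Izy)).
  by rewrite invf_div mulrCA divff // mulr1 => /(lt_le_trans Iy); rewrite ltxx.
have := Im_div_le0 z_norm y1 zI (ltW Iy) (rootC_Re_max m_gt0 ym (ltW Iy)).
by move/(lt_le_trans Izy); rewrite ltxx.
Qed.

(** Dividing [u] by [z] turns it towards 1 but not beyond, by [arg_min]; the real part must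
    therefore increase strictly. *)
Let no_step (u : algC) : u ^+ (2 * m) = 1 -> 0 < 'Im u -> 'Re (u / z) <= 'Re u -> False.
Proof.
move=> u2m Iu le_uz; have u1 := root_norm u2m.
have u0 : u != 0 by rewrite -normr_eq0 u1 oner_eq0.
have uz1 : `|u / z| = 1 by rewrite normf_div z_norm u1 divr1.
have uzI : 0 <= 'Im (u / z).
  have := arg_min u2m Iu; rewrite -invf_div ImV uz1 expr1n invr1 mulr1.
  by rewrite oppr_le0.
have := Im_div_le0 u1 uz1 (ltW Iu) uzI le_uz.
by rewrite invf_div mulrCA divff // mulr1 => /(lt_le_trans Imz_gt0); rewrite ltxx.
Qed.

(** Choose [y * z ^+ i] of maximal real part. By [no_step], applied to it or to its inverse, it is
    real; it is not -1, since one more turn by [z] would increase the real part. *)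
Let z_generates (y : algC) : y ^+ (2 * m) = 1 -> exists i, y = z ^+ i.
Proof.
move=> y2m; have m2_gt0 : (0 < 2 * m)%N by rewrite muln_gt0.
pose i0 := Ordinal m2_gt0.
have [/= i _ imax] := @real_arg_maxP algC _ i0 xpredT
  (fun i : 'I_(2 * m) => 'Re (y * z ^+ i)) isT (fun i _ => Creal_Re _).
have {}imax k : 'Re (y * z ^+ k) <= 'Re (y * z ^+ i).
  have -> : z ^+ k = z ^+ (k %% (2 * m)).
    by rewrite {1}(divn_eq k (2 * m)) exprD mulnC exprM z2m expr1n mul1r.
  exact: (imax (Ordinal (ltn_pmod k m2_gt0))).
pose u := y * z ^+ i; rewrite -/u in imax.
have u2m : u ^+ (2 * m) = 1 by rewrite exprMn y2m exprAC z2m expr1n mulr1.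
have u1 := root_norm u2m.
have u0 : u != 0 by rewrite -normr_eq0 u1 oner_eq0.
have [Iu|Iu|Iu] := real_ltgt0P (Creal_Im u).
- exfalso; apply: (no_step u2m Iu).
  have -> : z^-1 = z ^+ (2 * m).-1.
    by apply: (mulfI z0); rewrite divff // -exprS prednK.
  by rewrite /u -mulrA -exprD.
- exfalso; apply: (@no_step u^-1).
  + by rewrite exprVn u2m invr1.
  + by rewrite ImV u1 expr1n divr1 oppr_gt0.
  + rewrite -invfM !ReV normrM u1 z_norm mulr1 expr1n !divr1.
    by have := imax i.+1; rewrite exprSr mulrA.
exists ((2 * m) - i)%N; have zi0 : z ^+ i != 0 by rewrite expf_neq0.
apply: (mulIf zi0); rewrite -exprD subnK ?z2m; last exact/ltnW/ltn_ord.
case: (real_norm1 u1 Iu) => // uN1.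
have := imax i.+1; rewrite exprSr mulrA -/u uN1 mulN1r !raddfN /= lerN2.
have -> : 'Re 1 = 1 :> algC by apply/Creal_ReP; rewrite rpred1.
move=> ge1; have := leif_Re_Creal z; rewrite z_norm => -[le1 eq1].
have /eqP := Im_rootC_ge0 (-1 : algC) m_gt1.
have : 0 <= z by rewrite -eq1 eq_le ge1 le1.
by move/ger0_real/Creal_ImP => z_eq0; have := Imz_gt0; rewrite z_eq0 ltxx.
Qed.

Let z_prim : (2 * m).-primitive_root z.
Proof.
have m2_gt0 : (0 < 2 * m)%N by rewrite muln_gt0.
have [w prim_w] := C_prim_root_exists m2_gt0.
have [i wE] := z_generates (prim_expr_order prim_w).
have [k prim_k] := prim_order_exists m2_gt0 z2m.
move=> dv_k; suff <- : k = (2 * m)%N by [].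
apply/eqP; rewrite eqn_dvd dv_k /= (prim_order_dvd prim_w) wE exprAC.
by rewrite (prim_expr_order prim_k) expr1n.
Qed.

Lemma Im_rootN1_gt0 : 0 < 'Im z.
Proof. exact: Imz_gt0. Qed.

(** The number is sin (k pi / m). If it became negative from k to k + 1, then [arg_min] for
    [- z ^+ k.+1] would force [z ^+ k] to be real, which primitivity of [z] as a root of unity of
    order 2m allows only for k = 0. *)
Lemma Im_rootN1_exp k : (k <= m)%N -> 0 <= 'Im (z ^+ k).
Proof.
elim: k => [|k IH] lt_km; first by rewrite expr0 (Creal_ImP _ _) // rpred1.
case: (real_ge0P (Creal_Im (z ^+ k.+1))) => // Ilt.
have Ik := IH (ltnW lt_km).
have y2m : (- z ^+ k.+1) ^+ (2 * m) = 1.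
  by rewrite exprM sqrrN -exprM exprAC z2m expr1n.
have := arg_min y2m; rewrite raddfN oppr_gt0 /= => /(_ Ilt).
rewrite exprS invrN mulrN invfM mulrA divff // mul1r raddfN /= oppr_le0.
rewrite ImV normrX z_norm !expr1n divr1 oppr_ge0 => Ik'.
have /(real_norm1 _) : 'Im (z ^+ k) = 0 by apply/eqP; rewrite eq_le Ik' Ik.
rewrite normrX z_norm expr1n => /(_ erefl) zk.
have : z ^+ (2 * k) == 1 by case: zk => zk; rewrite mulnC exprM zk ?sqrrN expr1n.
rewrite -(prim_order_dvd z_prim) => /dvdn_leq.
rewrite leq_mul2l /= [(m <= k)%N]leqNgt lt_km muln_gt0 /=.
case: (posnP k) => [k0 _|_ /(_ isT) //].
by have := lt_trans Ilt Imz_gt0; rewrite k0 expr1 ltxx.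
Qed.

End RootsOfMinusOne.

Lemma subset_ind (T : finType) (Q : {set T} -> Prop) :
  (forall L : {set T}, (forall K : {set T}, K \subset L -> K != L -> Q K) -> Q L) ->
  forall L, Q L.
Proof.
move=> QH L; have [k] := ubnP #|L|; elim: k L => // k IH L; rewrite ltnS => le_k.
apply: QH => K sKL KL; apply: IH; apply: leq_trans le_k; apply: proper_card.
by rewrite properEneq KL.
Qed.

(** * Length with respect to a set of generators *)

Section Length.

Variable gT : finGroupType.
Implicit Types (J : {set gT}) (s t w : gT).

Lemma gen_mulg_ind J (P : gT -> Prop) :
    P 1%g -> (forall s w, s \in J -> w \in <<J>>%g -> P w -> P (s * w)%g) ->
  forall w, w \in <<J>>%g -> P w.
Proof.
move=> P1 PM w /gen_prodgP[n [c Jc ->]].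
elim: n c Jc => [|n IH] c Jc; first by rewrite big_ord0.
rewrite big_ord_recl; apply: PM => //; last exact: IH.
by apply: group_prod => i _; apply/mem_gen/Jc.
Qed.

Lemma SballS J k : Sball J k.+1 = Sball J k :|: (Sball J k * J)%g.
Proof. by []. Qed.

Lemma SballP J k w :
  reflect (exists2 c : seq gT, all (mem J) c & (size c <= k)%N /\ w = (\prod_(x <- c) x)%g)
          (w \in Sball J k).
Proof.
elim: k w => [|k IH] w.
  rewrite /= inE; apply: (iffP eqP) => [->|[c _ [le_c ->]]].
    by exists [::]; rewrite ?big_nil.
  by move: le_c; rewrite leqn0 => /nilP->; rewrite big_nil.
rewrite /= inE; apply: (iffP orP) => [[/IH[c cJ [le_c ->]]|/mulsgP[x s /IH[c cJ [le_c ->]] sJ ->]]|].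
- by exists c => //; rewrite leqW.
- exists (rcons c s); first by rewrite all_rcons /= sJ.
  by rewrite size_rcons big_rcons /= ltnS.
case; elim/last_ind=> [|c s _] cJ [le_c ->].
  by left; apply/IH; exists [::].
right; move: cJ le_c; rewrite all_rcons size_rcons ltnS => /andP[sJ cJ] le_c.
by rewrite big_rcons /= mem_mulg //; apply/IH; exists c.
Qed.

Lemma Sball_mono J : {homo Sball J : i j / (i <= j)%N >-> i \subset j}.
Proof.
move=> i j le_ij; apply/subsetP=> w /SballP[c cJ [le_c ->]].
by apply/SballP; exists c => //; rewrite (leq_trans le_c).
Qed.

(** A ball that equals the next one is stationary, and strict growth cannot last [#|gT|] steps. So
    the default value [#|gT|] in [coxlen] is harmless on the generated group. *)
Lemma Sball_gen J w : w \in <<J>>%g -> w \in Sball J #|gT|.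
Proof.
have stab k : (k < #|Sball J k|)%N \/ Sball J k.+1 = Sball J k.
  elim: k => [|k [lt_k|eq_k]]; first by left; rewrite /= cards1.
    have := Sball_mono J (leqnSn k); rewrite subEproper => /orP[/eqP e|/proper_card lt].
      by right; rewrite [LHS]SballS -e -SballS.
    by left; apply: leq_ltn_trans lt.
  by right; rewrite [LHS]SballS eq_k -SballS.
have [|stN] := stab #|gT|; first by rewrite ltnNge max_card.
have {}stN i : Sball J (i + #|gT|) = Sball J #|gT|.
  by elim: i => // i IH; rewrite addSn SballS IH -SballS.
case/gen_prodgP=> n [c Jc ->]; rewrite -(stN n).
apply/SballP; exists [seq c i | i <- enum 'I_n].
  by apply/allP=> _ /mapP[i _ ->]; apply: Jc.
by rewrite size_map size_enum_ord leq_addr big_map enumT.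
Qed.

Lemma coxlen_le J k w : w \in Sball J k -> (coxlen J w <= k)%N.
Proof.
move=> wk; rewrite /coxlen; have [le_k|gt_k] := leqP k #|gT|; last first.
  apply: leq_trans (ltnW gt_k).
  elim/big_ind: _ => [//|x y xN yN|[i lt_i] _ //].
  by rewrite geq_min xN.
have lt_k : (k < #|gT|.+1)%N by [].
have := mem_index_enum (Ordinal lt_k); elim: (index_enum _) => // i r IH.
rewrite inE big_cons => /orP[/eqP<-|/IH le_r]; first by rewrite /= wk geq_minl.
by case: ifP => _; rewrite ?geq_min le_r ?orbT.
Qed.

Lemma Sball_coxlen J w : w \in <<J>>%g -> w \in Sball J (coxlen J w).
Proof.
move=> wJ; rewrite /coxlen; elim/big_ind: _ => [|x y xN yN|i //].
  exact: Sball_gen.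
by rewrite /minn; case: ifP.
Qed.

Lemma coxlen_word J w : w \in <<J>>%g ->
  exists c : seq gT, [/\ all (mem J) c, size c = coxlen J w & w = (\prod_(x <- c) x)%g].
Proof.
case/Sball_coxlen/SballP=> c cJ [le_c wE]; exists c; split=> //.
by apply/eqP; rewrite eqn_leq le_c coxlen_le //; apply/SballP; exists c.
Qed.

Lemma coxlen_mul J s w : s \in J -> w \in <<J>>%g ->
  (coxlen J (s * w)%g <= (coxlen J w).+1)%N.
Proof.
move=> sJ /coxlen_word[c [cJ cE wE]]; apply/coxlen_le/SballP.
by exists (s :: c); rewrite /= ?sJ // big_cons cE -wE.
Qed.

Lemma coxlen_descent J w : {in J, forall s, #[s]%g = 2%N} -> w \in <<J>>%g -> w != 1%g ->
  exists2 s, s \in J & (coxlen J (s * w)%g < coxlen J w)%N.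
Proof.
move=> oJ wJ; have [[|s c] [cJ <- ->]] := coxlen_word wJ; first by rewrite big_nil eqxx.
case/andP: cJ => sJ cJ _; exists s => //=; rewrite ltnS big_cons mulgA.
have -> : (s * s)%g = 1%g by rewrite -(expgS s 1) -(oJ _ sJ) expg_order.
by rewrite mul1g; apply/coxlen_le/SballP; exists c.
Qed.

(** The alternating product of k letters that ends in [s]; its first letter depends on the parity of
    k, see [alt_word_rec]. *)
Fixpoint alt_word s t (k : nat) : gT :=
  if k is k'.+1 then (alt_word t s k' * s)%g else 1%g.

Lemma alt_word_rec s t k :
  alt_word s t k.+1 = ((if odd k then t else s) * alt_word s t k)%g.
Proof.
elim: k s t => [|k IH] s t; first by rewrite /= mulg1 mul1g.
by rewrite -[LHS]/(alt_word t s k.+1 * s)%g IH -mulgA /=; case: (odd k).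
Qed.

Lemma alt_word_braid s t k : #[s]%g = 2%N -> #[t]%g = 2%N ->
  ((alt_word t s k)^-1 * alt_word s t k = (t * s) ^+ k)%g.
Proof.
move=> os ot; have invs (x : gT) : #[x]%g = 2%N -> (x^-1 = x)%g.
  by move=> ox; rewrite invg_expg ox.
have conj_exp (x y : gT) j : (x * (y * x) ^+ j * y = (x * y) ^+ j.+1)%g.
  elim: j => [|j IH]; first by rewrite expg0 mulg1 expg1.
  by rewrite [RHS]expgS -IH expgS !mulgA.
elim: k s t os ot => [|k IH] s t os ot; first by rewrite /= mulg1 invg1.
by rewrite /= invMg (invs t ot) !mulgA -(mulgA t) (IH t s ot os) conj_exp.
Qed.

End Length.

(** * Determinant of a restriction *)

Section RestrictedDeterminant.

Variable n : nat.

(** Any basis [B] of [U] may replace [row_base U]: the base changes [C] and [D] between them are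
    inverse to each other, so their determinants cancel. *)
Lemma restr_detE r (U A : 'M[algC]_n) (B : 'M[algC]_(r, n)) (M : 'M[algC]_r) :
  row_free B -> (B :=: U)%MS -> B *m A = M *m B -> restr_det U A = \det M.
Proof.
move=> freeB eqBU BA; have er : r = \rank U by rewrite -eqBU; apply/esym/eqP.
subst r; rewrite /restr_det; set R := row_base U.
have [C RC] : exists C, R = C *m B by apply/submxP; rewrite eq_row_base eqBU.
have [D BD] : exists D, B = D *m R by apply/submxP; rewrite eq_row_base eqBU.
have freeR : row_free R by apply: row_base_free.
have CD : C *m D = 1%:M.
  by apply: (row_free_inj freeR); rewrite -mulmxA -BD -RC mul1mx.
have -> : R *m A = C *m M *m D *m R.
  by rewrite [in LHS]RC -[in LHS]mulmxA BA -[in RHS]mulmxA -BD mulmxA.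
rewrite -(mulmxA _ R) mulmxVp // mulmx1 !det_mulmx mulrAC -det_mulmx CD det1.
by rewrite mul1r.
Qed.

Lemma restr_det_conj (U U' A A' g : 'M[algC]_n) :
    g \in unitmx -> (U' :=: U *m g)%MS -> g *m A' = A *m g -> (U *m A <= U)%MS ->
  restr_det U' A' = restr_det U A.
Proof.
move=> g_unit eqU' AA' UA; set R := row_base U.
have RU : (R :=: U)%MS by apply: eq_row_base.
apply: (@restr_detE _ U' A' (R *m g) (R *m A *m pinvmx R)).
- by rewrite /row_free mxrankMfree ?row_free_unit //; apply: row_base_free.
- exact: (eqmx_trans (eqmxMr g RU) (eqmx_sym eqU')).
rewrite -[LHS]mulmxA AA' [LHS]mulmxA [RHS]mulmxA; congr (_ *m g).
apply/esym/mulmxKpV.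
by rewrite eq_row_base (submx_trans _ UA) // submxMr // eq_row_base.
Qed.

End RestrictedDeterminant.


(** * The group algebra and the exterior algebra *)

Section GroupAlgebraConv.

Variable gT : finGroupType.
Implicit Types (a b c : CW gT) (g h : gT).

Lemma convE a b g : conv a b g = \sum_h (a h : algC) * (b (h^-1 * g)%g : algC).
Proof. by rewrite ffunE. Qed.

Lemma conv_gdeltar a g h : conv a (gdelta g) h = a (h * g^-1)%g.
Proof.
rewrite convE (bigD1 (h * g^-1)%g) //= big1 => [|k kN].
  by rewrite ffunE invMg invgK mulgKV eqxx mulr1 addr0.
rewrite ffunE; case: eqP => [e|_]; last by rewrite mulr0.
by case/eqP: kN; rewrite -e invMg invgK mulKVg.
Qed.

Lemma conv_gdeltal a g h : conv (gdelta g) a h = a (g^-1 * h)%g.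
Proof.
rewrite convE (bigD1 g) //= big1 => [|k kN]; first by rewrite ffunE eqxx mul1r addr0.
by rewrite ffunE (negPf kN) mul0r.
Qed.

(** The exchanged arguments let right multiplication carry its own linear structure. *)
Definition convr b a : CW gT := conv a b.

Fact convr_is_linear b : linear (convr b).
Proof.
move=> k x y; apply/ffunP=> g; rewrite ffunE [in RHS]ffunE [in RHS]ffunE !convE.
rewrite scaler_sumr -big_split; apply: eq_bigr => h _ /=.
by rewrite !ffunE mulrDl scalerAl.
Qed.

HB.instance Definition _ b :=
  GRing.isLinear.Build algC (CW gT) (CW gT) *:%R (convr b) (convr_is_linear b).

Fact conv_is_linear a : linear (conv a).
Proof.
move=> k x y; apply/ffunP=> g; rewrite ffunE [in RHS]ffunE [in RHS]ffunE !convE.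
rewrite scaler_sumr -big_split; apply: eq_bigr => h _ /=.
by rewrite !ffunE mulrDr scalerAr.
Qed.

HB.instance Definition _ a :=
  GRing.isLinear.Build algC (CW gT) (CW gT) *:%R (conv a) (conv_is_linear a).

Lemma convZl (k : algC) a b : conv (k *: a) b = k *: conv a b.
Proof. by rewrite -[LHS]/(convr b _) linearZ. Qed.

Lemma convBl a b c : conv (a - b) c = conv a c - conv b c.
Proof. by rewrite -[LHS]/(convr c _) raddfB. Qed.

Lemma conv_suml (I : Type) (r : seq I) (P : pred I) (F : I -> CW gT) b :
  conv (\sum_(i <- r | P i) F i) b = \sum_(i <- r | P i) conv (F i) b.
Proof. by rewrite -[LHS]/(convr b _) raddf_sum. Qed.

Lemma gdelta_sum a : a = \sum_h (a h : algC) *: gdelta h.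
Proof. exact: fdelta_sum. Qed.

Lemma conv_gdelta g h : conv (gdelta g) (gdelta h) = gdelta (g * h)%g.
Proof.
by apply/ffunP=> k; rewrite conv_gdeltal !ffunE -(can_eq (mulKg g)) mulKVg.
Qed.

Lemma conv_gdeltaA a g h : conv (conv a (gdelta g)) (gdelta h) = conv a (gdelta (g * h)%g).
Proof. by apply/ffunP=> k; rewrite !conv_gdeltar invMg mulgA. Qed.

Lemma convA_gdelta a b g : conv (conv a b) (gdelta g) = conv a (conv b (gdelta g)).
Proof.
apply/ffunP=> k; rewrite conv_gdeltar !convE; apply: eq_bigr => h _.
by rewrite conv_gdeltar mulgA.
Qed.

Lemma convA a b c : conv (conv a b) c = conv a (conv b c).
Proof.
rewrite [c]gdelta_sum !linear_sum; apply: eq_bigr => g _.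
by rewrite !linearZ /= convA_gdelta.
Qed.

Lemma conv1r a : conv a (gdelta 1%g) = a.
Proof. by apply/ffunP=> k; rewrite conv_gdeltar invg1 mulg1. Qed.

Lemma conv1l a : conv (gdelta 1%g) a = a.
Proof. by apply/ffunP=> k; rewrite conv_gdeltal invg1 mul1g. Qed.

Definition cres (H : {set gT}) a : CW gT := [ffun g => if g \in H then a g else 0].

Fact cres_is_linear H : linear (cres H).
Proof.
move=> k x y; apply/ffunP=> g; rewrite !ffunE.
by case: ifP => _; rewrite ?ffunE // scaler0 addr0.
Qed.

HB.instance Definition _ H :=
  GRing.isLinear.Build algC (CW gT) (CW gT) *:%R (cres H) (cres_is_linear H).

Lemma cres_id (H : {set gT}) a : (forall g, g \notin H -> a g = 0) -> cres H a = a.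
Proof.
by move=> a0; apply/ffunP=> g; rewrite ffunE; case: (boolP (g \in H)) => // /a0.
Qed.

(** Right translation by [H] preserves [H] and its complement, so restriction to [H] is a
    homomorphism of right modules over the group algebra of [H]. *)
Lemma cres_conv (H : {group gT}) a b : cres H (conv a (cres H b)) = conv (cres H a) (cres H b).
Proof.
apply/ffunP=> g; rewrite ffunE !convE.
under [in RHS]eq_bigr do rewrite !ffunE.
under [in LHS]eq_bigr do rewrite !ffunE.
have [gH|gH] := boolP (g \in H).
  apply: eq_bigr => h _; rewrite groupMr // groupV.
  by case: ifP; rewrite ?mulr0.
rewrite big1 // => h _; have [hH|_] := boolP (h \in H); last by rewrite mul0r.
by rewrite groupMl ?groupV // (negPf gH) mulr0.
Qed.

Lemma cres_delta (H : {set gT}) g : cres H (gdelta g) = (g \in H)%:R *: gdelta g.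
Proof.
apply/ffunP=> h; rewrite !ffunE; case: eqP => [->|_]; last by rewrite scaler0 if_same.
by case: ifP; rewrite /GRing.scale /= ?mul1r ?mul0r.
Qed.

Lemma cres_fdelta (H : {set gT}) g : cres H (fdelta g) = (g \in H)%:R *: gdelta g.
Proof. exact: cres_delta. Qed.

End GroupAlgebraConv.

(** * Signs and the action on the exterior algebra *)

Section ExteriorAction.

Variable gT : finGroupType.
Implicit Types (A B D : {set gT}) (a b t w g h : gT).

Local Notation sg := (fun b : bool => (-1) ^+ b : algC).

Lemma sign_card_prod D (R : pred gT) :
  (-1) ^+ #|[set u in D | R u]| = \prod_(u in D) sg (R u) :> algC.
Proof.
rewrite -sum1_card expr_sum (big_mkcond (mem [set _ in _ | _])) /= [RHS]big_mkcond.
by apply: eq_bigr => u _; rewrite in_set; case: (u \in D); case: (R u).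
Qed.

Lemma sign_card_prod2 A B (R : rel gT) :
  (-1) ^+ #|[set p in setX A B | R p.1 p.2]|
    = \prod_(a in A) \prod_(b in B) sg (R a b) :> algC.
Proof.
rewrite -sum1_card expr_sum (big_mkcond (mem [set _ in _ | _])) /= pair_big /= [RHS]big_mkcond.
apply: eq_bigr => -[a b] _; rewrite in_set in_setX /=.
by case: (a \in A); case: (b \in B); case: (R a b).
Qed.

Lemma ltT_irr a : ltT a a = false.
Proof. exact: ltnn. Qed.

Lemma ltTN a b : a != b -> ltT b a = ~~ ltT a b.
Proof.
move=> ab; rewrite /ltT -leqNgt [in RHS]leq_eqVlt.
by rewrite (inj_eq (@ord_inj _)) (inj_eq enum_rank_inj) eq_sym (negPf ab).
Qed.

Lemma wsignE A B : wsign A B = \prod_(a in A) \prod_(b in B) sg (ltT b a).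
Proof. exact: sign_card_prod2 A B (fun a b => ltT b a). Qed.

Lemma asignE w A :
  asign w A = \prod_(a in A) \prod_(b in A) sg (ltT a b && ltT (b ^ w) (a ^ w)).
Proof. exact: sign_card_prod2. Qed.

Lemma wsignM A B : wsign A B * wsign A B = 1.
Proof. by rewrite /wsign -exprD addnn -signr_odd odd_double. Qed.

Lemma prod_conj (F : gT -> algC) A w : \prod_(a in (A :^ w)%g) F a = \prod_(a in A) F (a ^ w)%g.
Proof. by rewrite big_imset //= => x y _ _; apply: conjg_inj. Qed.

(** Modulo 2, [asign w] counts the inversions of [w] on a set and [wsign] those between two sets.
    Pairs inside [A] or inside [B] match; for a cross pair, its order before and whether [w]
    reverses it determine its order after. *)
Lemma asignU w A B : [disjoint A & B] ->
  asign w (A :|: B) * wsign A B = asign w A * asign w B * wsign (A :^ w)%g (B :^ w)%g.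
Proof.
move=> dAB; pose s a b := sg (ltT a b && ltT (b ^ w) (a ^ w)).
have splitU F : \prod_(a in A :|: B) F a = (\prod_(a in A) F a) * \prod_(a in B) F a :> algC.
  by rewrite -bigU //; apply: eq_bigl => a; rewrite inE.
have asU : asign w (A :|: B) = (\prod_(a in A) \prod_(b in A) s a b)
    * (\prod_(a in A) \prod_(b in B) s a b) * ((\prod_(b in B) \prod_(a in A) s b a)
    * \prod_(a in B) \prod_(b in B) s a b).
  have inner a : \prod_(b in A :|: B) s a b = (\prod_(b in A) s a b) * \prod_(b in B) s a b.
    exact: splitU.
  rewrite asignE splitU (eq_bigr _ (fun a _ => inner a)) big_split; congr (_ * _).
  by rewrite (eq_bigr _ (fun a _ => inner a)) big_split.
have wsE : wsign (A :^ w)%g (B :^ w)%g = \prod_(a in A) \prod_(b in B) sg (ltT (b ^ w) (a ^ w)).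
  by rewrite wsignE prod_conj; apply: eq_bigr => a _; rewrite prod_conj.
rewrite asU wsE [in LHS]wsignE !asignE.
have cross : \prod_(a in A) \prod_(b in B) s a b * (\prod_(b in B) \prod_(a in A) s b a)
    * \prod_(a in A) \prod_(b in B) sg (ltT b a)
    = \prod_(a in A) \prod_(b in B) sg (ltT (b ^ w) (a ^ w)).
  rewrite [X in _ * X * _]exchange_big -!big_split; apply: eq_bigr => a aA /=.
  rewrite -!big_split; apply: eq_bigr => b bB /=.
  have ab : a != b by apply: contraTneq aA => ->; rewrite (disjointFl dAB bB).
  have abw : (a ^ w)%g != (b ^ w)%g by rewrite (inj_eq (@conjg_inj _ w)).
  rewrite /s (ltTN ab) (ltTN abw).
  by case: (ltT a b); case: (ltT (a ^ w) (b ^ w)); rewrite /= ?expr0 ?expr1 ?mulr1 ?mul1r ?mulrNN ?mulr1.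
rewrite -cross; rewrite /s; ring.
Qed.

Lemma asign1 A : asign 1%g A = 1.
Proof.
rewrite asignE big1 // => a _; rewrite big1 // => b _; rewrite !conjg1.
by have [->|ab] := eqVneq a b; rewrite ?ltT_irr // (ltTN ab) andbN.
Qed.

Lemma asign_set1 w t : asign w [set t] = 1.
Proof. by rewrite asignE !big_set1 ltT_irr. Qed.

Lemma asignU1 w t A : t \notin A ->
  asign w (t |: A) = asign w A * wsign [set t] A * wsign [set t ^ w]%g (A :^ w)%g.
Proof.
move=> tA; have dis : [disjoint [set t] & A] by rewrite disjoints1.
have := asignU w dis; rewrite asign_set1 mul1r conjg_set1 => e.
by rewrite -[LHS]mulr1 -(wsignM [set t] A) mulrA e mulrAC.
Qed.

(** The cocycle identity that makes [actE] a right action. Elements are removed one at a time by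
    [asignU1]; the sign [u] of the removed element against the rest, taken after [g], enters twice
    and squares to 1. *)
Lemma asign_mul g h A : asign (g * h)%g A = asign g A * asign h (A :^ g)%g.
Proof.
elim/(@subset_ind gT): A => A IH; have [->|[t tA]] := set_0Vmem A.
  by rewrite !asignE conj0g !big_set0 mulr1.
have tA' : t \notin A :\ t by rewrite !inE eqxx.
have tgA : (t ^ g)%g \notin ((A :\ t) :^ g)%g by rewrite memJ_conjg.
rewrite -(setD1K tA) conjUg conjg_set1 !asignU1 // IH ?subD1set //; last first.
  by apply: contraNneq tA' => ->.
rewrite !conjsgM !conjgM.
set u := wsign [set t ^ g]%g _; have u1 : u * u = 1 by apply: wsignM.
set x := asign g _; set y := asign h _; set z := wsign [set t] _; set v := wsign _ _.
by rewrite -[LHS]mulr1 -u1; ring.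
Qed.

Lemma eb_sum (a : Ext gT) : a = \sum_A (a A : algC) *: eb A.
Proof. exact: fdelta_sum. Qed.

Fact actE_is_linear w : linear (actE w : Ext gT -> Ext gT).
Proof.
move=> k x y; rewrite /actE scaler_sumr -big_split; apply: eq_bigr => A _ /=.
by move: (_ *: eb _) => v; rewrite !ffunE scalerDl -scalerA.
Qed.

HB.instance Definition _ w :=
  GRing.isLinear.Build algC (Ext gT) (Ext gT) *:%R (actE w) (actE_is_linear w).

Lemma actE_eb w A : actE w (eb A) = asign w A *: eb (A :^ w)%g.
Proof.
rewrite /actE (bigD1 A) //= big1 ?addr0 => [|B BA]; first by rewrite ffunE eqxx scale1r.
by rewrite ffunE (negPf BA) scale0r.
Qed.

Lemma actE_mul g h (a : Ext gT) : actE (g * h)%g a = actE h (actE g a).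
Proof.
apply: (linear_fdelta_ext (f := actE (g * h)%g) (g := actE h \o actE g)) => A.
by rewrite /= -[fdelta A]/(eb A) !actE_eb linearZ /= actE_eb scalerA asign_mul conjsgM.
Qed.

Lemma actE1 (a : Ext gT) : actE 1%g a = a.
Proof.
apply: (linear_fdelta_ext (f := actE 1%g) (g := idfun)) => A.
by rewrite /= -[fdelta A]/(eb A) actE_eb asign1 conjsg1 scale1r.
Qed.

Lemma mulE_eb A (b : Ext gT) : mulE (eb A) b = \sum_B (b B : algC) *: emul A B.
Proof.
rewrite /mulE (bigD1 A) //= [X in _ + X]big1 ?addr0 => [|A' AA'].
  by apply: eq_bigr => B _; rewrite ffunE eqxx mul1r.
by rewrite big1 // => B _; rewrite ffunE (negPf AA') mul0r scale0r.
Qed.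

Lemma mulE_ebZ A (k : algC) (a b : Ext gT) :
  mulE (eb A) (k *: a + b) = k *: mulE (eb A) a + mulE (eb A) b.
Proof.
rewrite !mulE_eb scaler_sumr -big_split; apply: eq_bigr => B _ /=.
by move: (emul A B) => v; rewrite !ffunE scalerDl -scalerA.
Qed.

Lemma mulE_eb_eb A B : mulE (eb A) (eb B) = emul A B.
Proof.
rewrite mulE_eb (bigD1 B) //= big1 ?addr0 => [|C CB]; first by rewrite ffunE eqxx scale1r.
by rewrite ffunE (negPf CB) scale0r.
Qed.

Lemma osrelE D : osrel D = \sum_(t in D) (- wsign [set t] (D :\ t)) *: eb (D :\ t).
Proof.
apply: eq_bigr => t tD; congr (_ *: _); rewrite exprS mulN1r; congr (- _).
rewrite sign_card_prod wsignE big_set1 (bigD1 t) //= ltT_irr expr0 mul1r.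
by apply: eq_bigl => u; rewrite !inE andbC.
Qed.

Lemma mulE_osrel A D :
  mulE (eb A) (osrel D) = \sum_(t in D) (- wsign [set t] (D :\ t)) *: emul A (D :\ t).
Proof.
have lin : linear (mulE (eb A) : Ext gT -> Ext gT) by move=> k x y; apply: mulE_ebZ.
pose hl := GRing.isLinear.Build algC (Ext gT) (Ext gT) *:%R (mulE (eb A)) lin.
pose f : {linear Ext gT -> Ext gT} := HB.pack (mulE (eb A)) hl.
rewrite osrelE -[LHS]/(f _) (linear_sum f); apply: eq_bigr => t _.
by rewrite (linearZ_LR f) /= mulE_eb_eb.
Qed.

Lemma actE_emul w A B :
  actE w (emul A B) = (asign w A * asign w B) *: emul (A :^ w)%g (B :^ w)%g.
Proof.
rewrite /emul; have -> : [disjoint (A :^ w)%g & (B :^ w)%g] = [disjoint A & B].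
  by rewrite -!setI_eq0 -conjIg -(inj_eq (@conjsg_inj _ w)) conj0g.
case: ifP => dAB; last by rewrite linear0 scaler0.
rewrite linearZ /= actE_eb !scalerA conjUg; congr (_ *: _).
by rewrite mulrC (asignU w dAB).
Qed.

(** Spanning products of the Orlik-Solomon ideal are permuted up to sign, whence its stability under
    [W]. *)
Lemma actE_mulE_osrel w A D :
  actE w (mulE (eb A) (osrel D))
    = (asign w A * asign w D) *: mulE (eb (A :^ w)%g) (osrel (D :^ w)%g).
Proof.
rewrite !mulE_osrel linear_sum scaler_sumr big_imset /=; last by move=> x y _ _; apply: conjg_inj.
apply: eq_bigr => t tD; rewrite linearZ /= actE_emul !scalerA.
have Dt : ((D :^ w) :\ (t ^ w) = (D :\ t) :^ w)%g by rewrite conjDg conjg_set1.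
rewrite Dt; congr (_ *: _).
have tDt : t \notin D :\ t by rewrite !inE eqxx.
have -> : asign w D = asign w (t |: (D :\ t)) by rewrite setD1K.
rewrite asignU1 //; set u := wsign [set t ^ w]%g _; have u1 : u * u = 1 by apply: wsignM.
set x := asign w A; set y := asign w _; set z := wsign [set t] _.
by rewrite -[LHS]mulr1 -u1; ring.
Qed.

End ExteriorAction.

(** * Induction and conjugation *)

Section InducedConjugate.

Variables (gT : finGroupType) (G : {group gT}).

Lemma cent1_conj (w x : gT) : x \in G -> ('C_G[w] :^ x)%g = 'C_G[w ^ x]%g.
Proof. by move=> xG; rewrite conjIg conjGid // cent1J. Qed.

(** In the formula for the induced function the conjugation is absorbed by translating the summation
    variable, as [x] lies in [G]. *)
Lemma cfun_conj (H K : {group gT}) (x : gT) (phi : 'CF(H)) : x \in G -> H \subset G ->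
    (H :^ x)%g = K :> {set gT} ->
  exists phi' : 'CF(K), [/\ phi \is a linear_char -> phi' \is a linear_char,
    forall c, phi' (c ^ x)%g = phi c & 'Ind[G] phi' = 'Ind[G] phi].
Proof.
move=> xG sHG HxK; have iso : isom H K (conjgm H x) by rewrite -HxK conj_isom.
have sKG : K \subset G by rewrite -HxK -(conjGid xG) conjSg.
exists (cfIsom iso phi).
have phiE c : cfIsom iso phi (c ^ x)%g = phi c.
  have [cH|cH] := boolP (c \in H); first by rewrite -[RHS](cfIsomE iso).
  by rewrite !cfun0 // -HxK memJ_conjg.
split=> //; first by rewrite cfIsom_lin_char.
have cK : #|K| = #|H| by rewrite -HxK cardJg.
apply/cfun_inP=> g gG; rewrite !cfIndE // cK; congr (_ * _).
rewrite (reindex_inj (mulIg x)) /=; apply: eq_big => [y|y yG]; first by rewrite groupMr.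
by rewrite conjgM phiE.
Qed.

End InducedConjugate.

(** * Roots and parabolic subgroups *)

Record coxeter_rep (gT : finGroupType) (W : {group gT}) (S : {set gT})
    (rG : mx_representation algC W #|S|) : Prop := CoxeterRep {
  coxrep_sub : S \subset W;
  coxrep_gen : <<S>>%g = W :> {set gT};
  coxrep_inv : {in S, forall s, #[s]%g = 2%N};
  coxrep_refl : forall i : 'I_#|S|, rG (enum_val i) = refl_mx i
}.

Section CoxeterGroup.

Variables (gT : finGroupType) (W : {group gT}) (S : {set gT}).
Variable rG : mx_representation algC W #|S|.
Hypothesis hG : coxeter_rep rG.

Let sSW : S \subset W := coxrep_sub hG.
Let genW : <<S>>%g = W :> {set gT} := coxrep_gen hG.
Let invS : {in S, forall s, #[s]%g = 2%N} := coxrep_inv hG.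
Let hrG : forall i : 'I_#|S|, rG (enum_val i) = refl_mx i := coxrep_refl hG.

Section Roots.

Implicit Types (J L : {set gT}) (s t w : gT) (u v : 'rV[algC]_#|S|).

Definition rootv s : 'rV[algC]_#|S| := \row_j (enum_val j == s)%:R.
Definition formB u v : algC := (u *m coxB S *m v^T) 0 0.
(** The cone spanned by the simple roots; in [algC] the relation [0 <=] also says that a coordinate
    is real. *)
Definition posv v : bool := [forall j, 0 <= v 0 j].

Lemma posvP v : reflect (forall j, 0 <= v 0 j) (posv v).
Proof. exact: forallP. Qed.

Lemma posvD u v : posv u -> posv v -> posv (u + v).
Proof. by move=> /posvP pu /posvP pv; apply/posvP=> j; rewrite mxE addr_ge0. Qed.

Lemma posvZ (a : algC) v : 0 <= a -> posv v -> posv (a *: v).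
Proof. by move=> a0 /posvP pv; apply/posvP=> j; rewrite mxE mulr_ge0. Qed.

Lemma posv_sum (I : finType) (A : {pred I}) (f : I -> 'rV_#|S|) :
  (forall i, i \in A -> posv (f i)) -> posv (\sum_(i in A) f i).
Proof.
move=> pf; elim/big_ind: _ => [|u v|//]; last exact: posvD.
by apply/posvP=> j; rewrite mxE.
Qed.

Lemma posv_anti v : posv v -> posv (- v) -> v = 0.
Proof.
move=> /posvP pv /posvP nv; apply/rowP=> j; rewrite mxE.
by have := nv j; rewrite mxE oppr_ge0 => nj; apply/eqP; rewrite eq_le pv nj.
Qed.

Lemma idxP s : s \in S -> {i : 'I_#|S| | s = enum_val i}.
Proof. by move=> sS; exists (enum_rank_in sS s); rewrite enum_rankK_in. Qed.

Lemma rootv_enum i : rootv (enum_val i) = delta_mx 0 i.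
Proof. by apply/rowP=> j; rewrite !mxE eqxx /= (inj_eq enum_val_inj). Qed.

Lemma rootv_decomp v : v = \sum_(i < #|S|) v 0 i *: rootv (enum_val i).
Proof.
by rewrite {1}(matrix_sum_delta v) big_ord1; apply: eq_bigr => i _; rewrite rootv_enum.
Qed.

Lemma rootv_neq0 s : s \in S -> rootv s != 0.
Proof.
case/idxP=> i ->; apply/eqP=> /rowP/(_ i); rewrite !mxE eqxx => /eqP.
by rewrite oner_eq0.
Qed.

Lemma posv_rootv s : posv (rootv s).
Proof. by apply/posvP=> j; rewrite mxE ler0n. Qed.

Lemma formBDl u v x : formB (u + v) x = formB u x + formB v x.
Proof. by rewrite /formB !mulmxDl mxE. Qed.

Lemma formBZl (a : algC) u v : formB (a *: u) v = a * formB u v.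
Proof. by rewrite /formB -!scalemxAl mxE. Qed.

Lemma coxB_sym : (coxB S)^T = coxB S.
Proof.
apply/matrixP=> i j; rewrite !mxE.
have inv (k : 'I_#|S|) : ((enum_val k : gT)^-1)%g = enum_val k.
  by rewrite invg_expg (invS (enum_valP k)).
by rewrite -(orderV (enum_val i * _)) invMg !inv.
Qed.

Lemma formBC u v : formB u v = formB v u.
Proof.
have -> : formB u v = (u *m coxB S *m v^T)^T 0 0 by rewrite mxE.
by rewrite !trmx_mul trmxK coxB_sym mulmxA.
Qed.

Lemma formBDr u v x : formB u (v + x) = formB u v + formB u x.
Proof. by rewrite !(formBC u) formBDl. Qed.

Lemma formBZr (a : algC) u v : formB u (a *: v) = a * formB u v.
Proof. by rewrite !(formBC u) formBZl. Qed.

Lemma formBN u v : formB (- u) v = - formB u v.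
Proof. by rewrite -scaleN1r formBZl mulN1r. Qed.

Lemma formB_suml (I : finType) (A : {pred I}) (f : I -> 'rV_#|S|) v :
  formB (\sum_(i in A) f i) v = \sum_(i in A) formB (f i) v.
Proof. by rewrite /formB !mulmx_suml summxE. Qed.

Lemma formB_root s t : s \in S -> t \in S ->
  formB (rootv s) (rootv t) = - 'Re ((#[(s * t)%g]%g).-root (-1)).
Proof.
case/idxP=> i -> /idxP[j ->]; rewrite !rootv_enum /formB trmx_delta.
by rewrite -rowE -colE !mxE.
Qed.

Lemma formB_root1 s : s \in S -> formB (rootv s) (rootv s) = 1.
Proof.
move=> sS; rewrite formB_root //.
have -> : (s * s)%g = 1%g by rewrite -(expgS s 1) -(invS sS) expg_order.
by rewrite order1 root1C raddfN opprK /=; apply/Creal_ReP; rewrite rpred1.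
Qed.

Lemma rG_reflection s v : s \in S ->
  v *m rG s = v - (2%:R * formB v (rootv s)) *: rootv s.
Proof.
case/idxP=> i ->; rewrite hrG /refl_mx mulmxBr mulmx1; congr (_ - _).
rewrite -scalemxAr mulmxA -scalerA; congr (_ *: _).
by rewrite [v *m col i _]mx11_scalar mul_scalar_mx rootv_enum /formB trmx_delta -mulmxA -colE.
Qed.

Lemma memW w : (w \in W) = (w \in <<S>>%g).
Proof. by rewrite genW. Qed.

Lemma mem_genS J w : J \subset S -> w \in <<J>>%g -> w \in W.
Proof. by move=> sJS; apply/subsetP; rewrite gen_subG (subset_trans sJS). Qed.

Lemma rG_root_self s : s \in S -> rootv s *m rG s = - rootv s.
Proof.
move=> sS; rewrite rG_reflection // formB_root1 // mulr1 scaler_nat mulr2n.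
by rewrite opprD addrA subrr add0r.
Qed.

Lemma formB_inv w u v : w \in W -> formB (u *m rG w) (v *m rG w) = formB u v.
Proof.
rewrite memW => wS; move: w wS u v; apply: gen_mulg_ind => [|s w sS wS IH] u v.
  by rewrite repr_mx1 !mulmx1.
have [sW wW] : s \in W /\ w \in W by split; [apply: (subsetP sSW)|rewrite memW].
rewrite repr_mxM // !mulmxA IH !rG_reflection // -!scaleNr.
rewrite formBDl !formBDr !formBZl !formBZr formB_root1 // (formBC (rootv s) v).
set a := formB u _; set b := formB v _.
ring.
Qed.

Lemma rG_unit w : w \in W -> rG w \in unitmx.
Proof. exact: repr_mx_unit. Qed.

Lemma mulmx_rG_eq0 w v : w \in W -> (v *m rG w == 0) = (v == 0).
Proof.
move=> wW; apply/eqP/eqP=> [v0|->]; last by rewrite mul0mx.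
by rewrite -[v](repr_mxK rG wW) v0 mul0mx.
Qed.

Lemma rG_coord J w v i : J \subset S -> w \in <<J>>%g -> enum_val i \notin J ->
  (v *m rG w) 0 i = v 0 i.
Proof.
move=> sJS wJ iJ; move: w wJ v; apply: gen_mulg_ind => [|s w sJ wJ IH] v.
  by rewrite repr_mx1 mulmx1.
have sS := subsetP sJS _ sJ.
rewrite repr_mxM ?(subsetP sSW _ sS) ?(mem_genS sJS wJ) // mulmxA IH rG_reflection // !mxE.
by case: eqP => [e|_]; [rewrite e sJ in iJ|rewrite mulr0 subr0].
Qed.

Lemma det_refl s : s \in S -> \det (rG s) = -1.
Proof.
case/idxP=> i ->; rewrite hrG /refl_mx.
have Bii : - 'Re ((#[(enum_val i * enum_val i)%g]%g).-root (-1)) = 1 :> algC.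
  by rewrite -formB_root ?enum_valP // formB_root1 ?enum_valP.
rewrite (expand_det_row _ i) (bigD1 i) //= big1 ?addr0 => [|k ki]; last first.
  by rewrite !mxE big_ord1 !mxE eqxx eq_sym (negPf ki) mulr0n !mulr0 subr0 mul0r.
rewrite /cofactor -signr_odd addnn odd_double mul1r.
have -> : row' i (col' i (1%:M - 2%:R *: (col i (coxB S) *m delta_mx (0 : 'I_1) i))) = 1%:M.
  apply/matrixP=> k l; rewrite !mxE big_ord1 !mxE (inj_eq lift_inj).
  by rewrite [lift i l == i]eq_sym (negPf (neq_lift i l)) andbF !mulr0 subr0.
rewrite det1 mulr1 !mxE big_ord1 !mxE !eqxx Bii !mulr1.
by rewrite -[true%:R]/(1 : algC); ring.
Qed.

Lemma det_coxlen J w : J \subset S -> w \in <<J>>%g -> \det (rG w) = (-1) ^+ coxlen J w.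
Proof.
move=> sJS /coxlen_word[c [cJ <- ->]].
elim: c cJ => [|s c IH] /=; first by rewrite big_nil repr_mx1 det1.
case/andP=> sJ cJ; have sS := subsetP sJS _ sJ.
rewrite big_cons repr_mxM ?(subsetP sSW _ sS) //; last first.
  by rewrite big_seq group_prod // => x /(allP cJ) /(subsetP sJS) /(subsetP sSW).
by rewrite det_mulmx (det_refl sS) IH // exprS.
Qed.

Lemma coxlen_parity J s w : J \subset S -> s \in J -> w \in <<J>>%g ->
  odd (coxlen J (s * w)%g) = ~~ odd (coxlen J w).
Proof.
move=> sJS sJ wJ; have sS := subsetP sJS _ sJ.
have : (-1) ^+ coxlen J (s * w)%g = - (-1) ^+ coxlen J w :> algC.
  rewrite -!det_coxlen //; last by rewrite groupM // mem_gen.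
  by rewrite repr_mxM ?(subsetP sSW _ sS) ?(mem_genS sJS wJ) // det_mulmx (det_refl sS) mulN1r.
rewrite -signr_odd -[in RHS]signr_odd -signrN => /eqP.
by rewrite (inj_eq signr_inj) => /eqP.
Qed.

(** The determinant gives the two lengths opposite parities. This does the work of the exchange
    condition: a weak comparison of these lengths is always strict. *)
Lemma coxlen_neq J s w : J \subset S -> s \in J -> w \in <<J>>%g ->
  coxlen J (s * w)%g != coxlen J w.
Proof.
move=> sJS sJ wJ; apply/eqP=> e; have := coxlen_parity sJS sJ wJ.
by rewrite e; case: (odd _).
Qed.

Lemma mulKs s w : s \in S -> (s * (s * w))%g = w.
Proof. by move=> sS; rewrite mulgA -(expgS s 1) -(invS sS) expg_order mul1g. Qed.

Section Dihedral.

Variables s t : gT.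
Hypotheses (sS : s \in S) (tS : t \in S) (st : s != t).
Let m := #[(s * t)%g]%g.
Let z : algC := m.-root (-1).
(** This is sin (k pi / m) / sin (pi / m), the coefficient of a simple root in a root of the
    dihedral group of [s] and [t]. *)
Let a k : algC := 'Im (z ^+ k) / 'Im z.

Let m_gt1 : (1 < m)%N.
Proof.
rewrite ltn_neqAle order_gt0 andbT eq_sym order_eq1; apply: contra st => /eqP st1.
by rewrite -(mulKs t sS) st1 mulg1.
Qed.

Let a_ge0 k : (k <= m)%N -> 0 <= a k.
Proof.
by move=> le_km; rewrite divr_ge0 ?Im_rootN1_exp // ltW ?Im_rootN1_gt0.
Qed.

Let a_rec k : a k.+2 = 2%:R * 'Re z * a k.+1 - a k.
Proof.
have z1 : `|z| = 1 by rewrite norm_rootC normrN1 rootC1 // ltnW.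
have e : z ^+ k.+2 + z ^+ k = (2%:R * 'Re z) * z ^+ k.+1.
  have zz : z * z^* = 1 by rewrite -normCK z1 expr1n.
  have -> : 2%:R * 'Re z = z + z^* by rewrite ReE mulrC divfK // pnatr_eq0.
  by rewrite mulrDl -exprS [in z^* * _]exprS mulrA [z^* * z]mulrC zz mul1r.
apply/(addIr (a k)); rewrite subrK /a -mulrDl -raddfD /= e.
by rewrite ImMl ?rpredM ?rpred_nat ?Creal_Re // mulrA.
Qed.

Let sW : s \in W. Proof. exact: (subsetP sSW). Qed.
Let tW : t \in W. Proof. exact: (subsetP sSW). Qed.

Let alt_word_mem k : alt_word t s k \in W.
Proof.
by elim: k => [|k IH]; rewrite ?group1 // alt_word_rec groupM //; case: ifP.
Qed.

(** Each reflection changes one of the two coefficients by the Chebyshev recursion [a_rec], whose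
    factor 2 Re z = 2 cos (pi / m) is minus twice the form on the two simple roots. *)
Let alt_root k : rootv s *m rG (alt_word t s k)^-1%g =
  if odd k then a k *: rootv s + a k.+1 *: rootv t
  else a k.+1 *: rootv s + a k *: rootv t.
Proof.
have Bst : formB (rootv s) (rootv t) = - 'Re z by rewrite formB_root.
have st_t : rootv s *m rG t = rootv s + (2%:R * 'Re z) *: rootv t.
  by rewrite rG_reflection // Bst mulrN scaleNr opprK.
have ts_s : rootv t *m rG s = rootv t + (2%:R * 'Re z) *: rootv s.
  by rewrite rG_reflection // formBC Bst mulrN scaleNr opprK.
elim: k => [|k IH].
  rewrite /= invg1 repr_mx1 mulmx1 /a expr1 divff ?gt_eqF ?Im_rootN1_gt0 //.
  by rewrite expr0 (Creal_ImP _ _) ?rpred1 // mul0r scale1r scale0r addr0.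
have invV x : x \in S -> (x^-1)%g = x by move=> xS; rewrite invg_expg (invS xS).
rewrite alt_word_rec invMg /= a_rec.
case: (odd k) IH => /= IH; rewrite ?(invV _ sS) ?(invV _ tS) repr_mxM ?groupV // mulmxA IH.
  rewrite mulmxDl -!scalemxAl ts_s rG_root_self // scalerN scalerDr scalerA.
  by rewrite scalerBl [RHS]addrC addrCA [_ * a _]mulrC [- _ + _]addrC.
rewrite mulmxDl -!scalemxAl st_t rG_root_self // scalerN scalerDr scalerA.
by rewrite scalerBl addrA mulrC.
Qed.

Lemma alt_root_pos k w : (k < m)%N -> w \in W ->
  posv (rootv s *m rG w) -> posv (rootv t *m rG w) ->
  posv (rootv s *m rG ((alt_word t s k)^-1 * w)%g).
Proof.
move=> lt_km wW ps pt; rewrite repr_mxM ?groupV // mulmxA alt_root.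
by case: odd; rewrite mulmxDl -!scalemxAl posvD // posvZ // a_ge0 // ltnW.
Qed.

End Dihedral.

(* Strip from w its longest alternating prefix t s t ...: both s and t lengthen
   what remains, and the prefix is too short for the dihedral coefficients
   [Im z^k / Im z] to change sign. *)
Lemma coxlen_root_pos J s w : J \subset S -> s \in J -> w \in <<J>>%g ->
  (coxlen J w < coxlen J (s * w)%g)%N -> posv (rootv s *m rG w).
Proof.
move=> sJS; have [n] := ubnP (coxlen J w); elim: n s w => // n IH s w.
rewrite ltnS => le_n sJ wJ lt_sw.
have [->|w1] := eqVneq w 1%g; first by rewrite repr_mx1 mulmx1 posv_rootv.
have invJ : {in J, forall x, #[x]%g = 2%N} by move=> x /(subsetP sJS); apply: invS.
have [t tJ lt_tw] := coxlen_descent invJ wJ w1.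
have [sS tS] := (subsetP sJS _ sJ, subsetP sJS _ tJ).
have st : s != t by apply: contraTneq lt_tw => <-; rewrite -leqNgt ltnW.
(* [c k] is the letter to strip from [w_ k]; the choice [c 0 = t] is made because [t] shortens
   [w]. *)
pose c k := if odd k then s else t; pose w_ k := (alt_word t s k * w)%g.
have cJ k : c k \in J by rewrite /c; case: odd.
have w_S k : w_ k.+1 = (c k * w_ k)%g by rewrite /w_ alt_word_rec mulgA.
have wJ_ k : w_ k \in <<J>>%g.
  by elim: k => [|k IHk]; [rewrite /w_ mul1g|rewrite w_S groupM // mem_gen].
pose P k := (coxlen J (w_ k) <= coxlen J (w_ k.+1))%N.
have desc k : (forall i, (i < k)%N -> ~~ P i) -> (coxlen J (w_ k) + k <= coxlen J w)%N.
  elim: k => [|k IHk] notP; first by rewrite addn0 /w_ mul1g.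
  rewrite addnS -addSn (leq_trans _ (IHk _)) // => [|i lt_ik]; last first.
    by apply: notP; rewrite ltnW.
  by rewrite leq_add2r ltnNge; apply: notP.
have exP : exists k, P k.
  have [/existsP[i Pi]|/existsPn notP] :=
    boolP [exists i : 'I_(coxlen J w).+1, P i]; first by exists i.
  have := desc (coxlen J w).+1 (fun i lt_i => notP (Ordinal lt_i)).
  by rewrite addnS ltnNge leq_addl.
case: (ex_minnP exP) => k Pk kmin.
have {}desc i : (i <= k)%N -> (coxlen J (w_ i) + i <= coxlen J w)%N.
  move=> le_ik; apply: desc => j lt_ji; apply/negP=> /kmin.
  by rewrite leqNgt (leq_trans lt_ji).
have k_gt0 : (0 < k)%N.
  rewrite lt0n; apply: contraTneq Pk => ->; rewrite /P w_S /w_ /c /= mul1g.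
  by rewrite -ltnNge.
(* If m letters could be stripped, the braid relation would let the stripped word end in [s]; then
   [s * w] would be reached from [w_ m] by m - 1 letters and would be no longer than [w]. *)
have lt_km : (k < #[(s * t)%g]%g)%N.
  rewrite ltnNge; apply: contraTN lt_sw => /desc; rewrite -leqNgt.
  set m := #[_]%g => le_m.
  have m_gt0 : (0 < m)%N by apply: order_gt0.
  have eq_alt : alt_word t s m = alt_word s t m.
    have := alt_word_braid m (invS tS) (invS sS); rewrite expg_order => /eqP.
    by rewrite -eq_mulVg1 => /eqP->.
  have : w_ m = (alt_word t s m.-1 * (s * w))%g.
    by rewrite /w_ eq_alt mulgA -[in LHS](prednK m_gt0).
  move=> wm; have sw : (s * w)%g = ((alt_word t s m.-1)^-1 * w_ m)%g by rewrite wm mulKg.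
  have alt_len i x : x \in <<J>>%g -> (coxlen J ((alt_word t s i)^-1 * x)%g <= i + coxlen J x)%N.
    move=> xJ; elim: i x xJ => [|i IHi] x xJ; first by rewrite invg1 mul1g.
    rewrite alt_word_rec invMg -mulgA.
    have ciV : ((c i)^-1)%g = c i by rewrite invg_expg (invJ _ (cJ i)).
    rewrite -/(c i) ciV (leq_trans (IHi _ _)) ?groupM // ?mem_gen //.
    by rewrite addSn -addnS leq_add2l coxlen_mul.
  rewrite sw; apply: leq_trans (alt_len _ _ (wJ_ m)) _; apply: leq_trans le_m.
  by rewrite addnC leq_add2l leq_pred.
have vW : w_ k \in W by apply: mem_genS (wJ_ k).
have lt_v : (coxlen J (w_ k) < n)%N.
  apply: leq_trans le_n; apply: leq_trans (desc k (leqnn k)).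
  by rewrite -[in X in (X <= _)%N]addn1 leq_add2l.
have up_c : (coxlen J (w_ k) < coxlen J (c k * w_ k)%g)%N.
  by rewrite ltn_neqAle eq_sym coxlen_neq //= -w_S.
have up_c' : (coxlen J (w_ k) < coxlen J (c k.-1 * w_ k)%g)%N.
  have wk : w_ k = (c k.-1 * w_ k.-1)%g by rewrite -w_S prednK.
  rewrite [in X in (_ < X)%N]wk mulKs ?(subsetP sJS) // -{1}(prednK k_gt0) ltnNge.
  by apply/negP=> /kmin; rewrite leqNgt prednK // leqnn.
have [pos_s pos_t] : posv (rootv s *m rG (w_ k)) /\ posv (rootv t *m rG (w_ k)).
  have both x : x \in J -> (coxlen J (w_ k) < coxlen J (x * w_ k)%g)%N -> posv (rootv x *m rG (w_ k)).
    by move=> xJ; apply: IH.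
  have := both _ (cJ k) up_c; have := both _ (cJ k.-1) up_c'.
  have -> : c k = if odd k.-1 then t else s.
    by rewrite /c -{1}(prednK k_gt0) /=; case: odd.
  by rewrite /c; case: odd; split.
have -> : w = ((alt_word t s k)^-1 * w_ k)%g by rewrite /w_ mulKg.
exact: alt_root_pos.
Qed.

End Roots.

(** * Distinguished coset representatives *)

Section Parabolics.

Implicit Types (J K L M : {set gT}) (s t u w x : gT) (v : 'rV[algC]_#|S|).

Local Notation X := (Xset W S).
Local Notation root := rootv.


Lemma subS_mem s : s \in S -> s \in W.
Proof. exact/subsetP/sSW. Qed.

Lemma repr_mxMV w v : w \in W -> v *m rG w *m rG w^-1%g = v.
Proof. by move=> wW; rewrite -mulmxA -repr_mxM ?groupV // mulgV repr_mx1 mulmx1. Qed.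

Lemma rootv_neg J s w : J \subset S -> s \in J -> w \in <<J>>%g ->
  (coxlen J (s * w)%g < coxlen J w)%N -> posv (- (root s *m rG w)).
Proof.
move=> sJS sJ wJ lt_sw; have sS := subsetP sJS _ sJ.
have wW := mem_genS sJS wJ.
rewrite -mulNmx -(rG_root_self sS) -mulmxA -repr_mxM ?(subS_mem sS) //.
apply: (coxlen_root_pos sJS) => //; first by rewrite groupM // mem_gen.
by rewrite (mulKs w sS).
Qed.

(** The image of a root is not both nonnegative and nonpositive, so [coxlen_root_pos] and
    [rootv_neg] settle both directions. Lengths are those of the subsystem [J]; the case [J = S]
    reads each X_K as a positivity condition. *)
Lemma root_sign J s w : J \subset S -> s \in J -> w \in <<J>>%g ->
  posv (root s *m rG w) = (coxlen J w < coxlen J (s * w)%g)%N.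
Proof.
move=> sJS sJ wJ; have sS := subsetP sJS _ sJ.
apply/idP/idP=> [pos|]; last exact: coxlen_root_pos.
rewrite ltn_neqAle eq_sym (coxlen_neq sJS) //= leqNgt; apply/negP=> /(rootv_neg sJS sJ wJ).
move/(posv_anti pos)/eqP; rewrite mulmx_rG_eq0 ?(mem_genS sJS) //.
by rewrite (negPf (rootv_neq0 sS)).
Qed.

Lemma rootS_neg s w : s \in S -> w \in W -> ~~ posv (root s *m rG w) ->
  posv (- (root s *m rG w)).
Proof.
move=> sS wW; rewrite (root_sign (subxx S)) // -?memW // => ltN.
apply: (rootv_neg (subxx S)) => //; first by rewrite -memW.
by rewrite ltn_neqAle coxlen_neq -?memW // leqNgt.
Qed.

Lemma XsetP J w : J \subset S ->
  reflect (w \in W /\ forall s, s \in J -> posv (root s *m rG w)) (w \in X J).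
Proof.
move=> sJS; rewrite inE; apply: (iffP andP) => -[wW posw]; split=> //.
  move=> s sJ; rewrite (root_sign (subxx S)) ?(subsetP sJS) -?memW //.
  by have /forall_inP := posw; apply.
apply/forall_inP=> s sJ; rewrite -(root_sign (subxx S)) ?(subsetP sJS) -?memW //.
exact: posw.
Qed.

Lemma Xset_mem J w : w \in X J -> w \in W.
Proof. by rewrite inE => /andP[]. Qed.

Lemma Xset_sub J K : J \subset K -> X K \subset X J.
Proof.
move=> sJK; apply/subsetP=> w; rewrite !inE => /andP[-> /forall_inP posw].
by apply/forall_inP=> s sJ; apply/posw/(subsetP sJK).
Qed.

Definition suppv J v : bool := [forall i, (enum_val i \notin J) ==> (v 0 i == 0)].

Lemma suppvP J v : reflect (forall i, enum_val i \notin J -> v 0 i = 0) (suppv J v).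
Proof.
apply: (iffP forallP) => sv i; last by apply/implyP=> iJ; rewrite sv.
by move=> iJ; apply/eqP; have := sv i; rewrite iJ.
Qed.

Lemma suppv_root J s : s \in J -> suppv J (root s).
Proof.
move=> sJ; apply/suppvP=> i iJ; rewrite mxE; case: eqP => // e.
by rewrite e sJ in iJ.
Qed.

Lemma suppv_rG J w v : J \subset S -> w \in <<J>>%g -> suppv J v -> suppv J (v *m rG w).
Proof.
by move=> sJS wJ /suppvP sv; apply/suppvP=> i iJ; rewrite (rG_coord _ sJS) // sv.
Qed.

Lemma suppv_decomp J v : J \subset S -> suppv J v ->
  v = \sum_(i < #|S| | enum_val i \in J) v 0 i *: root (enum_val i).
Proof.
move=> sJS /suppvP sv; rewrite {1}(rootv_decomp v) (bigID (fun i => enum_val i \in J)) /=.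
by rewrite [X in _ + X]big1 ?addr0 // => i iJ; rewrite sv // scale0r.
Qed.

Lemma posv_Xset J x v : J \subset S -> x \in X J -> suppv J v -> posv v -> posv (v *m rG x).
Proof.
move=> sJS /(XsetP _ sJS)[xW posx] sv /posvP pv.
rewrite (suppv_decomp sJS sv) mulmx_suml; apply: posv_sum => i iJ.
by rewrite -scalemxAl posvZ //; apply: posx.
Qed.

Lemma pos_gen1 J w : J \subset S -> w \in <<J>>%g ->
  (forall s, s \in J -> posv (root s *m rG w)) -> w = 1%g.
Proof.
move=> sJS wJ posw; apply/eqP; apply: contraT => w1.
have invJ : {in J, forall s, #[s]%g = 2%N}.
  by move=> s /(subsetP sJS); apply: invS.
have [s sJ lt_sw] := coxlen_descent invJ wJ w1.
have := posw s sJ; rewrite (root_sign sJS) // => lt_ws.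
by have := ltn_trans lt_sw lt_ws; rewrite ltnn.
Qed.

Lemma rG_faithful w : w \in W -> rG w = 1%:M -> w = 1%g.
Proof.
move=> wW w1; apply: (pos_gen1 (subxx S)); first by rewrite -memW.
by move=> s _; rewrite w1 mulmx1 posv_rootv.
Qed.

Lemma rG_conj_reflection s w v : s \in S -> w \in W ->
  v *m rG (s ^ w)%g = v - (2%:R * formB v (root s *m rG w)) *: (root s *m rG w).
Proof.
move=> sS wW; rewrite conjgE !repr_mxM ?groupM ?groupV ?(subS_mem sS) // !mulmxA.
rewrite (rG_reflection _ sS) mulmxBl -scalemxAl; congr (_ - (_ * _) *: _).
  by rewrite -{2}(invgK w) repr_mxMV // groupV.
by rewrite -[in LHS](formB_inv _ _ wW) -{2}(invgK w) repr_mxMV ?groupV.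
Qed.

(** Two descriptions of one reflection, applied to the root of [t], make the two roots proportional;
    both have norm 1, so they agree up to a sign, which positivity fixes. *)
Lemma conj_root s t w : s \in S -> t \in S -> w \in W -> (s ^ w)%g = t ->
  posv (root s *m rG w) -> root s *m rG w = root t.
Proof.
move=> sS tS wW swt pos; set r := root s *m rG w.
have tr1 : root t *m rG t = - root t by apply: rG_root_self.
have := rG_conj_reflection (root t) sS wW; rewrite swt tr1 -/r.
set a := formB _ _ => e0.
have e : root t = a *: r.
  apply: (@scalerI _ _ 2%:R); rewrite ?pnatr_eq0 // scalerA scaler_nat mulr2n.
  by apply/eqP; rewrite -subr_eq0 -addrA -e0 subrr.
have rr : formB r r = 1 by rewrite formB_inv // formB_root1.
have : a ^+ 2 = 1.
  have := formB_root1 tS; rewrite {1 2}e formBZl formBZr rr mulr1 => <-.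
  by rewrite expr2.
move/eqP; rewrite sqrf_eq1 => /orP[]/eqP aE; first by rewrite e aE scale1r.
have : posv (- r) by rewrite -scaleN1r -aE -e posv_rootv.
move/(posv_anti pos)/eqP; rewrite mulmx_rG_eq0 //.
by rewrite (negPf (rootv_neq0 sS)).
Qed.

Lemma root_conj s t w : s \in S -> t \in S -> w \in W ->
  root s *m rG w = root t -> (s ^ w)%g = t.
Proof.
move=> sS tS wW e; have swW : (s ^ w)%g \in W by rewrite groupJ ?(subS_mem sS).
have tW := subS_mem tS.
have eq_rG : rG (s ^ w)%g = rG t.
  apply/row_matrixP=> i; rewrite !rowE rG_conj_reflection // e.
  by rewrite rG_reflection.
apply/eqP; rewrite eq_mulgV1; apply/eqP/rG_faithful; first by rewrite groupM ?groupV.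
by rewrite repr_mxM ?groupV // eq_rG -repr_mxM ?groupV // mulgV repr_mx1.
Qed.

(** The preimage is a nonnegative combination of roots in [J], each sent by [x] to a nonnegative
    vector. Nothing can cancel, so a root [r] with nonzero coefficient goes to a multiple of the
    root of [t]; the norms make the factor 1, and [x] is injective. *)
Lemma Xset_simple J x q w t : J \subset S -> x \in X J -> q \in S -> w \in W -> t \in S ->
    suppv J (root q *m rG w) -> root q *m rG w *m rG x = root t ->
  exists2 r, r \in J & root q *m rG w = root r.
Proof.
move=> sJS xX qS wW tS; set g := root q *m rG w => sg gx.
have xW := Xset_mem xX; have [_ posx] := XsetP _ sJS xX.
have g0 : g != 0 by rewrite mulmx_rG_eq0 ?rootv_neq0.
have pg : posv g.
  apply: contraT => /(rootS_neg qS wW) ng.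
  have : posv (- g *m rG x).
    apply: (posv_Xset sJS xX) => //; apply/suppvP=> i iJ.
    by rewrite mxE (suppvP _ _ sg) // oppr0.
  rewrite mulNmx gx => /(posv_anti (posv_rootv t))/eqP.
  by rewrite (negPf (rootv_neq0 tS)).
have [i giN0] : exists i, g 0 i != 0.
  apply/existsP; apply: contraR g0 => /existsPn g0; apply/eqP/rowP=> i.
  by rewrite [RHS]mxE; apply/eqP; have := g0 i; rewrite negbK.
have iJ : enum_val i \in J by apply: contraR giN0 => /(suppvP _ _ sg)->.
have gi : 0 < g 0 i by rewrite lt_def giN0 (posvP _ pg).
pose r := enum_val i : gT; exists r => //.
have /posvP posr := posx r iJ.
have rxE : root r *m rG x = (root r *m rG x) 0 (enum_rank_in tS t) *: root t.
  apply/rowP=> j; rewrite [RHS]mxE mxE [root t _ _]mxE; case: eqP => [e|ne].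
    by rewrite -{2}e enum_valK_in mulr1 mxE.
  rewrite mulr0; apply/eqP; rewrite -[_ == 0]orFb -(gt_eqF gi) -mulf_eq0.
  have := congr1 (fun v => v 0 j) gx; rewrite {1}(suppv_decomp sJS sg) mulmx_suml.
  rewrite summxE (bigD1 i) //= -scalemxAl [in RHS]mxE; case: eqP => // _.
  rewrite mxE => /eqP; rewrite paddr_eq0.
  - by case/andP=> + _; rewrite [(root _ *m _) 0 j]mxE.
  - by rewrite mulr_ge0 ?(ltW gi) // posr.
  - apply: sumr_ge0 => k /andP[kJ _]; rewrite -scalemxAl mxE mulr_ge0 ?(posvP _ pg) //.
    by have /posvP := posx _ kJ; apply.
move: rxE; set d := _ 0 _ => rxE.
have rS : r \in S by apply: enum_valP.
have : d ^+ 2 = 1.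
  have := formB_root1 rS; rewrite -(formB_inv _ _ xW) rxE formBZl formBZr formB_root1 //.
  by rewrite mulr1 expr2.
move/eqP; rewrite sqrf_eq1 => /orP[]/eqP dE; last first.
  by have := posr (enum_rank_in tS t); rewrite -/d dE oppr_ge0 ler10.
rewrite -[LHS](repr_mxMV _ xW) -[RHS](repr_mxMV _ xW).
by rewrite gx rxE dE scale1r.
Qed.

Lemma Xset_factor J w : J \subset S -> w \in W ->
  exists2 u, u \in <<J>>%g & (u^-1 * w)%g \in X J.
Proof.
move=> sJS wW; have g1 : 1%g \in <<J>>%g by apply: group1.
case: (@arg_minnP _ 1%g (mem <<J>>%g) (fun u => coxlen S (u^-1 * w)%g) g1) => u /= uJ umin.
exists u => //; have uW := mem_genS sJS uJ.
rewrite inE groupM ?groupV //=; apply/forall_inP=> s sJ; have sS := subsetP sJS _ sJ.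
rewrite ltn_neqAle eq_sym coxlen_neq -?memW ?groupM ?groupV //=.
have sV : (s^-1)%g = s by rewrite invg_expg (invS sS).
have := umin (u * s)%g; rewrite invMg sV mulgA; apply.
by rewrite groupM // mem_gen.
Qed.

(** Images under [u] of roots in [K] stay in the span of [J], where [x] preserves the positive cone
    and hence the signs. *)
Lemma Xset_mul J K u x : K \subset J -> J \subset S -> u \in <<J>>%g -> x \in X J ->
  (u * x \in X K)%g = (u \in X K).
Proof.
move=> sKJ sJS uJ xX; have sKS := subset_trans sKJ sJS.
have [uW xW] := (mem_genS sJS uJ, Xset_mem xX).
have supp s : s \in K -> suppv J (root s *m rG u).
  by move=> sK; apply: suppv_rG => //; apply/suppv_root/(subsetP sKJ).
apply/(XsetP _ sKS)/(XsetP _ sKS) => -[_ pos]; split; rewrite ?groupM // => s sK.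
  apply: contraT => /(rootS_neg (subsetP sKS _ sK) uW) neg.
  have : posv (- (root s *m rG u) *m rG x).
    apply: (posv_Xset sJS xX) => //; apply/suppvP=> i iJ.
    by rewrite mxE (suppvP _ _ (supp s sK)) // oppr0.
  have := pos s sK; rewrite repr_mxM // mulmxA mulNmx => /posv_anti/[apply]/eqP.
  by rewrite !mulmx_rG_eq0 // (negPf (rootv_neq0 (subsetP sKS _ sK))).
by rewrite repr_mxM // mulmxA (posv_Xset sJS xX) ?supp ?pos.
Qed.

Lemma Xset_gen1 J u : J \subset S -> u \in <<J>>%g -> u \in X J -> u = 1%g.
Proof. by move=> sJS uJ /(XsetP _ sJS)[_]; apply: pos_gen1. Qed.

Lemma Xset_factor_uniq J u u' x x' : J \subset S -> u \in <<J>>%g -> u' \in <<J>>%g ->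
  x \in X J -> x' \in X J -> (u * x = u' * x')%g -> u = u' /\ x = x'.
Proof.
move=> sJS uJ uJ' xX xX' e.
have xE : x = (u^-1 * u' * x')%g by rewrite -mulgA -e mulKg.
have vJ : (u^-1 * u')%g \in <<J>>%g by rewrite groupM ?groupV.
have v1 : (u^-1 * u')%g = 1%g.
  by apply: (Xset_gen1 sJS vJ); rewrite -(Xset_mul _ sJS vJ xX') // -xE.
by move: xE e; rewrite v1 mul1g => ->; split=> //; apply: (mulIg x').
Qed.

Lemma Xset_1 J : J \subset S -> 1%g \in X J.
Proof.
by move=> sJS; apply/(XsetP _ sJS); split=> // s _; rewrite repr_mx1 mulmx1 posv_rootv.
Qed.

Lemma conj_rootX L n s : L \subset S -> n \in X L -> (L :^ n)%g \subset S -> s \in L ->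
  root s *m rG n = root (s ^ n)%g.
Proof.
move=> sLS nX sLnS sL; have [nW pos] := XsetP _ sLS nX.
by apply: conj_root => //; [apply: (subsetP sLS)|apply: (subsetP sLnS); rewrite memJ_conjg|apply: pos].
Qed.

Lemma Xset_conj L K n y : L \subset S -> n \in X L -> (L :^ n)%g \subset S -> K \subset L ->
  (n * y \in X K)%g = (y \in X (K :^ n)%g).
Proof.
move=> sLS nX sLnS sKL; have nW := Xset_mem nX.
have sKS := subset_trans sKL sLS.
have sKnS : (K :^ n)%g \subset S by apply: subset_trans sLnS; rewrite conjSg.
have rE s : s \in K -> y \in W -> root s *m rG (n * y)%g = root (s ^ n)%g *m rG y.
  by move=> sK yW; rewrite repr_mxM // mulmxA (conj_rootX sLS) // (subsetP sKL).
apply/(XsetP _ sKS)/(XsetP _ sKnS) => -[yW pos].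
  have {}yW : y \in W by move: yW; rewrite groupMl.
  by split=> // _ /imsetP[s sK ->]; rewrite -rE //; apply: pos.
split=> [|s sK]; first by rewrite groupM.
by rewrite rE // pos // memJ_conjg.
Qed.

(** The reflection [s ^ w] negates this vector, while W_J leaves the coordinates outside [J]
    unchanged; so these coordinates vanish. *)
Lemma suppv_conj J s w : J \subset S -> s \in S -> w \in W -> (s ^ w)%g \in <<J>>%g ->
  suppv J (root s *m rG w).
Proof.
move=> sJS sS wW swJ; apply/suppvP=> i iJ.
have := rG_coord (root s *m rG w) sJS swJ iJ.
rewrite rG_conj_reflection // formB_inv // formB_root1 // mulr1.
move: (root s *m rG w) => v; rewrite !mxE => /eqP.
by rewrite -subr_eq0 addrAC subrr sub0r oppr_eq0 mulf_eq0 pnatr_eq0 => /eqP.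
Qed.

(** As [n] keeps the positive roots of W_L positive, its inverse does so for W_M; then
    [Xset_simple], applied to the inverse, shows that simple roots go to simple roots. *)
Lemma gen_conj_half L M n : L \subset S -> M \subset S -> n \in X L ->
  (<<L>> :^ n)%g = <<M>>%g -> (n^-1)%g \in X M /\ (L :^ n)%g \subset M.
Proof.
move=> sLS sMS nX LnM; have nW := Xset_mem nX; have [_ posn] := XsetP _ sLS nX.
have nVX : (n^-1)%g \in X M.
  apply/(XsetP _ sMS); split=> [|t tM]; first by rewrite groupV.
  have tS := subsetP sMS _ tM.
  have tn : suppv L (root t *m rG n^-1%g).
    apply: suppv_conj; rewrite ?groupV //.
    by rewrite -mem_conjg LnM mem_gen.
  apply: contraT => /(rootS_neg tS (groupVr nW)) neg.
  have : posv (- (root t *m rG n^-1%g) *m rG n).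
    apply: (posv_Xset sLS nX) => //; apply/suppvP=> i iJ.
    by rewrite mxE (suppvP _ _ tn) // oppr0.
  have := repr_mxMV (root t) (groupVr nW); rewrite invgK mulNmx => ->.
  move=> /(posv_anti (posv_rootv t))/eqP.
  by rewrite (negPf (rootv_neq0 tS)).
split=> //; apply/subsetP=> _ /imsetP[s sL ->]; have sS := subsetP sLS _ sL.
have [r rM e] : exists2 r, r \in M & root s *m rG n = root r.
  apply: (Xset_simple sMS nVX sS nW sS); last exact: repr_mxMV.
  by apply: suppv_conj => //; rewrite -LnM memJ_conjg mem_gen.
by rewrite (root_conj sS (subsetP sMS _ rM) nW e).
Qed.

Lemma gen_conj_Xset L M n : L \subset S -> M \subset S -> n \in X L ->
  (<<L>> :^ n)%g = <<M>>%g -> (L :^ n)%g = M.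
Proof.
move=> sLS sMS nX LnM; have [nVX sub] := gen_conj_half sLS sMS nX LnM.
have MnL : (<<M>> :^ n^-1)%g = <<L>>%g by rewrite -LnM conjsgK.
have [_ sub'] := gen_conj_half sMS sLS nVX MnL.
by apply/eqP; rewrite eqEsubset sub -(conjsgKV n M) conjSg.
Qed.

(** Conjugation of parabolic subgroups reduces to conjugation of their simple reflections; for
    [M = L] this is the factorization of N_W(W_L) into W_L and N_L. *)
Lemma gen_conjP L M w : L \subset S -> M \subset S -> w \in W ->
  (<<L>> :^ w)%g = <<M>>%g ->
  exists2 u, u \in <<L>>%g & (u^-1 * w)%g \in X L /\ (L :^ (u^-1 * w))%g = M.
Proof.
move=> sLS sMS wW LwM; have [u uL nX] := Xset_factor sLS wW.
exists u => //; split=> //; apply: gen_conj_Xset => //.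
by rewrite conjsgM (conjGid (groupVr uL)).
Qed.

End Parabolics.

(** * Fixed spaces and Steinberg's theorem *)

Section FixedSpaces.

Implicit Types (J K L M A : {set gT}) (s t w x : gT) (v : 'rV[algC]_#|S|).

Local Notation root := rootv.
Local Notation n := #|S|.

Lemma coxB_real i j : coxB S i j \is Num.real.
Proof. by rewrite mxE rpredN Creal_Re. Qed.

Lemma mulmx_real m1 m2 m3 (A : 'M[algC]_(m1, m2)) (B : 'M[algC]_(m2, m3)) :
    (forall i j, A i j \is Num.real) -> (forall i j, B i j \is Num.real) ->
  forall i j, (A *m B) i j \is Num.real.
Proof. by move=> rA rB i j; rewrite mxE rpred_sum // => k _; rewrite rpredM. Qed.

Lemma rG_real w : w \in W -> forall i j, rG w i j \is Num.real.
Proof.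
rewrite memW; move: w; apply: gen_mulg_ind => [|s w sS wS IH] i j.
  by rewrite repr_mx1 mxE rpred_nat.
rewrite repr_mxM ?(subS_mem sS) ?memW //; apply: mulmx_real => // {}i {}j.
have [k ->] := idxP sS; rewrite hrG !mxE big_ord1 !mxE.
by rewrite rpredB ?rpredM ?rpredN ?Creal_Re ?rpred_nat.
Qed.

Lemma Re_rG w v : w \in W -> map_mx (@Re algC) (v *m rG w) = map_mx (@Re algC) v *m rG w.
Proof.
move=> wW; apply/rowP=> j; rewrite !mxE raddf_sum; apply: eq_bigr => k _ /=.
by rewrite ReMr ?rG_real // mxE.
Qed.

Lemma Im_rG w v : w \in W -> map_mx (@Im algC) (v *m rG w) = map_mx (@Im algC) v *m rG w.
Proof.
move=> wW; apply/rowP=> j; rewrite !mxE raddf_sum; apply: eq_bigr => k _ /=.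
by rewrite ImMr ?rG_real // mxE.
Qed.

Lemma formB_real v v' : (forall i, v 0 i \is Num.real) -> (forall i, v' 0 i \is Num.real) ->
  formB v v' \is Num.real.
Proof.
move=> rv rv'; apply: mulmx_real => [i j|i j]; last by rewrite mxE ord1.
by apply: mulmx_real => [{}i {}j|]; [rewrite ord1|apply: coxB_real].
Qed.

(** Take [u] in W_J maximizing the sum of the coordinates of [v *m rG u]: a reflection whose root
    pairs negatively with this vector would increase the sum. *)
Lemma dominant_exists J v : J \subset S -> (forall i, v 0 i \is Num.real) ->
  exists2 u, u \in <<J>>%g & forall s, s \in J -> 0 <= formB (v *m rG u) (root s).
Proof.
move=> sJS rv; pose h u : algC := \sum_i (v *m rG u) 0 i.
have rvu u : u \in W -> forall i, (v *m rG u) 0 i \is Num.real.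
  by move=> uW i; apply: mulmx_real => [a b|]; [rewrite ord1|apply: rG_real].
have hR u : u \in <<J>>%g -> h u \is Num.real.
  by move=> uJ; rewrite rpred_sum // => i _; apply/rvu/(mem_genS sJS).
have [/= u uJ umax] := @real_arg_maxP algC _ 1%g (mem <<J>>%g) h (group1 _) hR.
exists u => // s sJ; have sS := subsetP sJS _ sJ.
have uW := mem_genS sJS uJ; have sW := subS_mem sS.
have rB : formB (v *m rG u) (root s) \is Num.real.
  by apply: formB_real; [apply: rvu|move=> i; rewrite mxE rpred_nat].
case: (real_ge0P rB) => // ltB.
have usJ : (u * s)%g \in <<J>>%g by rewrite groupM // mem_gen.
have := umax _ usJ; rewrite /h repr_mxM // mulmxA rG_reflection //=.
have -> : \sum_i (v *m rG u - (2%:R * formB (v *m rG u) (root s)) *: root s) 0 i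
          = h u - 2%:R * formB (v *m rG u) (root s).
  under eq_bigr do rewrite mxE; rewrite big_split /=; congr (_ + _).
  rewrite (bigD1 (enum_rank_in sS s)) //= big1 => [|i ne].
    by rewrite !mxE enum_rankK_in // eqxx mulr1 addr0.
  rewrite !mxE; case: eqP => [e|_]; last by rewrite mulr0 oppr0.
  by case/eqP: ne; apply: enum_val_inj; rewrite enum_rankK_in.
rewrite -subr_ge0 opprD addrA subrr sub0r opprK.
by rewrite pmulr_rge0 ?ltr0n // => /(lt_le_trans ltB); rewrite ltxx.
Qed.

(** Induction on the length. If [s] shortens [w], the root of [s] goes to a nonpositive combination
    of [J]; invariance of the form then makes the pairing of [v] with that root both nonnegative and
    nonpositive, so [s] fixes [v] and can be stripped. *)
Lemma dominant_stab J v w : J \subset S -> (forall s, s \in J -> 0 <= formB v (root s)) ->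
    w \in <<J>>%g -> v *m rG w = v ->
  w \in <<[set s in J | formB v (root s) == 0]>>%g.
Proof.
move=> sJS dom; have [k] := ubnP (coxlen J w); elim: k w => // k IH w.
rewrite ltnS => le_k wJ vw; have [->|w1] := eqVneq w 1%g; first exact: group1.
have invJ : {in J, forall s, #[s]%g = 2%N} by move=> s /(subsetP sJS); apply: invS.
have [s sJ lt_sw] := coxlen_descent invJ wJ w1; have sS := subsetP sJS _ sJ.
have wW := mem_genS sJS wJ; have sW := subS_mem sS.
have neg := rootv_neg sJS sJ wJ lt_sw.
have Bs0 : formB v (root s) = 0.
  apply/eqP; rewrite eq_le dom // andbT -(formB_inv _ _ wW) vw formBC.
  rewrite -oppr_ge0 -formBN; have := posvP _ neg; set r := - _ => posr.
  have supp : suppv J r.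
    apply/suppvP=> i iJ; rewrite mxE (suppvP _ _ (suppv_rG sJS wJ (suppv_root sJ))) //.
    by rewrite oppr0.
  rewrite (suppv_decomp sJS supp) formB_suml sumr_ge0 // => i iJ.
  by rewrite formBZl mulr_ge0 // formBC dom.
have vs : v *m rG s = v by rewrite rG_reflection // Bs0 mulr0 scale0r subr0.
rewrite -(mulKs w sS) groupM //; first by rewrite mem_gen // inE sJ Bs0 /=.
apply: IH; first exact: leq_trans lt_sw le_k.
  by rewrite groupM // mem_gen.
by rewrite repr_mxM // mulmxA vs.
Qed.

Lemma gen_fix L v : L \subset W -> (forall s, s \in L -> v *m rG s = v) ->
  forall w, w \in <<L>>%g -> v *m rG w = v.
Proof.
move=> sLW fixL; apply: gen_mulg_ind => [|s w sL wL IH].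
  by rewrite repr_mx1 mulmx1.
have wW : w \in W by move: wL; apply/subsetP; rewrite gen_subG.
by rewrite repr_mxM ?(subsetP sLW _ sL) // mulmxA fixL.
Qed.

Lemma rG_conjM w x : w \in W -> x \in W -> rG x *m rG (w ^ x)%g = rG w *m rG x.
Proof. by move=> wW xW; rewrite -!repr_mxM ?groupJ // conjgE mulKVg. Qed.

Lemma conj_fix m (v : 'M[algC]_(m, n)) w x : w \in W -> x \in W ->
  (v *m rG x *m rG (w ^ x)%g == v *m rG x) = (v *m rG w == v).
Proof.
move=> wW xW; rewrite -[X in X == _]mulmxA rG_conjM // mulmxA.
by apply/eqP/eqP=> [e|->//]; rewrite -[LHS](repr_mxK rG xW) e repr_mxK.
Qed.

Lemma stab_vector J v : J \subset S -> (forall i, v 0 i \is Num.real) ->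
  exists L x, [/\ L \subset J, x \in <<J>>%g &
    forall w, w \in <<J>>%g -> (v *m rG w == v) = (w \in <<L>> :^ x)%g].
Proof.
move=> sJS rv; have [u uJ dom] := dominant_exists sJS rv; have uW := mem_genS sJS uJ.
exists [set s in J | formB (v *m rG u) (root s) == 0], (u^-1)%g.
split; [by apply/subsetP=> s; rewrite inE => /andP[]|by rewrite groupV|].
move=> w wJ; have wW := mem_genS sJS wJ; rewrite mem_conjgV.
rewrite -(conj_fix _ wW uW); apply/eqP/idP=> [|]; first exact: dominant_stab (groupJ wJ uJ).
apply: gen_fix => [|s]; first last.
  rewrite inE => /andP[sJ /eqP Bs0].
  by rewrite rG_reflection ?(subsetP sJS) // Bs0 mulr0 scale0r subr0.
by apply/subsetP=> s; rewrite inE => /andP[/(subsetP sJS)/subS_mem].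
Qed.

(** Steinberg's theorem for real vectors: each new vector is moved by [x^-1], so that its stabilizer
    is taken inside the standard parabolic found for the others. *)
Lemma stab_vectors (vs : seq 'rV[algC]_n) :
    (forall v, v \in vs -> forall i, v 0 i \is Num.real) ->
  exists L x, [/\ L \subset S, x \in W &
    forall w, w \in W -> all (fun v => v *m rG w == v) vs = (w \in <<L>> :^ x)%g].
Proof.
elim: vs => [|v vs IH] rvs.
  by exists S, 1%g; split=> // w wW; rewrite conjsg1 -memW wW.
have [|L [x [sLS xW stabL]]] := IH.
  by move=> u uvs; apply: rvs; rewrite inE uvs orbT.
have rv i : (v *m rG x^-1%g) 0 i \is Num.real.
  apply: mulmx_real => [a b|]; last by apply: rG_real; rewrite groupV.
  by rewrite ord1 rvs ?mem_head.
have [M [y [sML yL stabM]]] := stab_vector sLS rv.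
have yW := mem_genS sLS yL.
exists M, (y * x)%g; split; rewrite ?groupM ?(subset_trans sML) // => w wW.
rewrite /= stabL // conjsgM [in RHS]mem_conjg mem_conjg.
rewrite -(conj_fix v wW (groupVr xW)) andbC.
have [wL|wL] := boolP (w ^ x^-1 \in <<L>>)%g; first by rewrite andTb stabM.
rewrite andFb; apply/esym/negbTE; apply: contra wL; apply/subsetP.
by rewrite -(conjGid yL) conjSg genS.
Qed.

(** The matrices of [W] are real, so fixing the rows of [U] amounts to fixing their real and
    imaginary parts. *)
Lemma stab_space m (U : 'M[algC]_(m, n)) :
  exists L x, [/\ L \subset S, x \in W &
    forall w, w \in W -> (U *m rG w == U) = (w \in <<L>> :^ x)%g].
Proof.
pose vs := [seq map_mx (@Re algC) (row i U) | i <- enum 'I_m] ++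
           [seq map_mx (@Im algC) (row i U) | i <- enum 'I_m].
have [|L [x [sLS xW stabL]]] := @stab_vectors vs.
  by move=> v; rewrite mem_cat => /orP[] /mapP[i _ ->] j; rewrite mxE ?Creal_Re ?Creal_Im.
exists L, x; split=> // w wW; rewrite -stabL // all_cat !all_map.
apply/eqP/andP=> [Uw|[/allP fixRe /allP fixIm]].
  by split; apply/allP=> i _ /=; rewrite -?Re_rG -?Im_rG // -row_mul Uw.
apply/row_matrixP=> i; rewrite row_mul; apply/rowP=> j.
have mi : i \in Finite.enum 'I_m by rewrite -enumT mem_enum.
have := congr1 (fun v => v 0 j) (eqP (fixRe i mi)).
rewrite /= -Re_rG // mxE [RHS]mxE => eRe.
have := congr1 (fun v => v 0 j) (eqP (fixIm i mi)).
by rewrite /= -Im_rG // mxE [RHS]mxE => eIm; rewrite [LHS]Crect eRe eIm -Crect.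
Qed.

Lemma sub_Fixw m (U : 'M[algC]_(m, n)) w : (U <= Fixw rG w)%MS = (U *m rG w == U).
Proof. by rewrite sub_kermx mulmxBr mulmx1 subr_eq0. Qed.

Lemma sub_FixL m (U : 'M[algC]_(m, n)) A :
  (U <= FixL rG A)%MS = [forall w in A, U *m rG w == U].
Proof.
apply/sub_bigcapmxP/forall_inP => fixU w wA; have := fixU w wA; by rewrite sub_Fixw.
Qed.

Lemma FixL_fix A w : w \in A -> FixL rG A *m rG w = FixL rG A.
Proof.
by move=> wA; have := submx_refl (FixL rG A); rewrite sub_FixL => /forall_inP/(_ w wA)/eqP.
Qed.

Lemma FixL_gen L : L \subset W -> (FixL rG <<L>>%g :=: FixL rG L)%MS.
Proof.
move=> sLW; apply/eqmxP/andP; split; rewrite sub_FixL; apply/forall_inP=> w wL.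
  by rewrite FixL_fix // mem_gen.
apply/eqP/row_matrixP=> i; rewrite row_mul; apply: (gen_fix sLW) wL => s sL.
by rewrite -row_mul FixL_fix.
Qed.

Lemma FixL_conj A x : A \subset W -> x \in W -> (FixL rG (A :^ x)%g :=: FixL rG A *m rG x)%MS.
Proof.
move=> sAW xW; apply/eqmxP/andP; split; last first.
  rewrite sub_FixL; apply/forall_inP=> _ /imsetP[a aA ->]; have aW := subsetP sAW _ aA.
  by rewrite -[X in X == _]mulmxA rG_conjM // mulmxA FixL_fix.
rewrite -[X in (X <= _)%MS](repr_mxKV rG xW) submxMr // sub_FixL.
apply/forall_inP=> a aA; have aW := subsetP sAW _ aA.
have := rG_conjM (groupJ aW xW) (groupVr xW); rewrite conjgK => e.
by rewrite -[X in X == _]mulmxA e mulmxA FixL_fix // memJ_conjg.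
Qed.

Lemma Fixw_conj w x : w \in W -> x \in W -> (Fixw rG (w ^ x)%g :=: Fixw rG w *m rG x)%MS.
Proof.
move=> wW xW.
have Fix1 y : (Fixw rG y :=: FixL rG [set y])%MS by rewrite /FixL big_set1.
apply: eqmx_trans (Fix1 _) _; rewrite -conjg_set1.
apply: eqmx_trans (FixL_conj _ xW) _; first by rewrite sub1set.
exact/eqmxMr/eqmx_sym/Fix1.
Qed.

(** A vector of the radical is fixed by every reflection, so the sum over the group multiplies it by
    |W|. But this sum kills each simple root, since [s] negates its own root, and therefore kills
    everything. *)
Lemma coxB_unit : coxB S \in unitmx.
Proof.
rewrite -row_free_unit -kermx_eq0; apply/eqP/row_matrixP=> i; rewrite row0.
set v := row i _; have vB : v *m coxB S = 0.
  by apply/sub_kermxP; rewrite row_sub.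
have vfix w : w \in W -> v *m rG w = v.
  rewrite memW; apply: gen_fix => [|s sS]; first exact: sSW.
  by rewrite rG_reflection // /formB vB mul0mx mxE mulr0 scale0r subr0.
pose avg : 'M[algC]_n := \sum_(w in W) rG w.
have v_avg : v *m avg = #|W|%:R *: v.
  rewrite mulmx_sumr (eq_bigr (fun _ => v)) => [|w wW]; last exact: vfix.
  by rewrite sumr_const scaler_nat.
have root_avg s : s \in S -> root s *m avg = 0.
  move=> sS; have sW := subS_mem sS.
  have : root s *m avg = - (root s *m avg).
    rewrite {1}/avg (reindex_inj (mulgI s)) /= (eq_bigl (mem W)) => [|w]; last first.
      by rewrite groupMl.
    rewrite !mulmx_sumr -sumrN; apply: eq_bigr => w wW.
    by rewrite repr_mxM // mulmxA rG_root_self // mulNmx.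
  move/eqP; rewrite -subr_eq0 opprK -mulr2n -scaler_nat scaler_eq0 pnatr_eq0.
  by move/eqP.
have v0 : v *m avg = 0.
  rewrite (rootv_decomp v) mulmx_suml big1 // => j _.
  by rewrite -scalemxAl root_avg ?scaler0 ?enum_valP.
move/eqP: v0; rewrite v_avg scaler_eq0 pnatr_eq0 gtn_eqF ?cardG_gt0 //=.
by move/eqP.
Qed.

(** Nondegeneracy of the form provides [v] that pairs to 0 with the roots of [L] and to 1 with the
    other simple roots. It is dominant and lies in Fix(W_L), and [dominant_stab] confines its
    stabilizer to W_L. *)
Lemma FixL_stab L w : L \subset S -> w \in W ->
  (FixL rG L *m rG w == FixL rG L) = (w \in <<L>>%g).
Proof.
move=> sLS wW; have sLW : L \subset W by apply: subset_trans sLS _; apply: sSW.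
apply/eqP/idP=> [fixw|wL]; last first.
  apply/eqP; rewrite -sub_Fixw; apply: submx_trans (_ : (FixL rG <<L>>%g <= _)%MS).
    by rewrite (FixL_gen sLW).
  by rewrite sub_Fixw FixL_fix.
pose b : 'rV[algC]_n := \row_i (enum_val i \notin L)%:R.
pose v := b *m invmx (coxB S).
have Bv s : s \in S -> formB v (root s) = (s \notin L)%:R.
  case/idxP=> i ->; rewrite /formB rootv_enum trmx_delta mulmxKV ?coxB_unit //.
  by rewrite -colE !mxE.
have vL : (v <= FixL rG L)%MS.
  rewrite sub_FixL; apply/forall_inP=> s sL; have sS := subsetP sLS _ sL.
  by rewrite rG_reflection // Bv // sL mulr0 scale0r subr0.
have vw : v *m rG w = v.
  by case/submxP: vL => D ->; rewrite -mulmxA fixw.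
have dom s : s \in S -> 0 <= formB v (root s) by move=> sS; rewrite Bv // ler0n.
have wS : w \in <<S>>%g by rewrite -memW.
have := dominant_stab (subxx S) dom wS vw.
apply/subsetP/genS; apply/subsetP=> s; rewrite inE => /andP[sS].
by rewrite Bv // pnatr_eq0 eqb0 negbK.
Qed.

Lemma FixL_parabolic_inj L M x y : L \subset S -> M \subset S -> x \in W -> y \in W ->
  (FixL rG (<<L>> :^ x)%g :=: FixL rG (<<M>> :^ y)%g)%MS -> (<<L>> :^ x = <<M>> :^ y)%g.
Proof.
have half L' M' x' y' : L' \subset S -> M' \subset S -> x' \in W -> y' \in W ->
    (FixL rG (<<L'>> :^ x')%g :=: FixL rG (<<M'>> :^ y')%g)%MS ->
    (<<L'>> :^ x' \subset <<M'>> :^ y')%g.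
  move=> sL sM xW yW eqF.
  have sub K : K \subset S -> <<K>>%g \subset W.
    by move=> sK; apply/subsetP=> w; apply: mem_genS.
  apply/subsetP=> w wL; have wW : w \in W.
    move: wL; apply/subsetP; rewrite -(conjGid xW) conjSg; exact: sub.
  rewrite mem_conjg -(FixL_stab sM) ?groupJ ?groupV //.
  have FM : (FixL rG M' *m rG y' :=: FixL rG (<<L'>> :^ x')%g)%MS.
    apply: eqmx_trans (eqmx_sym eqF); apply: eqmx_sym.
    apply: eqmx_trans (FixL_conj (sub _ sM) yW) _; apply/eqmxMr/FixL_gen.
    by apply: subset_trans sM _; apply: sSW.
  have : (FixL rG M' *m rG y' <= Fixw rG w)%MS by rewrite FM sub_Fixw FixL_fix.
  by rewrite sub_Fixw -(conj_fix _ (groupJ wW (groupVr yW)) yW) conjgKV.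
move=> sL sM xW yW eqF; apply/eqP; rewrite eqEsubset half //=.
by apply: half => //; apply: eqmx_sym.
Qed.

Lemma FixL_flat A : A \subset W ->
  exists L x, [/\ L \subset S, x \in W & (FixL rG A :=: FixL rG (<<L>> :^ x)%g)%MS].
Proof.
move=> sAW; have [L [x [sLS xW stabL]]] := stab_space (FixL rG A).
exists L, x; split=> //; apply/eqmxP/andP; split.
  rewrite sub_FixL; apply/forall_inP=> w wL; rewrite stabL //.
  move: wL; apply/subsetP; rewrite -(conjGid xW) conjSg.
  by apply/subsetP=> ?; apply: mem_genS.
rewrite sub_FixL; apply/forall_inP=> a aA; rewrite FixL_fix //.
by rewrite -stabL ?(subsetP sAW) // FixL_fix.
Qed.

(** The projection onto Fix(W_L), orthogonal for the form by [formB_avg]. *)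
Definition avg L : 'M[algC]_n := #|<<L>>%g|%:R^-1 *: \sum_(w in <<L>>%g) rG w.

Lemma avg_FixL L : L \subset S -> (avg L <= FixL rG L)%MS.
Proof.
move=> sLS; rewrite sub_FixL; apply/forall_inP=> s sL; have sS := subsetP sLS _ sL.
rewrite -scalemxAl mulmx_suml; apply/eqP; congr (_ *: _).
rewrite [RHS](reindex_inj (mulIg s)) /= [RHS](eq_bigl (mem <<L>>%g)) => [|w].
  by apply: eq_bigr => w wL; rewrite repr_mxM ?(subS_mem sS) ?(mem_genS sLS wL).
by rewrite groupMr // mem_gen.
Qed.

Lemma formB_avg L v v' : L \subset S -> (v' <= FixL rG L)%MS -> formB (v *m avg L) v' = formB v v'.
Proof.
move=> sLS vL; have sLW : L \subset W by apply: subset_trans sLS _; apply: sSW.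
rewrite -scalemxAr formBZl mulmx_sumr formB_suml (eq_bigr (fun _ => formB v v')) => [|w wL].
  by rewrite sumr_const -[formB _ _ *+ _]mulr_natl mulrA mulVf ?mul1r // pnatr_eq0 -lt0n cardG_gt0.
rewrite -[RHS](formB_inv _ _ (mem_genS sLS wL)); congr (formB _ _); apply/esym.
by apply: (gen_fix sLW) wL => s sL; apply/eqP; move: vL; rewrite sub_FixL => /forall_inP->.
Qed.

Lemma sub_orthB v (U : 'M[algC]_n) :
  (v <= orthB (coxB S) U)%MS <-> (forall v', (v' <= U)%MS -> formB v v' = 0).
Proof.
split=> [|vU].
  rewrite sub_kermx mulmxA => /eqP vU v' /submxP[D ->].
  by rewrite /formB trmx_mul mulmxA vU mul0mx mxE.
rewrite sub_kermx mulmxA; apply/eqP/rowP=> j; rewrite [RHS]mxE -(vU (row j U)) ?row_sub //.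
by rewrite /formB tr_row colE mulmxA -colE [RHS]mxE.
Qed.

(** If [w] fixes [v], then [v] minus its average over W_L is fixed by [w] and orthogonal to
    Fix(W_L), hence zero. Conversely, a vector of Fix(W_L) orthogonal to that space is orthogonal to
    everything, by averaging. *)
Lemma cuspidalP L w : L \subset S -> w \in <<L>>%g ->
  reflect (Fixw rG w :=: FixL rG L)%MS (cuspidal rG (coxB S) L w).
Proof.
move=> sLS wL; rewrite /cuspidal wL /= mxrank_eq0.
have FL : (FixL rG L <= Fixw rG w)%MS.
  by rewrite sub_Fixw (FixL_stab sLS) // (mem_genS sLS).
apply: (iffP idP) => [/eqP cap0|eqF].
  apply/eqmxP; rewrite FL andbT; apply/rV_subP=> v vw.
  have va : (v *m avg L <= FixL rG L)%MS by apply: submx_trans (avg_FixL sLS); apply: submxMl.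
  suff /eqP: v - v *m avg L = 0 by rewrite subr_eq0 => /eqP->.
  apply/eqP; rewrite -submx0 -cap0 sub_capmx addmx_sub ?eqmx_opp ?(submx_trans va) //=.
  apply/sub_orthB=> v' v'L; rewrite formBDl formBN formB_avg // subrr //.
rewrite -submx0; apply/rV_subP=> v; rewrite sub_capmx eqF => /andP[vL /sub_orthB orth].
rewrite submx0; apply/eqP; rewrite -[v](mulmxK coxB_unit).
suff -> : v *m coxB S = 0 by rewrite mul0mx.
apply/rowP=> j; rewrite [RHS]mxE.
have -> : (v *m coxB S) 0 j = formB v (root (enum_val j)).
  by rewrite /formB rootv_enum trmx_delta -colE [RHS]mxE.
rewrite formBC -(formB_avg (L := L)) // formBC; apply: orth.
by apply: submx_trans (avg_FixL sLS); apply: submxMl.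
Qed.

(** [L] comes from the pointwise stabilizer of the fixed space of [w]: it is parabolic, contains
    [w], and fixes everything that [w] fixes. *)
Lemma cuspidal_exists w : w \in W ->
  exists L x, [/\ L \subset S, x \in W & cuspidal rG (coxB S) L (w ^ x)%g].
Proof.
move=> wW; have [L [x [sLS xW stabL]]] := stab_space (Fixw rG w).
have Lw : (w ^ x^-1)%g \in <<L>>%g.
  by rewrite -mem_conjg -stabL // -sub_Fixw.
have sLW : <<L>>%g \subset W by apply/subsetP=> ?; apply: mem_genS.
exists L, (x^-1)%g; split; rewrite ?groupV //; apply/cuspidalP => //.
apply/eqmxP/andP; split; last first.
  by rewrite sub_Fixw (FixL_stab sLS) // groupJ ?groupV.
rewrite (Fixw_conj wW (groupVr xW)) sub_FixL; apply/forall_inP=> s sL.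
have sW : s \in W by apply/subS_mem/(subsetP sLS).
have fixs : Fixw rG w *m rG (s ^ x)%g = Fixw rG w.
  by apply/eqP; rewrite (stabL _ (groupJ sW xW)) memJ_conjg mem_gen.
have := rG_conjM (groupJ sW xW) (groupVr xW); rewrite conjgK => e.
by rewrite -[X in X == _]mulmxA e mulmxA fixs.
Qed.

(** An element commuting with [w] preserves the fixed space of [w], which is Fix(W_L), and a
    parabolic subgroup is determined by its fixed space. *)
Lemma cuspidal_cent_norm L w : L \subset S -> cuspidal rG (coxB S) L w ->
  ('C_W[w] \subset 'N_W(<<L>>))%g.
Proof.
move=> sLS cusp; have wL : w \in <<L>>%g by case/andP: cusp.
have wW := mem_genS sLS wL.
have sLW : <<L>>%g \subset W by apply/subsetP=> ?; apply: mem_genS.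
have sLW' : L \subset W by apply: subset_trans sLS _; apply: sSW.
have eqF := cuspidalP sLS wL cusp; apply/subsetP=> c /setIP[cW /cent1P cw].
rewrite inE cW inE sub_conjg; suff -> : (<<L>> :^ c^-1)%g = <<L>>%g by rewrite subxx.
have cVW : (c^-1)%g \in W by rewrite groupV.
rewrite -[RHS]conjsg1; apply: FixL_parabolic_inj => //; rewrite conjsg1.
apply: eqmx_trans (FixL_conj sLW cVW) _.
have FL : (FixL rG <<L>>%g :=: Fixw rG w)%MS.
  exact: eqmx_trans (FixL_gen sLW') (eqmx_sym eqF).
apply: eqmx_trans (eqmxMr _ FL) _; apply: eqmx_trans (eqmx_sym (Fixw_conj wW cVW)) _.
suff -> : (w ^ c^-1)%g = w by apply: eqmx_sym.
by apply/conjg_fixP/commgP/commuteV/commute_sym.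
Qed.

Lemma alpha_L_w L w c : L \subset S -> cuspidal rG (coxB S) L w -> c \in ('C_W[w])%g ->
  alpha_L rG L c = alpha_w rG w c.
Proof.
move=> sLS cusp cC; have wL : w \in <<L>>%g by case/andP: cusp.
case/setIP: cC => cW /cent1P cw.
apply: (@restr_det_conj _ _ _ _ _ 1%:M); rewrite ?unitmx1 ?mul1mx ?mulmx1 //.
  exact/eqmx_sym/cuspidalP.
have wW := mem_genS sLS wL; rewrite sub_Fixw -[X in X == _]mulmxA -repr_mxM // cw repr_mxM // mulmxA.
by have := submx_refl (Fixw rG w); rewrite sub_Fixw => /eqP->.
Qed.

Lemma alpha_w_conj w c x : w \in W -> x \in W -> c \in ('C_W[w])%g ->
  alpha_w rG (w ^ x)%g (c ^ x)%g = alpha_w rG w c.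
Proof.
move=> wW xW /setIP[cW /cent1P cw].
apply: (@restr_det_conj _ _ _ _ _ (rG x)); first exact: rG_unit.
- exact: Fixw_conj.
- exact: rG_conjM.
rewrite sub_Fixw -[X in X == _]mulmxA -repr_mxM // cw repr_mxM // mulmxA.
by have := submx_refl (Fixw rG w); rewrite sub_Fixw => /eqP->.
Qed.

Lemma sgnW_det w : w \in W -> sgnW S w = \det (rG w).
Proof. by rewrite memW => wS; rewrite (det_coxlen (subxx S)). Qed.

Lemma sgnW_conj w x : w \in W -> x \in W -> sgnW S (w ^ x)%g = sgnW S w.
Proof.
move=> wW xW; rewrite !sgnW_det ?groupJ // conjgE !repr_mxM ?groupM ?groupV //.
by rewrite !det_mulmx mulrCA -det_mulmx -repr_mxM ?groupV // mulVg repr_mx1 det1 mulr1.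
Qed.

End FixedSpaces.

(** * The descent algebra *)

Section CosetSums.

Implicit Types (J K L M N P : {set gT}) (s t u w x y a b d : gT).

Local Notation X := (Xset W S).
Local Notation Xs := (Xsharp W S).
Local Notation x_ := (xJ W S).
Local Notation e_ := (eL W S).

Definition mKLv K L : algC := if L \subset K then (#|X K :&: Xs L|)%:R else 0.

Lemma mKLvE K L : L \subset K -> mKLv K L = \sum_(y in X K) ((L :^ y)%g \subset S)%:R.
Proof.
move=> sLK; rewrite /mKLv sLK -sum1_card natr_sum [RHS](bigID (fun y => (L :^ y)%g \subset S)) /=.
rewrite [X in _ = _ + X]big1 ?addr0 => [|y /andP[_ /negPf->] //].
rewrite [RHS](eq_bigr (fun _ => 1)) => [|y /andP[_ ->] //].
apply: eq_bigl => y; rewrite in_setI [y \in Xsharp _ _ _]in_set.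
by case: (boolP (y \in X K)) => //= /(subsetP (Xset_sub sLK))->.
Qed.

Lemma mKLv_diag L : L \subset S -> mKLv L L = #|Xs L|%:R.
Proof.
by move=> sLS; rewrite /mKLv subxx (setIidPr _) //; apply/subsetP=> y; rewrite in_set => /andP[].
Qed.

Lemma mKLv_neq0 L : L \subset S -> mKLv L L != 0.
Proof.
move=> sLS; rewrite mKLv_diag // pnatr_eq0 -lt0n; apply/card_gt0P; exists 1%g.
by rewrite in_set Xset_1 //= conjsg1.
Qed.

Lemma powerset_idx (T : nmodType) (F : {set gT} -> T) :
  \sum_(L in powerset S) F L = \sum_(i < #|powerset S|) F (enum_val i).
Proof. by rewrite big_enum_val. Qed.

Lemma pidxK L : L \subset S -> enum_val (pidx S L) = L.
Proof. by move=> sLS; rewrite /pidx enum_rankK_in // inE. Qed.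

(** The matrix is triangular for inclusion, with diagonal entries |X_L^#|, nonzero since 1 is
    counted. A vector of the left kernel vanishes at the large sets and then, by induction, at the
    smaller ones. *)
Lemma mKL_unit : mKL W S \in unitmx.
Proof.
rewrite -row_free_unit -kermx_eq0; apply/eqP/row_matrixP=> r; rewrite row0.
set v := row r _; have vM : v *m mKL W S = 0 by apply/sub_kermxP; rewrite row_sub.
have v0 : forall i, v 0 i = 0; last by apply/rowP=> i; rewrite v0 mxE.
move=> i; have [k] := ubnP (#|S| - #|(enum_val i : {set gT})|); elim: k i => // k IH i.
rewrite ltnS => le_k; have := congr1 (fun u : 'rV_ _ => u 0 i) vM.
have iS : enum_val i \subset S by have := enum_valP i; rewrite inE.
rewrite mxE [RHS]mxE (bigD1 i) //= big1 ?addr0 => [|j ji].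
  rewrite [mKL _ _ _ _]mxE /= subxx => /eqP; rewrite mulf_eq0 => /orP[/eqP//|].
  have := mKLv_neq0 iS; rewrite /mKLv subxx => /negPf->; by [].
rewrite [mKL _ _ _ _]mxE /=; case: ifP => [sij|_]; last by rewrite mulr0.
rewrite IH ?mul0r //; apply: leq_trans le_k.
have jS : enum_val j \subset S by have := enum_valP j; rewrite inE.
rewrite ltn_sub2l //; first last.
  rewrite proper_card // properEneq sij andbT; apply: contra ji => /eqP e.
  by apply/eqP/esym/enum_val_inj.
apply: leq_trans (subset_leq_card jS); rewrite proper_card // properEneq sij andbT.
by apply: contra ji => /eqP e; apply/eqP/esym/enum_val_inj.
Qed.

Lemma xJ_eL K : K \subset S -> x_ K = \sum_(L in powerset K) mKLv K L *: e_ L.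
Proof.
move=> sKS; transitivity (\sum_(L in powerset S) mKLv K L *: e_ L); last first.
  rewrite (bigID (mem (powerset K))) /= [X in _ + X]big1 ?addr0 => [|L /andP[_]].
    apply: eq_bigl => L; rewrite !inE; case: (boolP (L \subset K)); rewrite ?andbF //.
    by move/subset_trans->.
  by rewrite inE /mKLv => /negPf->; rewrite scale0r.
rewrite powerset_idx /eL.
transitivity (\sum_(i < #|powerset S|) \sum_(k < #|powerset S|)
  (mKL W S (pidx S K) i * invmx (mKL W S) i k) *: x_ (enum_val k)); last first.
  apply: eq_bigr => i _; rewrite powerset_idx scaler_sumr; apply: eq_bigr => k _.
  rewrite scalerA /pidx !enum_valK_in; congr ((_ * _) *: _).
  by rewrite mxE -/(pidx S K) pidxK.
rewrite exchange_big /= (bigD1 (pidx S K)) //= [X in _ + X]big1 ?addr0 => [|k kN].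
  rewrite -scaler_suml; have := mulmxV mKL_unit => /matrixP/(_ (pidx S K) (pidx S K)).
  by rewrite !mxE eqxx => ->; rewrite scale1r pidxK.
rewrite -scaler_suml; have := mulmxV mKL_unit => /matrixP/(_ (pidx S K) k).
by rewrite !mxE eq_sym (negPf kN) => ->; rewrite scale0r.
Qed.

(** The triangular system solved for its diagonal term; inductions on [L] go through this recursion
    instead of the inverse matrix. *)
Lemma eL_rec L : L \subset S ->
  e_ L = (mKLv L L)^-1 *: (x_ L - \sum_(K in powerset L | K != L) mKLv L K *: e_ K).
Proof.
move=> sLS; rewrite (xJ_eL sLS) (bigD1 L) ?inE //= addrK scalerA mulVf ?scale1r //.
exact: mKLv_neq0.
Qed.

Lemma xJE K g : x_ K g = (g^-1 \in X K)%g%:R.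
Proof.
rewrite sum_ffunE; have [gX|gX] := boolP (_ \in _).
  rewrite (bigD1 g^-1%g) //= ffunE invgK eqxx big1 ?addr0 // => y /andP[_ yg].
  by rewrite ffunE; case: eqP => // e; rewrite e invgK eqxx in yg.
rewrite big1 // => y yX; rewrite ffunE; case: eqP => // e.
by rewrite e invgK yX in gX.
Qed.

Lemma sum_Xset (T : nmodType) K L (F : gT -> T) : K \subset L -> L \subset S ->
  \sum_(y in X K) F y = \sum_(b in X K :&: <<L>>%g) \sum_(a in X L) F (b * a)%g.
Proof.
move=> sKL sLS; pose D := setX (X K :&: <<L>>%g) (X L).
have eqX : X K = [set (p.1 * p.2)%g | p in D].
  apply/setP=> y; apply/idP/imsetP=> [yK|[[b a] /setXP[/setIP[bK bL] aL] ->]]; last first.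
    by rewrite (Xset_mul sKL sLS).
  have [u uL aX] := Xset_factor sLS (Xset_mem yK).
  exists (u, (u^-1 * y)%g); last by rewrite /= mulKVg.
  apply/setXP; split=> //; apply/setIP; split=> //=.
  by rewrite -(Xset_mul sKL sLS uL aX) mulKVg.
rewrite {1}eqX big_imset => [|[b a] [b' a'] /setXP[/setIP[bK bL] aL] /setXP[/setIP[bK' bL'] aL'] /=].
  by rewrite pair_big; apply: eq_bigl => -[b a]; rewrite in_setX.
by case/(Xset_factor_uniq sLS bL bL' aL aL') => -> ->.
Qed.

(* Minimal length representatives of the (W_K, W_J)-double cosets of W_L. *)
Definition Dset J K L : {set gT} := [set d in X K :&: <<L>>%g | (d^-1)%g \in X J].

Lemma in_Dset J K L d :
  (d \in Dset J K L) = [&& d \in X K, d \in <<L>>%g & (d^-1)%g \in X J].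
Proof. by rewrite in_set in_setI -andbA. Qed.

Lemma conj_simple J K d s u : J \subset S -> K \subset S -> d \in X K -> (d^-1)%g \in X J ->
  s \in K -> u \in <<J>>%g -> (s ^ (d * u))%g \in J -> (s ^ d)%g \in J.
Proof.
move=> sJS sKS dK dJ sK uJ sduJ; have sS := subsetP sKS _ sK.
have dW := Xset_mem dK; have uW := mem_genS sJS uJ.
have sdJ : (s ^ d)%g \in <<J>>%g.
  by rewrite -(memJ_conjg _ u) (conjGid uJ) -conjgM mem_gen.
have supp : suppv J (rootv s *m rG d) by apply: suppv_conj.
have [r rJ e] : exists2 r, r \in J & rootv s *m rG d = rootv r.
  by apply: (Xset_simple sJS dJ sS dW sS) => //; apply: repr_mxK.
by rewrite (root_conj sS (subsetP sJS _ rJ) dW e).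
Qed.

(** If [d] sends a root of [K] into the span of [J], the image is the simple root of [s ^ d], and
    its sign is tested by [u]. Otherwise some coordinate outside [J] is nonzero, [u] does not change
    it, and the root keeps its sign. *)
Lemma Xset_double J K d u : J \subset S -> K \subset S -> d \in W -> (d^-1)%g \in X J ->
  u \in <<J>>%g ->
  (d * u \in X K)%g = (d \in X K) && (u \in X (J :&: K :^ d)%g).
Proof.
move=> sJS sKS dW dJ uJ; have uW := mem_genS sJS uJ.
have sJK : J :&: (K :^ d)%g \subset S by apply: subset_trans (subsetIl _ _) sJS.
have simp s : s \in K -> suppv J (rootv s *m rG d) ->
    (s ^ d)%g \in J /\ rootv s *m rG d = rootv (s ^ d)%g.
  move=> sK supp; have sS := subsetP sKS _ sK.
  have [r rJ e] : exists2 r, r \in J & rootv s *m rG d = rootv r.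
    by apply: (Xset_simple sJS dJ sS dW sS) => //; apply: repr_mxK.
  by rewrite (root_conj sS (subsetP sJS _ rJ) dW e).
(* W_J only moves the J-coordinates *)
have sign s : s \in K -> ~~ suppv J (rootv s *m rG d) ->
    posv (rootv s *m rG (d * u)%g) = posv (rootv s *m rG d).
  move=> sK; rewrite negb_forall => /existsP[i]; rewrite negb_imply => /andP[iJ vi].
  have sS := subsetP sKS _ sK.
  have rc := rG_coord (rootv s *m rG d) sJS uJ iJ; rewrite -mulmxA -repr_mxM // in rc.
  apply/idP/idP => pos; apply: contraT => /(rootS_neg sS _) neg.
    have /posvP/(_ i) := neg dW; rewrite mxE -rc oppr_ge0 => le0.
    by move: vi; rewrite -rc eq_le le0 (posvP _ pos).
  have /posvP/(_ i) := neg (groupM dW uW); rewrite mxE rc oppr_ge0 => le0.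
  by move: vi; rewrite eq_le le0 (posvP _ pos).
apply/(XsetP _ sKS)/andP=> [[_ pos]|[/(XsetP _ sKS)[_ posd] /(XsetP _ sJK)[_ posu]]].
  split; last first.
    apply/(XsetP _ sJK); split=> // r /setIP[rJ /imsetP[s sK rE]]; rewrite rE in rJ *.
    have sS := subsetP sKS _ sK.
    have supp : suppv J (rootv s *m rG d) by apply: suppv_conj => //; rewrite mem_gen.
    by have [_ <-] := simp s sK supp; rewrite -mulmxA -repr_mxM // pos.
  apply/(XsetP _ sKS); split=> // s sK.
  have [supp|nsupp] := boolP (suppv J (rootv s *m rG d)).
    by have [_ ->] := simp s sK supp; apply: posv_rootv.
  by rewrite -sign // pos.
split=> [|s sK]; first by rewrite groupM.
have [supp|nsupp] := boolP (suppv J (rootv s *m rG d)); last by rewrite sign // posd.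
have [sdJ e] := simp s sK supp; rewrite repr_mxM // mulmxA e posu //.
by rewrite inE sdJ memJ_conjg.
Qed.

Lemma sum_Dset (T : nmodType) J K L (F : gT -> T) : J \subset L -> K \subset L -> L \subset S ->
  \sum_(b in X K :&: <<L>>%g) F b
    = \sum_(d in Dset J K L) \sum_(u in X (J :&: K :^ d)%g :&: <<J>>%g) F (d * u)%g.
Proof.
move=> sJL sKL sLS; have sJS := subset_trans sJL sLS; have sKS := subset_trans sKL sLS.
have JL u : u \in <<J>>%g -> u \in <<L>>%g by apply/subsetP/genS.
pose D := [set p : gT * gT | (p.1 \in Dset J K L) && (p.2 \in X (J :&: K :^ p.1)%g :&: <<J>>%g)].
have -> : X K :&: <<L>>%g = [set (p.1 * p.2)%g | p in D].
  apply/setP=> b; apply/idP/imsetP=> [/setIP[bK bL]|[[d u]]]; last first.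
    rewrite in_set /= in_Dset => /andP[/and3P[dK dL dJ] /setIP[uX uJ]] ->.
    rewrite inE groupM // ?JL // andbT (Xset_double sJS sKS) ?dK ?(Xset_mem dK) //.
  have bW := Xset_mem bK.
  have [v vJ dX] := Xset_factor sJS (groupVr bW).
  pose d := (b * v)%g; have dE : (v^-1 * b^-1 = d^-1)%g by rewrite invMg.
  have dJ : (d^-1)%g \in X J by rewrite -dE.
  have dW : d \in W by rewrite groupM // (mem_genS sJS).
  have bE : b = (d * v^-1)%g by rewrite mulgK.
  have vVJ : (v^-1)%g \in <<J>>%g by rewrite groupV.
  have := bK; rewrite {1}bE (Xset_double sJS sKS) // => /andP[dK vX].
  exists (d, (v^-1)%g); last by [].
  have dL : d \in <<L>>%g by apply: groupM bL (JL _ vJ).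
  by rewrite in_set /= in_Dset in_setI dK dJ vVJ vX dL.
rewrite big_imset => [|[d u] [d' u']].
  rewrite pair_big_dep; by apply: eq_bigl => -[d u]; rewrite [in LHS]in_set.
rewrite [(d, u) \in D]in_set [(d', u') \in D]in_set /= !in_Dset.
move=> /andP[/and3P[_ _ dJ] /setIP[_ uJ]] /andP[/and3P[_ _ dJ'] /setIP[_ uJ']] e.
have e' : (u^-1 * d^-1 = u'^-1 * d'^-1)%g by rewrite -!invMg e.
have [] := Xset_factor_uniq sJS (groupVr uJ) (groupVr uJ') dJ dJ' e'.
by move=> /invg_inj-> /invg_inj->.
Qed.

(** [d] conjugates [K :&: J :^ d^-1] to [J :&: K :^ d], so translation by [d] matches their coset
    representatives; those of the second set then factor through W_J. *)
Lemma sum_Xset_double (T : nmodType) J K L d (F : gT -> T) :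
    J \subset L -> K \subset L -> L \subset S -> d \in Dset J K L ->
  \sum_(y in X (K :&: J :^ d^-1)%g) F y
    = \sum_(u in X (J :&: K :^ d)%g :&: <<J>>%g) \sum_(a in X J) F (d * (u * a))%g.
Proof.
move=> sJL sKL sLS; rewrite in_Dset => /and3P[dK dL dJ].
have sJS := subset_trans sJL sLS; have sKS := subset_trans sKL sLS.
have JKd : ((K :&: J :^ d^-1) :^ d = J :&: K :^ d)%g by rewrite conjIg conjsgKV setIC.
rewrite -(@sum_Xset _ (J :&: K :^ d)%g J (fun y => F (d * y)%g)) ?subsetIl //.
rewrite (reindex_inj (mulgI d)) /=; apply: eq_bigl => y.
rewrite -JKd (@Xset_conj (K :&: J :^ d^-1)%g) //.
- by apply: subset_trans (subsetIl _ _) sKS.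
- by apply: (subsetP (Xset_sub (subsetIl _ _))) dK.
- by rewrite JKd; apply: subset_trans (subsetIl _ _) sJS.
Qed.

End CosetSums.

Section DescentAlgebra.

Implicit Types (J K L M N P : {set gT}) (s t u w x y a b d : gT).

Local Notation X := (Xset W S).
Local Notation Xs := (Xsharp W S).
Local Notation x_ := (xJ W S).
Local Notation e_ := (eL W S).
Local Notation m_ := mKLv.

Lemma sum_powerset_conj (T : nmodType) K x (Q : pred {set gT}) (F : {set gT} -> T) :
  \sum_(N in powerset (K :^ x)%g | Q N) F N
    = \sum_(N in powerset K | Q (N :^ x)%g) F (N :^ x)%g.
Proof.
rewrite (reindex_inj (@conjsg_inj _ x)) /=; apply: eq_bigl => N.
by rewrite !powersetE conjSg.
Qed.

Section Conjugation.

Variables (L : {set gT}) (n : gT).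
Hypotheses (sLS : L \subset S) (nX : n \in X L) (sLnS : (L :^ n)%g \subset S).

Lemma xJ_conj K : K \subset L -> conv (x_ K) (gdelta n) = x_ (K :^ n)%g.
Proof.
move=> sKL; apply/ffunP=> g; rewrite conv_gdeltar !xJE invMg invgK.
by rewrite (Xset_conj _ sLS nX sLnS sKL).
Qed.

Lemma mKLv_conj K N : K \subset L -> N \subset K -> m_ (K :^ n)%g (N :^ n)%g = m_ K N.
Proof.
move=> sKL sNK; rewrite !mKLvE ?conjSg // [RHS](reindex_inj (mulgI n)) /=.
apply: eq_big => [y|y _]; first by rewrite (Xset_conj _ sLS nX sLnS sKL).
by rewrite conjsgM.
Qed.

(** [n] carries the coefficients and the x_N to those of the conjugate sets, hence also the solution
    of the recursion. The value at 1 is the same because every x_N takes the value 1 there. *)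
Lemma eL_conj K : K \subset L ->
  conv (e_ K) (gdelta n) = e_ (K :^ n)%g /\ e_ (K :^ n)%g 1%g = e_ K 1%g.
Proof.
elim/(@subset_ind gT): K => K IH sKL; have sKS := subset_trans sKL sLS.
have sKnS : (K :^ n)%g \subset S by apply: subset_trans sLnS; rewrite conjSg.
rewrite (eL_rec sKS) (eL_rec sKnS) sum_powerset_conj.
have -> : m_ (K :^ n)%g (K :^ n)%g = m_ K K by apply: mKLv_conj.
have -> : \sum_(N in powerset K | (N :^ n)%g != (K :^ n)%g) m_ (K :^ n)%g (N :^ n)%g *: e_ (N :^ n)%g
    = \sum_(N in powerset K | N != K) m_ K N *: e_ (N :^ n)%g.
  apply: eq_big => [N|N /andP[]]; first by rewrite (inj_eq (@conjsg_inj _ n)).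
  by rewrite inE => sNK _; rewrite mKLv_conj.
split.
  rewrite convZl convBl xJ_conj // conv_suml; congr (_ *: (_ - _)).
  apply: eq_bigr => N /andP[]; rewrite inE => sNK NK; rewrite convZl.
  by have [-> _] := IH N sNK NK (subset_trans sNK sKL).
have val1 (k : algC) (v v' : CW gT) : (k *: (v - v')) 1%g = k * ((v 1%g : algC) - v' 1%g).
  by rewrite !ffunE.
rewrite !val1; congr (_ * (_ - _)); first by rewrite !xJE invg1 !Xset_1.
rewrite !sum_ffunE.
apply: eq_bigr => N /andP[]; rewrite inE => sNK NK; rewrite !ffunE.
by have [_ ->] := IH N sNK NK (subset_trans sNK sKL).
Qed.

End Conjugation.

Lemma sum_eL_1 : \sum_(L in powerset S) e_ L = gdelta 1%g.
Proof.
have XS g : (g \in X S) = (g == 1%g).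
  apply/idP/eqP=> [gX|->]; last exact: Xset_1.
  by apply: (Xset_gen1 (subxx S)) => //; rewrite -memW (Xset_mem gX).
have <- : x_ S = gdelta 1%g.
  by apply/ffunP=> g; rewrite xJE ffunE XS -(inj_eq invg_inj) invgK invg1.
rewrite (xJ_eL (subxx S)); apply: eq_bigr => L; rewrite inE => sLS.
by rewrite mKLvE // (big_pred1 1%g) ?conjsg1 ?sLS ?scale1r.
Qed.

(* The element x_K of the group algebra of W_L. *)
Definition xr L K : CW gT := cres <<L>>%g (x_ K).

Lemma conv_xJ J L K : conv (x_ J) (xr L K)
  = \sum_(b in X K :&: <<L>>%g) \sum_(a in X J) gdelta (b * a)^-1%g.
Proof.
have -> : xr L K = \sum_(b in X K :&: <<L>>%g) gdelta b^-1%g.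
  rewrite /xr /xJ linear_sum /= (bigID (mem <<L>>%g)) /= [X in _ + X]big1 ?addr0.
    apply: eq_big => [b|b /andP[_ bL]]; first by rewrite in_setI.
    by rewrite cres_delta groupV bL scale1r.
  by move=> b /andP[_ bL]; rewrite cres_delta groupV (negPf bL) scale0r.
rewrite linear_sum; apply: eq_bigr => b _ /=; rewrite /xJ conv_suml.
by apply: eq_bigr => a _; rewrite conv_gdelta invMg.
Qed.

Lemma xJ_xr L K : K \subset L -> L \subset S -> conv (x_ L) (xr L K) = x_ K.
Proof. by move=> sKL sLS; rewrite conv_xJ [RHS](sum_Xset _ sKL sLS). Qed.

(* Solomon's Mackey formula for the product x_J x_K, in terms of the e_P. *)
Lemma xJ_xr_eL J K L : J \subset L -> K \subset L -> L \subset S ->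
  conv (x_ J) (xr L K) = \sum_(N in powerset J) m_ J N *:
    \sum_(b in X K :&: <<L>>%g | (N :^ b^-1)%g \subset K) e_ (N :^ b^-1)%g.
Proof.
move=> sJL sKL sLS; have sJS := subset_trans sJL sLS; have sKS := subset_trans sKL sLS.
(* With [P = N :^ b^-1] the coefficient m_{J,N} is unfolded over X_J. The right-hand side becomes a
   sum over [b] and [P], compared with the left one double coset representative [d] at a time. *)
pose G P b : CW gT := ((P :^ b)%g \subset J)%:R *:
  \sum_(a in X J) ((P :^ (b * a))%g \subset S)%:R *: e_ P.
transitivity (\sum_(b in X K :&: <<L>>%g) \sum_(P in powerset K) G P b); last first.
  under [RHS]eq_bigr do rewrite scaler_sumr.
  rewrite (exchange_big_dep (mem (X K :&: <<L>>%g))) /=; last by move=> N b _ /andP[].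
  apply: eq_bigr => b bK.
  transitivity (\sum_(P in powerset K | (P :^ b)%g \subset J) m_ J (P :^ b)%g *: e_ P).
    rewrite [LHS](bigID (fun P => (P :^ b)%g \subset J)) /= [X in _ + X]big1 ?addr0.
      apply: eq_bigr => P /andP[_ PbJ]; rewrite /G PbJ scale1r -scaler_suml.
      by rewrite mKLvE //; congr (_ *: _); apply: eq_bigr => a _; rewrite conjsgM.
    by move=> P /andP[_ /negPf PbJ]; rewrite /G PbJ scale0r.
  rewrite (reindex_inj (@conjsg_inj _ b^-1%g)) /=.
  apply: eq_big => [N|N _]; last by rewrite conjsgKV.
  by rewrite bK !powersetE conjsgKV andbC.
rewrite conv_xJ (sum_Dset _ sJL sKL sLS) [RHS](sum_Dset _ sJL sKL sLS).
apply: eq_bigr => d dD; set M := (K :&: J :^ d^-1)%g.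
have sMK : M \subset K by apply: subsetIl.
have sMS := subset_trans sMK sKS.
transitivity (x_ M).
  rewrite /xJ (sum_Xset_double _ sJL sKL sLS dD); apply: eq_bigr => u _.
  by apply: eq_bigr => a _; rewrite mulgA.
rewrite (xJ_eL sMS) exchange_big /= [RHS](bigID (fun P => P \subset M)) /=.
move: dD; rewrite in_Dset => /and3P[dK dL dJ].
rewrite [X in _ = _ + X]big1 ?addr0 => [|P /andP[]]; last first.
  rewrite inE => sPK PM; apply: big1 => u /setIP[_ uJ]; rewrite /G.
  case: (boolP ((P :^ (d * u))%g \subset J)) => [sub|_]; last by rewrite scale0r.
  case/negP: PM; rewrite subsetI sPK /= -sub_conjg; apply/subsetP=> _ /imsetP[s sP ->].
  apply: (conj_simple sJS sKS dK dJ (subsetP sPK _ sP) uJ).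
  by apply: (subsetP sub); rewrite memJ_conjg.
apply: eq_big => [P|P]; first by rewrite !inE andbC; case: (boolP (P \subset M)) => // /subset_trans->.
rewrite inE => sPM; have sPK := subset_trans sPM sMK.
have PdJ : (P :^ d)%g \subset J by move: sPM; rewrite subsetI -sub_conjg => /andP[].
rewrite mKLvE // (@sum_Xset_double _ J K L d) // ?in_Dset ?dK ?dL // scaler_suml.
apply: eq_bigr => u /setIP[uX uJ]; rewrite /G scaler_suml.
(* By [Xset_simple], only simple roots of [J] can be sent by [a] to simple roots; so if [a] carries
   the conjugate of [P] into [S], that conjugate already lay in [J]. *)
have eq_a a : a \in X J -> (P :^ (d * (u * a)))%g \subset S -> (P :^ (d * u))%g \subset J.
  move=> aJ PS; apply/subsetP=> _ /imsetP[s sP ->].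
  have sS := subsetP sKS _ (subsetP sPK _ sP).
  have dW := Xset_mem dK; have uW := mem_genS sJS uJ; have aW := Xset_mem aJ.
  have duW : (d * u)%g \in W by rewrite groupM.
  have sdJ : (s ^ d)%g \in J by apply: (subsetP PdJ); rewrite memJ_conjg.
  have sduJ : (s ^ (d * u))%g \in <<J>>%g by rewrite conjgM groupJ // mem_gen.
  have tS : (s ^ (d * u * a))%g \in S.
    by apply: (subsetP PS); rewrite -mulgA memJ_conjg.
  have duK : (d * u)%g \in X K.
    by rewrite (Xset_double sJS sKS) // dK.
  have posdu : posv (rootv s *m rG (d * u)%g).
    by have [_ ->] := XsetP _ sKS duK; rewrite ?(subsetP sPK).
  have supp := suppv_conj sJS sS duW sduJ.
  have pos : posv (rootv s *m rG (d * u * a)%g).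
    by rewrite repr_mxM // mulmxA (posv_Xset sJS aJ).
  have e := conj_root sS tS (groupM duW aW) erefl pos.
  have [r rJ er] : exists2 r, r \in J & rootv s *m rG (d * u)%g = rootv r.
    by apply: (Xset_simple sJS aJ sS duW tS supp); rewrite -e repr_mxM // mulmxA.
  by rewrite (root_conj sS (subsetP sJS _ rJ) duW er).
case: (boolP ((P :^ (d * u))%g \subset J)) => sub.
  by rewrite scale1r; apply: eq_bigr => a _; rewrite mulgA.
rewrite scale0r big1 // => a aJ; case: (boolP (_ \subset S)) => [PS|_]; last by rewrite scale0r.
by case/negP: sub; apply: eq_a aJ PS.
Qed.

(** In the recursion for e_J, the terms of [xJ_xr_eL] with [N] proper in [J] are those that the
    induction hypothesis subtracts. *)
Lemma eL_xr J K L : J \subset L -> K \subset L -> L \subset S ->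
  conv (e_ J) (xr L K) = \sum_(b in X K :&: <<L>>%g | (J :^ b^-1)%g \subset K) e_ (J :^ b^-1)%g.
Proof.
elim/(@subset_ind gT): J => J IH sJL sKL sLS; have sJS := subset_trans sJL sLS.
rewrite (eL_rec sJS) convZl convBl (xJ_xr_eL sJL) // conv_suml.
rewrite (bigD1 J) ?inE //= [X in _ - X](eq_bigr (fun N => m_ J N *:
    \sum_(b in X K :&: <<L>>%g | (N :^ b^-1)%g \subset K) e_ (N :^ b^-1)%g)).
  by rewrite addrK scalerA mulVf ?scale1r // mKLv_neq0.
move=> N /andP[]; rewrite inE => sNJ NJ; rewrite convZl IH //.
exact: subset_trans sNJ sJL.
Qed.

Lemma eL_xr0 K L : K \subset L -> K != L -> L \subset S -> conv (e_ L) (xr L K) = 0.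
Proof.
move=> sKL KL sLS; rewrite eL_xr // big1 // => b /andP[_ LbK].
case/eqP: KL; apply/eqP; rewrite eqEcard sKL.
by rewrite -(cardJg L b^-1%g) subset_leq_card.
Qed.

(** By the recursion, e_L lies in the span of the x_K with [K] inside [L]. *)
Lemma eL_ext (h h' : {linear CW gT -> CW gT}) L : L \subset S ->
  (forall K, K \subset L -> h (x_ K) = h' (x_ K)) -> h (e_ L) = h' (e_ L).
Proof.
elim/(@subset_ind gT): L => L IH sLS hx; rewrite (eL_rec sLS).
rewrite (linearZ_LR h) (linearZ_LR h') (linearB h) (linearB h') (hx L) //.
congr (_ *: (_ - _)); rewrite (linear_sum h) (linear_sum h').
apply: eq_bigr => K /andP[]; rewrite inE => sKL KL.
rewrite (linearZ_LR h) (linearZ_LR h') IH // ?(subset_trans sKL) // => N sNK.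
exact/hx/(subset_trans sNK).
Qed.

Definition fL L : CW gT := cres <<L>>%g (e_ L).

(** Checked on the x_N, where it is the factorization of X_N over W_L. For [K = L] it recovers e_L
    from its restriction to W_L. *)
Lemma xJ_cres_eL K L : K \subset L -> L \subset S -> conv (x_ L) (cres <<L>>%g (e_ K)) = e_ K.
Proof.
move=> sKL sLS; apply: (eL_ext (h := conv (x_ L) \o cres <<L>>%g) (h' := idfun)).
  exact: subset_trans sLS.
by move=> N sNK; apply: xJ_xr => //; apply: subset_trans sKL.
Qed.

Lemma fL_xr0 K L : K \subset L -> K != L -> L \subset S -> conv (fL L) (xr L K) = 0.
Proof.
move=> sKL KL sLS; have := eL_xr0 sKL KL sLS => /(congr1 (cres <<L>>%g)).
by rewrite /xr -[<<L>>%g]/(gval <<L>>%G) cres_conv linear0.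
Qed.

Lemma fL_cres_eL0 K L : K \subset L -> K != L -> L \subset S ->
  conv (fL L) (cres <<L>>%g (e_ K)) = 0.
Proof.
move=> sKL KL sLS; apply: (eL_ext (h := conv (fL L) \o cres <<L>>%g) (h' := \0)).
  exact: subset_trans sLS.
move=> N sNK; apply: fL_xr0 => //; first exact: subset_trans sKL.
by apply: contraNneq KL => NL; rewrite eqEsubset sKL -NL sNK.
Qed.

Lemma xr_LL L : L \subset S -> xr L L = gdelta 1%g.
Proof.
move=> sLS; apply/ffunP=> g; rewrite !ffunE xJE; case: ifP => gL.
  congr (nat_of_bool _)%:R; apply/idP/eqP=> [gX|->]; last by rewrite invg1 Xset_1.
  apply/invg_inj; rewrite invg1; apply: (Xset_gen1 sLS) gX.
  by rewrite groupV.
by case: eqP => // g1; rewrite g1 group1 in gL.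
Qed.

(** On W_L the recursion has x_L restricting to 1, while [fL L] annihilates from the left the
    restrictions of the e_K with [K] proper in [L]. *)
Lemma fL_idem L : L \subset S -> conv (fL L) (fL L) = (m_ L L)^-1 *: fL L.
Proof.
move=> sLS; pose h : {linear CW gT -> CW gT} := conv (fL L) \o cres <<L>>%g.
rewrite -[LHS]/(h (e_ L)) (eL_rec sLS) (linearZ_LR h) (linearB h).
have -> : h (x_ L) = fL L by rewrite /h /= -/(xr L L) xr_LL // conv1r.
rewrite (linear_sum h) big1 ?subr0 // => K /andP[]; rewrite inE => sKL KL.
by rewrite -[LHS]/(h _) (linearZ_LR h) /= fL_cres_eL0 ?scaler0.
Qed.

(** The dimension is the trace of the projection [p]: restrict to W_L, multiply by [fL L] on the
    left, rescale by m_LL. Each element of W_L contributes the diagonal entry m_LL e_L(1). *)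
Lemma dim_fL L : L \subset S ->
  (\dim <<[seq conv (fL L) (gdelta h) | h in <<L>>%g]>>%VS)%:R
    = (#|<<L>>%g| * #|Xs L|)%:R * e_ L 1%g :> algC.
Proof.
move=> sLS; pose p : {linear CW gT -> CW gT} := m_ L L \*: (conv (fL L) \o cres <<L>>%g).
set U := span _; have mLL := mKLv_neq0 sLS.
have fU h : h \in <<L>>%g -> conv (fL L) (gdelta h) \in U.
  by move=> hL; apply/memv_span/imageP; exists h.
have pU v : p v \in U.
  rewrite /p /= memvZ // [v]gdelta_sum !linear_sum memv_suml // => h _.
  rewrite !linearZ /= memvZ // cres_delta !linearZ /=.
  by case: (boolP (h \in _)) => hL; rewrite ?scale0r ?mem0v // scale1r fU.
have pid v : v \in U -> p v = v.
  move=> /coord_span ->; rewrite (linear_sum p); apply: eq_bigr => i _.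
  rewrite (linearZ_LR p); congr (_ *: _).
  have : [seq conv (fL L) (gdelta h) | h in <<L>>%g]`_i \in [seq conv (fL L) (gdelta h) | h in <<L>>%g].
    by rewrite mem_nth // size_image.
  case/imageP=> h hL ->; rewrite /p /= cres_id.
    by rewrite -convA fL_idem // convZl scalerA mulfV // scale1r.
  move=> g gL; rewrite conv_gdeltar ffunE; case: ifP => // ghL.
  by rewrite groupMr ?groupV // (negPf gL) in ghL.
rewrite -(ftr_projector pU pid) /ftr /p.
rewrite (bigID (mem <<L>>%g)) /= [X in _ + X]big1 ?addr0.
  rewrite (eq_bigr (fun _ => m_ L L * (e_ L 1%g : algC))) => [|h hL].
    by rewrite sumr_const mKLv_diag // natrM -mulrA !mulr_natl.
  by rewrite cres_fdelta hL scale1r ffunE conv_gdeltar mulgV ffunE group1.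
by move=> h hL; rewrite cres_fdelta (negPf hL) scale0r linear0 scaler0 ffunE.
Qed.

End DescentAlgebra.

(** * The group algebra graded by parabolic subgroups *)

Section RegularCharacter.

Implicit Types (J K L M N P : {set gT}) (s t u w x y a b d g h : gT).

Local Notation X := (Xset W S).
Local Notation Xs := (Xsharp W S).
Local Notation x_ := (xJ W S).
Local Notation e_ := (eL W S).

Definition parab : {set {set gT}} := [set (<<p.1>> :^ p.2)%g | p in setX (powerset S) W].

Lemma parabP P : reflect (exists L x, [/\ L \subset S, x \in W & P = (<<L>> :^ x)%g]) (P \in parab).
Proof.
apply: (iffP imsetP) => [[[L x] /setXP[]]|[L [x [sLS xW ->]]]].
  by rewrite powersetE => sLS xW ->; exists L, x.
by exists (L, x) => //; rewrite in_setX powersetE sLS.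
Qed.

Lemma parab_gen L : L \subset S -> <<L>>%g \in parab.
Proof. by move=> sLS; apply/parabP; exists L, 1%g; rewrite conjsg1. Qed.

Lemma parab_conj P g : g \in W -> P \in parab -> (P :^ g)%g \in parab.
Proof.
move=> gW /parabP[L [x [sLS xW ->]]]; apply/parabP; exists L, (x * g)%g.
by rewrite groupM // conjsgM.
Qed.

Definition Usp L x : {vspace CW gT} := span [seq conv (e_ L) (gdelta (h * x)%g) | h in <<L>>%g].

Lemma memUsp L x h : h \in <<L>>%g -> conv (e_ L) (gdelta (h * x)%g) \in Usp L x.
Proof. by move=> hL; apply/memv_span/imageP; exists h. Qed.

(** Write x y^-1 = u n as in [gen_conjP]: right multiplication by [n] turns e_L into e_M, so the
    first family of generators is contained in the second. *)
Lemma Usp_sub L M x y : L \subset S -> M \subset S -> x \in W -> y \in W ->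
  (<<L>> :^ x = <<M>> :^ y)%g -> (Usp L x <= Usp M y)%VS.
Proof.
move=> sLS sMS xW yW LM; apply/span_subvP=> _ /imageP[h hL ->].
have [|u uL [nX LnM]] := @gen_conjP L M (x * y^-1)%g sLS sMS (groupM xW (groupVr yW)).
  by rewrite conjsgM LM conjsgK.
set n := (u^-1 * (x * y^-1))%g in nX LnM.
have -> : (h * x = n * ((h * u) ^ n * y))%g.
  by rewrite mulgA conjgE mulKVg /n -!mulgA mulVg mulg1 mulKVg.
have sLnS : (L :^ n)%g \subset S by rewrite LnM.
have [e _] := eL_conj sLS nX sLnS (subxx L).
rewrite -conv_gdeltaA e LnM memUsp // -LnM genJ memJ_conjg groupM //.
Qed.

(* All the summands coincide (UPE): this is e_L CW_L x for any L, x with P = W_L^x. *)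
Definition UP P : {vspace CW gT} :=
  (\sum_(p in setX (powerset S) W | (<<p.1>> :^ p.2)%g == P) Usp p.1 p.2)%VS.

Lemma UPE L x : L \subset S -> x \in W -> UP (<<L>> :^ x)%g = Usp L x.
Proof.
move=> sLS xW; apply/eqP; rewrite eqEsubv; apply/andP; split.
  apply/subv_sumP=> -[M y] /andP[/setXP[]]; rewrite powersetE /= => sMS yW /eqP e.
  exact: Usp_sub.
by apply: (sumv_sup (L, x)); rewrite ?in_setX ?powersetE ?sLS ?xW //= eqxx.
Qed.

Lemma UP_gen L : L \subset S -> UP <<L>>%g = span [seq conv (e_ L) (gdelta h) | h in <<L>>%g].
Proof.
move=> sLS; rewrite -[<<L>>%g in LHS]conjsg1 UPE // /Usp; congr span.
by apply: eq_image => // h; rewrite mulg1.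
Qed.

Lemma UP_mul P g v : P \in parab -> g \in W -> v \in UP P ->
  conv v (gdelta g) \in UP (P :^ g)%g.
Proof.
move=> /parabP[L [x [sLS xW ->]]] gW; rewrite -conjsgM !UPE ?groupM //.
move=> vU; pose f := linfun (convr (gdelta g)).
have : f v \in (f @: Usp L x)%VS by apply: memv_img.
rewrite lfunE /= limg_span; apply/subvP/span_subvP=> _ /mapP[_ /imageP[h hL ->] ->].
by rewrite lfunE /= /convr conv_gdeltaA -mulgA memUsp.
Qed.

(** Multiplication by x_L on the left and by [x] on the right maps f_L CW_L onto this space. An
    upper bound suffices, since the sum of these spaces is everything by [CWsp_sum]. *)
Lemma dim_Usp L x : L \subset S ->
  (\dim (Usp L x))%:R <= (#|<<L>>%g| * #|Xs L|)%:R * e_ L 1%g :> algC.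
Proof.
move=> sLS; rewrite -dim_fL // ler_nat.
pose f : 'End(CW gT) := linfun (convr (gdelta x) \o conv (x_ L)).
set U := span _; have -> : Usp L x = (f @: U)%VS.
  rewrite limg_span /Usp; congr span; rewrite -map_comp; apply: eq_map => h /=.
  rewrite lfunE /= /convr -convA xJ_cres_eL // conv_gdeltaA //.
by rewrite -(limg_ker_dim f U) leq_addl.
Qed.

(** [F] parametrizes the pairs with the same parabolic by W_L and X_L^#, using [gen_conjP]; on all
    of them the value at 1 is that of e_L, by [eL_conj]. *)
Lemma fiber_sum L x : L \subset S -> x \in W ->
  \sum_(p in setX (powerset S) W | (<<p.1>> :^ p.2)%g == (<<L>> :^ x)%g) (e_ p.1 1%g : algC)
    = (#|<<L>>%g| * #|Xs L|)%:R * e_ L 1%g.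
Proof.
move=> sLS xW; pose D := setX <<L>>%g (Xs L).
pose F (q : gT * gT) : {set gT} * gT := ((L :^ q.2)%g, (q.2^-1 * q.1 * x)%g).
have XsP n : n \in Xs L -> [/\ n \in X L, n \in W & (L :^ n)%g \subset S].
  by rewrite in_set => /andP[nX ->]; rewrite (Xset_mem nX).
rewrite (eq_bigl (mem (F @: D))) => [|[M y]]; last first.
  apply/idP/imsetP=> [/andP[/setXP[]]|[[u n] /setXP[uL /XsP[nX nW LnS]] [-> ->]]]; last first.
    have uW := mem_genS sLS uL.
    rewrite in_setX powersetE LnS !groupM ?groupV //= genJ -conjsgM.
    by rewrite !mulgA mulgV mul1g conjsgM (conjGid uL).
  rewrite powersetE /= => sMS yW /eqP e.
  have [|u uL [nX LnM]] := @gen_conjP L M (x * y^-1)%g sLS sMS (groupM xW (groupVr yW)).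
    by rewrite conjsgM -e conjsgK.
  exists ((u^-1)%g, (u^-1 * (x * y^-1))%g).
    by rewrite in_setX groupV uL in_set nX LnM.
  by rewrite /F /= LnM !invMg !invgK; rewrite mulgK mulgKV.
rewrite big_imset => [|[u n] [u' n'] /setXP[uL /XsP[nX _ _]] /setXP[uL' /XsP[nX' _ _]] [_]].
  rewrite (eq_bigr (fun _ => e_ L 1%g : algC)) => [|[u n] /setXP[_ /XsP[nX nW LnS]]].
    by rewrite sumr_const cardsX mulr_natl.
  by have [_ ->] := eL_conj sLS nX LnS (subxx L).
move/mulIg => e; have e' : (u^-1 * n = u'^-1 * n')%g.
  by apply: invg_inj; rewrite !invMg !invgK.
by have [/invg_inj-> ->] := Xset_factor_uniq sLS (groupVr uL) (groupVr uL') nX nX' e'.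
Qed.

(* The (L, x) with W_L^x = P number |W_L| m_LL, and the e_L(1) add up to 1. *)
Lemma sum_dim_UP : (\sum_(P in parab) \dim (UP P) <= #|W|)%N.
Proof.
rewrite -(ler_nat algC) natr_sum.
apply: (@le_trans _ _ (\sum_(P in parab) \sum_(p in setX (powerset S) W | (<<p.1>> :^ p.2)%g == P)
  (e_ p.1 1%g : algC))).
  apply: ler_sum => _ /parabP[L [x [sLS xW ->]]].
  by rewrite UPE // fiber_sum // dim_Usp.
rewrite -(partition_big (fun p : {set gT} * gT => (<<p.1>> :^ p.2)%g) (mem parab)); last first.
  by move=> p pD; apply/imsetP; exists p.
have -> : \sum_(p in setX (powerset S) W) (e_ p.1 1%g : algC)
    = \sum_(L in powerset S) \sum_(x in W) (e_ L 1%g : algC).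
  by rewrite pair_big; apply: eq_bigl => -[L x]; rewrite in_setX.
under eq_bigr do rewrite sumr_const.
have e1 : \sum_(L in powerset S) (e_ L 1%g : algC) = 1.
  by have := congr1 (fun v : CW gT => v 1%g) sum_eL_1; rewrite /= sum_ffunE ffunE eqxx.
by rewrite sumrMnl e1.
Qed.

(** The type [gT] may be larger than [W]; this is the group algebra of [W] inside all functions on
    [gT]. *)
Definition CWsp : {vspace CW gT} := span [seq gdelta w | w in W].

Lemma memCWsp (v : CW gT) : (forall w, w \notin W -> v w = 0) -> v \in CWsp.
Proof.
move=> v0; rewrite [v]gdelta_sum (bigID (mem W)) /= [X in _ + X]big1 ?addr0.
  by apply: memv_suml => w wW; apply/memvZ/memv_span/imageP; exists w.
by move=> w wW; rewrite v0 // scale0r.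
Qed.

Lemma CWspP (v : CW gT) w : v \in CWsp -> w \notin W -> v w = 0.
Proof.
move=> vW wW; have -> : v = cres W v; last by rewrite ffunE (negPf wW).
have /coord_span -> := vW; apply/esym; rewrite (linear_sum (cres W)); apply: eq_bigr => i _.
rewrite (linearZ_LR (cres W)); congr (_ *: _).
have : [seq gdelta w | w in W]`_i \in [seq gdelta w | w in W] by rewrite mem_nth // size_image.
by case/imageP=> h hW ->; rewrite /= cres_delta hW scale1r.
Qed.

Lemma cres_CWsp (v : CW gT) : cres W v \in CWsp.
Proof. by apply: memCWsp => w wW; rewrite ffunE (negPf wW). Qed.

Lemma dim_CWsp : \dim CWsp = #|W|.
Proof.
apply/eqP; rewrite -(eqr_nat algC) -(@ftr_projector _ CWsp (cres W)).
- apply/eqP; rewrite /ftr -sum1_card natr_sum [RHS]big_mkcond; apply: eq_bigr => g _.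
  by rewrite !ffunE eqxx; case: ifP.
- exact: cres_CWsp.
- by move=> v vW; apply: cres_id => w wW; apply: CWspP.
Qed.

Lemma eL_CWsp L : L \subset S -> e_ L \in CWsp.
Proof.
move=> sLS; apply: memCWsp => w wW.
suff <- : cres W (e_ L) = e_ L by rewrite ffunE (negPf wW).
apply: (eL_ext (h := cres W) (h' := idfun)) => // K sKL; apply: cres_id => g gW.
by rewrite xJE; case: (boolP (_ \in X _)) => // /Xset_mem; rewrite groupV (negPf gW).
Qed.

Lemma CWsp_sum : (\sum_(P in parab) UP P)%VS = CWsp.
Proof.
apply/eqP; rewrite eqEsubv; apply/andP; split.
  apply/subv_sumP=> _ /parabP[L [x [sLS xW ->]]]; rewrite UPE //.
  apply/span_subvP=> _ /imageP[h hL ->]; have hW := mem_genS sLS hL.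
  apply: memCWsp => w wW; rewrite conv_gdeltar (CWspP (eL_CWsp sLS)) //.
  by rewrite groupMr ?groupV ?groupM.
apply/span_subvP=> _ /imageP[w wW ->].
rewrite -(conv1l (gdelta w)) -sum_eL_1 conv_suml memv_suml // => L; rewrite powersetE => sLS.
have LP : (<<L>> :^ w)%g \in parab by apply/parabP; exists L, w.
apply: (subvP (sumv_sup _ LP (subvv _))); rewrite UPE //.
by rewrite -{1}[w]mul1g memUsp.
Qed.

Definition chiU P g : algC := vtr (UP P) (convr (gdelta g)).

Lemma PhiL_chiU L g : L \subset S -> PhiL W S L g = chiU <<L>>%g g.
Proof. by move=> sLS; rewrite /chiU UP_gen. Qed.

Lemma cfReg_chiU g : g \in W -> cfReg W g = \sum_(P in parab | (P :^ g)%g == P) chiU P g.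
Proof.
move=> gW; have indep (u : {set gT} -> CW gT) :
    (forall P, P \in parab -> u P \in UP P) -> \sum_(P in parab) u P \in 0%VS ->
    forall P, P \in parab -> u P = 0.
  move=> uU; rewrite memv0 => /eqP u0; apply: sumv_dim_independent uU u0.
  by rewrite CWsp_sum dim_CWsp sum_dim_UP.
have := @graded_vtr _ _ parab UP 0%VS indep (convr (gdelta g)) (fun P => (P :^ g)%g).
rewrite add0v CWsp_sum !vtr0 subr0 => trE.
transitivity (vtr CWsp (convr (gdelta g))).
  rewrite (@vtr_ftr _ _ _ (cres W)); first last.
  - by move=> v vW; apply: cres_id => w wW; apply: CWspP.
  - exact: cres_CWsp.
  - move=> v vW; apply: memCWsp => w wW; rewrite /convr conv_gdeltar (CWspP vW) //.
    by rewrite groupMr ?groupV.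
  rewrite cfRegE /ftr (bigID (mem W)) /= [X in _ = _ + X]big1 ?addr0 => [|w wW].
    rewrite (eq_bigr (fun _ => (g == 1%g)%:R)) ?sumr_const => [|w wW].
      by case: (g == 1%g) => /=; rewrite ?mulr1n ?mulr0n ?mul0rn.
    rewrite cres_fdelta wW scale1r /convr conv_gdelta ffunE.
    by rewrite -{1}[w]mulg1 (inj_eq (mulgI w)) eq_sym.
  by rewrite cres_fdelta (negPf wW) scale0r linear0 ffunE.
rewrite trE.
- by apply: eq_bigr => P _; rewrite subr0 addv0.
- by move=> v; rewrite memv0 => /eqP->; rewrite linear0 mem0v.
- by move=> P v PP vP; rewrite addv0; apply: UP_mul.
- by move=> P; apply: parab_conj.
Qed.

Lemma chiU_conj P g x : P \in parab -> g \in W -> x \in W -> (P :^ g)%g = P ->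
  chiU (P :^ x)%g (g ^ x)%g = chiU P g.
Proof.
move=> PP gW xW Pg; apply: (@vtr_conj _ _ _ _ _ (convr (gdelta x)) (convr (gdelta x^-1%g))).
- by move=> v vP; rewrite -Pg; apply: UP_mul.
- by move=> v; apply: UP_mul.
- move=> v vP; rewrite -{1}(conjsgK x P); apply: UP_mul; rewrite ?groupV //.
  exact: parab_conj.
- by move=> v _; rewrite /= /convr conv_gdeltaA mulgV conv1r.
- by move=> v _; rewrite /= /convr conv_gdeltaA mulVg conv1r.
- by move=> v _; rewrite /= /convr !conv_gdeltaA conjgE mulgA.
Qed.

End RegularCharacter.

(** * The Orlik-Solomon algebra *)

Section OrlikSolomonAlgebra.

Implicit Types (L P A B D : {set gT}) (s t w x g : gT).

Local Notation T := (reflT W S).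
Local Notation Xi := (Xint rG).
Local Notation dep := (dependent rG).
Local Notation OSI := (OSideal W S rG).
Local Notation codim := (@Defs.codim #|S|).

Lemma reflTP t : reflect (exists2 s, s \in S & exists2 w, w \in W & t = (s ^ w)%g) (t \in T).
Proof.
apply: (iffP bigcupP) => [[w wW /imsetP[s sS ->]]|[s sS [w wW ->]]].
  by exists s => //; exists w.
by exists w => //; rewrite memJ_conjg.
Qed.

Lemma reflT_sub : T \subset W.
Proof. by apply/subsetP=> _ /reflTP[s sS [w wW ->]]; rewrite groupJ ?(subS_mem sS). Qed.

Lemma reflT_conj g : g \in W -> (T :^ g)%g = T.
Proof.
move=> gW; apply/eqP; rewrite eqEcard cardJg leqnn andbT.
apply/subsetP=> _ /imsetP[_ /reflTP[s sS [w wW ->]] ->].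
by apply/reflTP; exists s => //; exists (w * g)%g; rewrite ?groupM // conjgM.
Qed.

Lemma powT_conj g A : g \in W -> ((A :^ g)%g \in powerset T) = (A \in powerset T).
Proof. by move=> gW; rewrite !powersetE -{1}(reflT_conj gW) conjSg. Qed.

Lemma Xint_conj A g : A \subset W -> g \in W -> (Xi (A :^ g)%g :=: Xi A *m rG g)%MS.
Proof. exact: FixL_conj. Qed.

Lemma codim_eqmx (U V : 'M[algC]_#|S|) : (U :=: V)%MS -> codim U = codim V.
Proof. by move=> UV; rewrite /Defs.codim UV. Qed.

Lemma codim_rG (U : 'M[algC]_#|S|) g : g \in W -> codim (U *m rG g) = codim U.
Proof. by move=> gW; rewrite /Defs.codim mxrankMfree // row_free_unit rG_unit. Qed.

Lemma dependent_conj A g : A \subset W -> g \in W -> dep (A :^ g)%g = dep A.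
Proof.
move=> sA gW; rewrite /dependent cardJg (codim_eqmx (Xint_conj sA gW)).
by rewrite codim_rG.
Qed.

Lemma codim_refl t : t \in T -> (codim (Fixw rG t) <= 1)%N.
Proof.
case/reflTP=> s sS [w wW ->]; have sW := subS_mem sS.
rewrite (codim_eqmx (Fixw_conj sW wW)) codim_rG // /Defs.codim mxrank_ker subKn ?rank_leq_row //.
have [i ->] := idxP sS; rewrite hrG /refl_mx addrC addKr -scaleN1r scalerA.
apply: leq_trans (mxrank_scale _ _) _; apply: leq_trans (mxrankM_maxr _ _) _.
exact: rank_leq_row.
Qed.

Lemma codim_cap (U V : 'M[algC]_#|S|) : (codim (U :&: V)%MS <= codim U + codim V)%N.
Proof.
have := mxrank_sum_cap U V; have le_s := rank_leq_row (U + V)%MS.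
have le_U := rank_leq_row U; have le_V := rank_leq_row V; rewrite /Defs.codim => e.
by rewrite leq_subLR addnA; move: e le_s le_U le_V; lia.
Qed.

Lemma XintU A B : (Xi (A :|: B) :=: Xi A :&: Xi B)%MS.
Proof.
apply/eqmxP/andP; split.
  by rewrite sub_capmx; apply/andP; split; apply/sub_bigcapmxP=> t tA;
     apply: bigcapmx_inf (submx_refl _); rewrite inE tA ?orbT.
apply/sub_bigcapmxP=> t /setUP[] tA.
  by apply: submx_trans (capmxSl _ _) _; apply: bigcapmx_inf (submx_refl _).
by apply: submx_trans (capmxSr _ _) _; apply: bigcapmx_inf (submx_refl _).
Qed.

Lemma codim_card A : A \subset T -> (codim (Xi A) <= #|A|)%N.
Proof.
elim/(@subset_ind gT): A => A IH sAT; have [->|[t tA]] := set_0Vmem A.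
  by rewrite /Xint big_set0 /Defs.codim mxrank1 subnn.
rewrite -(setD1K tA) (codim_eqmx (XintU _ _)); apply: leq_trans (codim_cap _ _) _.
rewrite cardsU1 !inE eqxx /= leq_add //; first by rewrite /Xint big_set1 codim_refl // (subsetP sAT).
apply: IH; [exact: subD1set| |by apply: subset_trans sAT; apply: subD1set].
by apply: contraTneq tA => <-; rewrite !inE eqxx.
Qed.

Lemma indep_sub A B : A :|: B \subset T -> [disjoint A & B] -> ~~ dep (A :|: B) -> ~~ dep B.
Proof.
rewrite subUset /dependent -!leqNgt => /andP[sA sB] dAB.
have -> : #|A :|: B| = (#|A| + #|B|)%N.
  by apply/eqP; rewrite (leq_card_setU A B).2.
move=> le_AB; rewrite -(leq_add2l #|A|) (leq_trans le_AB) // (codim_eqmx (XintU _ _)).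
by apply: leq_trans (codim_cap _ _) _; rewrite leq_add2r codim_card.
Qed.

(** One space contains the other, and the codimensions are squeezed: that of [Xi D] is at most |D| -
    1, that of [Xi (D :\ t)] at least |D| - 1. *)
Lemma Xint_circuit D t : D \subset T -> t \in D -> dep D -> ~~ dep (D :\ t) ->
  (Xi (D :\ t) :=: Xi D)%MS.
Proof.
move=> sDT tD; rewrite /dependent -leqNgt (cardsD1 t D) tD add1n ltnS => le1 le2.
have sub : (Xi D <= Xi (D :\ t))%MS.
  apply/sub_bigcapmxP=> u; rewrite !inE => /andP[_ uD].
  exact: bigcapmx_inf (submx_refl _).
apply/eqmx_sym/eqmxP; rewrite -(mxrank_leqif_eq sub).2 eqn_leq mxrankS //=.
have : (codim (Xi D) <= codim (Xi (D :\ t)))%N by apply: leq_trans le1 le2.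
have leD := rank_leq_row (Xi D); have leDt := rank_leq_row (Xi (D :\ t)).
by rewrite /Defs.codim => le_c; rewrite -(subKn leD) -(subKn leDt) leq_sub2l.
Qed.

(** Multiply the relation of [B] by a_t for some [t] in [B]: the terms still containing [t] vanish,
    and the remaining one is the monomial of [B] up to sign. *)
Lemma dep_OSI B : B \subset T -> dep B -> eb B \in OSI.
Proof.
move=> sBT depB; have [B0|[t tB]] := set_0Vmem B.
  by move: depB; rewrite B0 /dependent cards0 ltn0.
have : mulE (eb [set t]) (osrel B) \in OSI.
  apply/memv_span/allpairsP; exists ([set t], B); split=> //=.
    by rewrite mem_enum powersetE sub1set (subsetP sBT).
  by rewrite mem_enum in_set powersetE sBT.
rewrite mulE_osrel (bigD1 t) //= big1 ?addr0 => [|u /andP[uB ut]].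
  rewrite /emul; have -> : [disjoint [set t] & B :\ t] by rewrite disjoints1 !inE eqxx.
  by rewrite scalerA mulNr wsignM scaleN1r memvN setD1K.
rewrite /emul; case: ifP => [|_]; last by rewrite scaler0.
by rewrite disjoints1 !inE eq_sym ut tB.
Qed.

Lemma OSI_act g (v : Ext gT) : g \in W -> v \in OSI -> actE g v \in OSI.
Proof.
move=> gW vI; have : linfun (actE g) v \in (linfun (actE g) @: OSI)%VS by apply: memv_img.
rewrite lfunE /= limg_span; apply/subvP/span_subvP=> _ /mapP[_ /allpairsP[[A D] /= [AT DT ->]] ->].
rewrite lfunE /= actE_mulE_osrel memvZ //; apply/memv_span/allpairsP.
exists ((A :^ g)%g, (D :^ g)%g); split=> //=; first by move: AT; rewrite !mem_enum powT_conj.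
move: DT; rewrite !mem_enum in_set => /andP[DT depD]; rewrite in_set powT_conj // DT dependent_conj //.
by apply: subset_trans reflT_sub; rewrite -powersetE.
Qed.

(** The condition on the cardinality expresses independence, see [flatT_indep]. *)
Definition flatT P : {set {set gT}} :=
  [set A in powerset T | (#|A| == codim (FixL rG P)) && (Xi A == FixL rG P)%MS].

Definition EXP P : {vspace Ext gT} := span [seq eb A | A <- enum (flatT P)].

Definition Eproj P (v : Ext gT) : Ext gT := [ffun A => if A \in flatT P then v A else 0].

Fact Eproj_is_linear P : linear (Eproj P).
Proof.
by move=> k u v; apply/ffunP=> A; rewrite !ffunE; case: ifP => _; rewrite ?ffunE // scaler0 addr0.
Qed.

HB.instance Definition _ P :=
  GRing.isLinear.Build algC (Ext gT) (Ext gT) *:%R (Eproj P) (Eproj_is_linear P).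

Lemma Eproj_eb P A : Eproj P (eb A) = (A \in flatT P)%:R *: eb A.
Proof.
apply/ffunP=> B; rewrite !ffunE; case: eqP => [->|_]; last by rewrite scaler0 if_same.
by case: ifP; rewrite /GRing.scale /= ?mul1r ?mul0r.
Qed.

Lemma EXP_sum P (v : Ext gT) : v \in EXP P -> v = \sum_(A in flatT P) (v A : algC) *: eb A.
Proof.
move=> vE; have : Eproj P v = v.
  have /coord_span -> := vE; rewrite (linear_sum (Eproj P)); apply: eq_bigr => i _.
  rewrite (linearZ_LR (Eproj P)); congr (_ *: _).
  have : [seq eb A | A <- enum (flatT P)]`_i \in [seq eb A | A <- enum (flatT P)].
    by rewrite mem_nth // size_map -cardE.
  by case/mapP=> A; rewrite mem_enum => AF ->; rewrite /= Eproj_eb AF scale1r.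
move=> <-; rewrite {1}[Eproj P v]eb_sum [RHS]big_mkcond; apply: eq_bigr => A _.
by rewrite !ffunE; case: ifP => // _; rewrite scale0r.
Qed.

Lemma Eproj_id P (v : Ext gT) : v \in EXP P -> Eproj P v = v.
Proof.
move=> /EXP_sum->; rewrite (linear_sum (Eproj P)); apply: eq_bigr => A AF.
by rewrite (linearZ_LR (Eproj P)) /= Eproj_eb AF scale1r.
Qed.

Lemma FixL_parab_inj P Q : P \in parab -> Q \in parab ->
  (FixL rG P :=: FixL rG Q)%MS -> P = Q.
Proof.
move=> /parabP[L [x [sLS xW ->]]] /parabP[M [y [sMS yW ->]]].
exact: FixL_parabolic_inj.
Qed.

Lemma Eproj_other P Q (v : Ext gT) : P \in parab -> Q \in parab -> P != Q ->
  v \in EXP Q -> Eproj P v = 0.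
Proof.
move=> PP QP PQ /EXP_sum->; rewrite (linear_sum (Eproj P)) big1 // => A.
rewrite in_set => /and3P[_ _ /eqmxP AQ]; rewrite (linearZ_LR (Eproj P)) /= Eproj_eb.
case: (boolP (A \in _)) => [|_]; last by rewrite scale0r scaler0.
rewrite in_set => /and3P[_ _ /eqmxP AP]; case/eqP: PQ; apply: FixL_parab_inj => //.
exact: eqmx_trans (eqmx_sym AP) AQ.
Qed.

Lemma flatT_indep P A : A \in powerset T ->
  (A \in flatT P) = ~~ dep A && (Xi A == FixL rG P)%MS.
Proof.
rewrite powersetE => sAT; rewrite in_set powersetE sAT /=.
have [/eqmxP e|_] := boolP (Xi A == FixL rG P)%MS; last by rewrite !andbF.
by rewrite !andbT /dependent -leqNgt (codim_eqmx e) eqn_leq -{2}(codim_eqmx e) codim_card // andbT.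
Qed.

(* Dependent monomials lie in the ideal, and the independent terms of a
   generator all belong to the same flat. *)
Lemma Eproj_OSI P (v : Ext gT) : v \in OSI -> Eproj P v \in OSI.
Proof.
move=> vI; have : linfun (Eproj P) v \in (linfun (Eproj P) @: OSI)%VS by apply: memv_img.
rewrite lfunE /= limg_span; apply/subvP/span_subvP=> _ /mapP[_ /allpairsP[[A D] /= [AT DT ->]] ->].
rewrite lfunE /=.
have gI : mulE (eb A) (osrel D) \in OSI by apply/memv_span/allpairsP; exists (A, D).
move: AT DT; rewrite !mem_enum powersetE in_set powersetE => sAT /andP[sDT depD].
have subU t : A :|: (D :\ t) \subset T.
  by rewrite subUset sAT (subset_trans _ sDT) // subD1set.
have same t : t \in D -> [disjoint A & D :\ t] -> ~~ dep (A :|: (D :\ t)) ->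
    (Xi (A :|: (D :\ t)) :=: Xi A :&: Xi D)%MS.
  move=> tD dAD ind; apply: eqmx_trans (XintU _ _) _; apply: cap_eqmx; first exact: eqmx_refl.
  by apply: Xint_circuit => //; apply: (indep_sub (subU t)) ind.
have [/eqmxP eX|neX] := boolP (Xi A :&: Xi D == FixL rG P)%MS.
  suff : mulE (eb A) (osrel D) - Eproj P (mulE (eb A) (osrel D)) \in OSI.
    by move/(memvB gI); rewrite subKr.
  rewrite mulE_osrel (linear_sum (Eproj P)) -sumrB memv_suml // => t tD.
  rewrite (linearZ_LR (Eproj P)) -scalerBr memvZ //=.
  rewrite {1 2}/emul; case: ifP => [dAD|_]; last by rewrite linear0 subr0 mem0v.
  rewrite (linearZ_LR (Eproj P)) -scalerBr memvZ //= Eproj_eb.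
  have [dt|ind] := boolP (dep (A :|: (D :\ t))).
    by rewrite memvB ?memvZ ?dep_OSI.
  rewrite flatT_indep ?powersetE // ind /=.
  have -> : (Xi (A :|: D :\ t) == FixL rG P)%MS.
    by apply/eqmxP; apply: eqmx_trans (same t tD dAD ind) eX.
  by rewrite scale1r subrr mem0v.
suff -> : Eproj P (mulE (eb A) (osrel D)) = 0 by rewrite mem0v.
rewrite mulE_osrel (linear_sum (Eproj P)) big1 // => t tD.
rewrite (linearZ_LR (Eproj P)) /emul; case: ifP => [dAD|_]; last first.
  by rewrite (linear0 (Eproj P)); apply: scaler0.
rewrite (linearZ_LR (Eproj P)) /= Eproj_eb flatT_indep ?powersetE //.
have [dt|ind] := boolP (dep (A :|: (D :\ t))); first by rewrite scale0r !scaler0.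
suff /negPf-> : ~~ (Xi (A :|: D :\ t) == FixL rG P)%MS by rewrite scale0r !scaler0.
apply: contra neX => /eqmxP e; apply/eqmxP.
exact: eqmx_trans (eqmx_sym (same t tD dAD ind)) e.
Qed.

Lemma EXP_act P g (v : Ext gT) : P \in parab -> g \in W -> v \in EXP P ->
  actE g v \in EXP (P :^ g)%g.
Proof.
move=> PP gW /EXP_sum->; rewrite (linear_sum (actE g)) memv_suml // => A.
rewrite in_set powersetE => /and3P[sAT cA /eqmxP XA].
rewrite (linearZ_LR (actE g)) memvZ //= actE_eb memvZ //; apply/memv_span/map_f.
have sPW : P \subset W.
  have /parabP[L [x [sLS xW ->]]] := PP; rewrite -(conjGid xW) conjSg.
  by apply/subsetP=> ?; apply: mem_genS.
have sAW := subset_trans sAT reflT_sub.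
have eX : (Xi (A :^ g)%g :=: FixL rG (P :^ g)%g)%MS.
  apply: eqmx_trans (Xint_conj sAW gW) _; apply: eqmx_trans (eqmxMr _ XA) _.
  exact/eqmx_sym/FixL_conj.
rewrite mem_enum in_set powT_conj // powersetE sAT cardJg /= (eqP cA).
apply/andP; split; last exact/eqmxP.
by rewrite (codim_eqmx (FixL_conj sPW gW)) codim_rG.
Qed.

(** [EXP P] may meet the ideal, so a complement is taken inside it. An independent set belongs to
    the flat of its own intersection, which is that of a parabolic by [FixL_flat]. *)
Lemma ExtT_sum : (OSI + \sum_(P in parab) (EXP P :\: OSI))%VS = ExtT W S.
Proof.
apply/eqP; rewrite eqEsubv; apply/andP; split.
  rewrite subv_add; apply/andP; split.
    apply/span_subvP=> _ /allpairsP[[A D] /= [AT DT ->]].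
    move: AT DT; rewrite !mem_enum powersetE in_set powersetE => sAT /andP[sDT depD].
    rewrite mulE_osrel memv_suml // => t tD; rewrite memvZ // /emul.
    case: ifP => _; rewrite ?mem0v // memvZ //; apply/memv_span/map_f.
    by rewrite mem_enum powersetE subUset sAT (subset_trans _ sDT) // subD1set.
  apply/subv_sumP=> P _; apply: subv_trans (diffvSl _ _) _; apply/span_subvP=> v /mapP[A].
  rewrite mem_enum in_set => /andP[AT _] ->; apply/memv_span/map_f.
  by rewrite mem_enum.
apply/span_subvP=> v /mapP[A]; rewrite mem_enum powersetE => sAT ->.
have [dA|ind] := boolP (dep A); first by apply: (subvP (addvSl _ _)); apply: dep_OSI.
have [L [x [sLS xW eX]]] := FixL_flat (subset_trans sAT reflT_sub).
have PP : (<<L>> :^ x)%g \in parab by apply/parabP; exists L, x.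
have : eb A \in (EXP (<<L>> :^ x)%g + OSI)%VS.
  apply: (subvP (addvSl _ _)); apply/memv_span/map_f; rewrite mem_enum flatT_indep ?powersetE //.
  by rewrite ind; apply/eqmxP.
rewrite -addv_diff; apply: subvP; rewrite addvC subv_add addvSl /=.
by apply: subv_trans (addvSr _ _); apply: (sumv_sup _ PP).
Qed.

Definition chiE P g : algC := vtr (EXP P + OSI)%VS (actE g) - vtr OSI (actE g).

(** For independence modulo the ideal, [Eproj P] isolates the component at [P] without leaving the
    ideal; that component then lies both in the ideal and in a complement of it. *)
Lemma omegaW_chiE g : g \in W ->
  omegaW W S rG g = \sum_(P in parab | (P :^ g)%g == P) chiE P g.
Proof.
move=> gW; pose C P := (EXP P :\: OSI)%VS.
have CE P : (C P + OSI = EXP P + OSI)%VS by apply: addv_diff.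
have indep (u : {set gT} -> Ext gT) :
    (forall P, P \in parab -> u P \in C P) -> \sum_(P in parab) u P \in OSI ->
    forall P, P \in parab -> u P = 0.
  move=> uC uI P PP; have uE Q : Q \in parab -> u Q \in EXP Q.
    by move=> QP; apply: (subvP (diffvSl _ _)); apply: uC.
  have := Eproj_OSI P uI; rewrite (linear_sum (Eproj P)) (bigD1 P) //= Eproj_id ?uE //.
  rewrite big1 ?addr0 => [uPI|Q /andP[QP QneP]]; last first.
    by rewrite (Eproj_other PP QP) ?uE // eq_sym.
  have : u P \in (C P :&: OSI)%VS by rewrite memv_cap uC.
  by rewrite capv_diff memv0 => /eqP.
rewrite /omegaW -ExtT_sum (graded_vtr indep (f := actE g) (sg := fun P => (P :^ g)%g)).
- by apply: eq_bigr => P _; rewrite CE.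
- by move=> v; apply: OSI_act.
- move=> P v PP vC; rewrite CE; apply: (subvP (addvSl _ _)); apply: EXP_act => //.
  exact: (subvP (diffvSl _ _)) vC.
- by move=> P; apply: parab_conj.
Qed.

Lemma PsiL_chiE L g : L \subset S -> PsiL W S rG L g = chiE <<L>>%g g.
Proof.
move=> sLS; have sLW := subset_trans sLS (sSW).
have e := FixL_gen sLW.
suff fE : [set A in powerset T | (#|A| == codim (FixL rG L)) && (Xi A == FixL rG L)%MS]
    = flatT <<L>>%g by rewrite /PsiL fE.
apply/setP=> A; rewrite in_set [in RHS]in_set -(codim_eqmx e).
congr (_ && (_ && _)); apply/eqmxP/eqmxP => eA; first exact: eqmx_trans eA (eqmx_sym e).
exact: eqmx_trans eA e.
Qed.

Lemma chiE_conj P g x : P \in parab -> g \in W -> x \in W -> (P :^ g)%g = P ->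
  chiE (P :^ x)%g (g ^ x)%g = chiE P g.
Proof.
move=> PP gW xW Pg; have actK v : actE x^-1%g (actE x v) = v.
  by rewrite -actE_mul mulgV actE1.
have actKV v : actE x (actE x^-1%g v) = v by rewrite -actE_mul mulVg actE1.
have sumI Q y (v : Ext gT) : Q \in parab -> y \in W -> v \in (EXP Q + OSI)%VS ->
    actE y v \in (EXP (Q :^ y)%g + OSI)%VS.
  move=> QP yW /memv_addP[u uE [u' u'I ->]]; rewrite linearD memv_add //.
    exact: EXP_act.
  exact: OSI_act.
have conjE v : actE (g ^ x)%g v = actE x (actE g (actE x^-1%g v)).
  by rewrite -!actE_mul conjgE.
congr (_ - _); apply: (@vtr_conj _ _ _ _ _ (actE x) (actE x^-1%g)) => //=.
- by move=> v vP; rewrite -Pg; apply: sumI.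
- by move=> v vP; apply: sumI.
- move=> v vP; rewrite -(conjsgK x P); apply: sumI; rewrite ?groupV //.
  exact: parab_conj.
- by move=> v; apply: OSI_act.
- by move=> v; apply: OSI_act.
- by move=> v; apply: OSI_act; rewrite groupV.
Qed.

End OrlikSolomonAlgebra.

(** * Transfer to the conjugacy classes of [W] *)

Section ParabolicClasses.

Implicit Types (L M P : {set gT}) (w x y z g : gT).

(** A chosen subset of [S] for each class of parabolic subgroups; the default of [odflt] is not
    reached on [parab]. *)
Definition parab_type P : {set gT} :=
  odflt set0 [pick L : {set gT} | (L \subset S) && [exists x in W, P == (<<L>> :^ x)%g]].

Definition parab_reps : {set {set gT}} := [set L in powerset S | parab_type <<L>>%g == L].

Lemma parab_type_conj P x : x \in W -> parab_type (P :^ x)%g = parab_type P.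
Proof.
move=> xW; congr odflt; apply: eq_pick => L; congr (_ && _).
apply/exists_inP/exists_inP=> -[y yW /eqP e].
  by exists (y * x^-1)%g; rewrite ?groupM ?groupV // conjsgM -e conjsgK.
by exists (y * x)%g; rewrite ?groupM // e conjsgM.
Qed.

Lemma parab_typeP P : P \in parab ->
  [/\ parab_type P \in parab_reps, parab_type P \subset S &
      exists2 x, x \in W & P = (<<parab_type P>> :^ x)%g].
Proof.
move=> PP; have [sLS [x xW PE]] : parab_type P \subset S /\
    exists2 x, x \in W & P = (<<parab_type P>> :^ x)%g.
  rewrite /parab_type; case: pickP => [L /andP[sLS /exists_inP[x xW /eqP e]]|no] /=.
    by split=> //; exists x.
  case/parabP: PP => L [x [sLS xW e]]; have /negbT/negP[] := no L.
  by rewrite sLS; apply/exists_inP; exists x => //; apply/eqP.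
split=> //; last by exists x.
by rewrite in_set powersetE sLS -(parab_type_conj _ xW) -PE /=.
Qed.

(** In the induction formula, the [y] for which W_L conjugated by y^-1 is a given [P] form a coset
    of the normalizer [N]. So each [P] fixed by [g] is met |N| times, always with the value
    [chi P g]. *)
Lemma sum_parab_Ind (chi : {set gT} -> gT -> algC) (theta : forall L, 'CF('N_W(<<L>>)%G)) g :
    (forall P h x, P \in parab -> h \in W -> x \in W -> (P :^ h)%g = P ->
      chi (P :^ x)%g (h ^ x)%g = chi P h) ->
    (forall L h, L \in parab_reps -> h \in 'N_W(<<L>>)%g -> chi <<L>>%g h = theta L h) ->
    g \in W ->
  \sum_(P in parab | (P :^ g)%g == P) chi P g = \sum_(L in parab_reps) 'Ind[W] (theta L) g.
Proof.
move=> chiJ chiE gW.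
rewrite (partition_big parab_type (mem parab_reps)) => [|P /andP[/parab_typeP[]] //].
apply: eq_bigr => L /= Lrep; have := Lrep; rewrite in_set powersetE => /andP[sLS /eqP LE].
set N := 'N_W(<<L>>)%G; have sNW : N \subset W by apply: subsetIl.
have Lpar y : y \in W -> (<<L>> :^ y)%g \in parab by move=> yW; apply/parab_conj/parab_gen.
rewrite cfIndE //; apply: canRL (mulKf _) _; first by rewrite neq0CG.
transitivity (\sum_(y in W | ((<<L>> :^ y^-1) :^ g == <<L>> :^ y^-1)%g) chi (<<L>> :^ y^-1)%g g).
  rewrite (partition_big (fun y => (<<L>> :^ y^-1)%g)
    (fun P => (P \in parab) && ((P :^ g)%g == P) && (parab_type P == L))) /=.
    rewrite mulr_sumr; apply: eq_bigr => P /andP[/andP[PP /eqP Pg] /eqP PL].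
    have [_ _ [x xW PE]] := parab_typeP PP; rewrite PL in PE.
    rewrite (eq_bigr (fun _ => chi P g)) => [|y /andP[_ /eqP-> //]].
    rewrite (eq_bigl (mem (x^-1 *: N)%g)) => [|y].
      by rewrite sumr_const card_lcoset mulr_natl.
    rewrite /= mem_lcoset invgK [in RHS]inE.
    have -> : (y \in W) = (x * y \in W)%g by rewrite groupMl.
    case: (boolP (x * y \in W)%g) => //= xyW.
    have -> : (x * y \in 'N(<<L>>))%g = ((<<L>> :^ y^-1)%g == P).
      apply/normP/eqP=> [e|e]; first by rewrite PE -{1}e conjsgM conjsgK.
      by rewrite conjsgM -PE -e conjsgKV.
    by have [->|ne] := eqVneq (<<L>> :^ y^-1)%g P; rewrite ?Pg ?eqxx ?andbF.
  move=> y /andP[yW ->]; rewrite Lpar ?groupV //= parab_type_conj ?groupV //.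
  exact/eqP.
rewrite big_mkcondr; apply: eq_bigr => y yW.
have e : ((<<L>> :^ y^-1) :^ g == <<L>> :^ y^-1)%g = (g ^ y \in N)%g.
  rewrite inE groupJ //=; apply/eqP/normP=> e.
    by rewrite conjgE !conjsgM e conjsgKV.
  by rewrite -[in RHS]e -!conjsgM conjgE -!mulgA mulgV mulg1.
case: (boolP ((<<L>> :^ y^-1) :^ g == <<L>> :^ y^-1)%g) => [Lyg|Lyg]; last first.
  by rewrite cfun0 // -e.
rewrite -chiE -?e // -(chiJ _ _ y) ?Lpar ?groupV ?conjsgKV //.
exact/eqP.
Qed.

Lemma cuspidal_conj L M w z : L \subset S -> M \subset S -> z \in W ->
  (<<L>> :^ z)%g = <<M>>%g -> cuspidal rG (coxB S) L w -> cuspidal rG (coxB S) M (w ^ z)%g.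
Proof.
move=> sLS sMS zW LzM cusp; have wL : w \in <<L>>%g by case/andP: cusp.
have wM : (w ^ z)%g \in <<M>>%g by rewrite -LzM memJ_conjg.
have wW := mem_genS sLS wL.
have sLW := subset_trans sLS sSW; have sMW := subset_trans sMS sSW.
apply/(cuspidalP sMS wM); apply: eqmx_trans (Fixw_conj wW zW) _.
apply: eqmx_trans (eqmxMr _ (cuspidalP sLS wL cusp)) _.
apply: eqmx_trans (eqmxMr _ (eqmx_sym (FixL_gen sLW))) _.
have sgLW : <<L>>%g \subset W by apply/subsetP=> ?; apply: mem_genS.
apply: eqmx_trans (eqmx_sym (FixL_conj sgLW zW)) _; rewrite LzM.
exact: FixL_gen.
Qed.

Lemma cuspidal_rep w : w \in W ->
  exists L x, [/\ L \in parab_reps, x \in W & cuspidal rG (coxB S) L (w ^ x)%g].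
Proof.
move=> wW; have [M [y [sMS yW cusp]]] := cuspidal_exists wW.
have [Lrep sLS [z zW ME]] := parab_typeP (parab_gen sMS).
exists (parab_type <<M>>%g), (y * z^-1)%g; rewrite groupM ?groupV // conjgM; split=> //.
apply: (cuspidal_conj sMS sLS) cusp; rewrite ?groupV //.
by rewrite {1}ME conjsgK.
Qed.

End ParabolicClasses.

(** * From cuspidal pairs to the classes of W *)

Section CharacterTransfer.

Implicit Types (L : {set gT}) (w x g r : gT).

Lemma card1_uniq (T : finType) (A : {set T}) (a b : T) :
  #|A| = 1%N -> a \in A -> b \in A -> a = b.
Proof. by move/eqP/cards1P=> [c ->]; rewrite !inE => /eqP-> /eqP->. Qed.

Section Refinement.

Variables (R_ : {set gT} -> {set gT}) (phi : {set gT} -> forall w, 'CF('C_W[w]%G)).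

Let cusp_transversal L :=
  class_transversal <<L>>%g [set w in <<L>>%g | cuspidal rG (coxB S) L w] (R_ L).

Hypothesis transv : forall L, L \in parab_reps -> cusp_transversal L.

Definition cusp_pairs : {set {set gT} * gT} :=
  [set q | (q.1 \in parab_reps) && (q.2 \in R_ q.1)].

Let repS L : L \in parab_reps -> L \subset S.
Proof. by rewrite in_set powersetE => /andP[]. Qed.

Let R_cusp L w : L \in parab_reps -> w \in R_ L -> cuspidal rG (coxB S) L w.
Proof.
move=> Lrep wR; have [sR _] := transv Lrep.
by have := subsetP sR w wR; rewrite inE => /andP[].
Qed.

Let R_W L w : L \in parab_reps -> w \in R_ L -> w \in W.
Proof. by move=> Lrep wR; have /andP[wL _] := R_cusp Lrep wR; apply: mem_genS wL; apply: repS. Qed.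

Lemma sum_cusp_pairs (T : nmodType) (F : {set gT} -> gT -> T) :
  \sum_(L in parab_reps) \sum_(w in R_ L) F L w = \sum_(q in cusp_pairs) F q.1 q.2.
Proof. by rewrite pair_big_dep; apply: eq_bigl => -[L w]; rewrite [RHS]in_set. Qed.

(** Induction in stages through N_W(W_L), which contains C_W(w) by cuspidality. *)
Lemma Ind_cusp_pairs (chi : {set gT} -> gT -> algC) (f : {set gT} -> forall w, 'CF('C_W[w]%G)) g :
    (forall P h x, P \in parab -> h \in W -> x \in W -> (P :^ h)%g = P ->
      chi (P :^ x)%g (h ^ x)%g = chi P h) ->
    (forall L h, L \in parab_reps -> h \in 'N_W(<<L>>)%g ->
      chi <<L>>%g h = (\sum_(w in R_ L) 'Ind['N_W(<<L>>)%G] (f L w)) h) ->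
    g \in W ->
  \sum_(P in parab | (P :^ g)%g == P) chi P g = (\sum_(q in cusp_pairs) 'Ind[W] (f q.1 q.2)) g.
Proof.
move=> chiJ chiE gW.
rewrite (sum_parab_Ind (theta := fun L => \sum_(w in R_ L) 'Ind['N_W(<<L>>)%G] (f L w)) chiJ chiE gW).
rewrite -(sum_cusp_pairs (fun L w => 'Ind[W] (f L w))) sum_cfunE; apply: eq_bigr => L Lrep.
congr (fun_of_cfun _ g); rewrite linear_sum; apply: eq_bigr => w wR /=.
by rewrite cfIndInd ?subsetIl // cuspidal_cent_norm ?repS ?R_cusp.
Qed.

(* Every element of W is conjugate to some q.2, and the degree of the regular
   character leaves no room for a second one. *)
Lemma card_cusp_pairs : (forall L w, L \in parab_reps -> w \in R_ L -> phi L w \is a linear_char) ->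
    cfReg W = \sum_(q in cusp_pairs) 'Ind[W] (phi q.1 q.2) ->
  forall x, x \in W -> #|[set q in cusp_pairs | x \in (q.2 ^: W)%g]| = 1%N.
Proof.
move=> lin regE x xW.
have sumW : (\sum_(y in W) 1 = \sum_(y in W) #|[set q in cusp_pairs | y \in (q.2 ^: W)%g]|)%N.
  have -> : (\sum_(y in W) #|[set q in cusp_pairs | y \in (q.2 ^: W)%g]|
      = \sum_(q in cusp_pairs) #|(q.2 ^: W)%g|)%N.
    rewrite (eq_bigr (fun y => \sum_(q in cusp_pairs) (y \in (q.2 ^: W)%g))%N) => [|y _].
      rewrite exchange_big; apply: eq_bigr => q qQ; rewrite -sum1_card big_mkcond [RHS]big_mkcond.
      apply: eq_bigr => y _; have qW : q.2 \in W.
        by move: qQ; rewrite in_set => /andP[]; apply: R_W.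
      case: (boolP (y \in (q.2 ^: W)%g)) => [/imsetP[z zW ->]|_]; last by rewrite if_same.
      by rewrite groupJ.
    rewrite -sum1_card big_mkcond [RHS]big_mkcond; apply: eq_bigr => q _.
    by rewrite in_set; case: (q \in cusp_pairs); case: (y \in _).
  apply/eqP; rewrite sum1_card -(eqr_nat algC); apply/eqP.
  have := congr1 (fun f : 'CF(W) => f 1%g) regE; rewrite cfRegE eqxx mulr1n => ->.
  rewrite sum_cfunE natr_sum; apply: eq_bigr => q; rewrite in_set => /andP[Lrep qR].
  by rewrite cfInd1 ?subsetIl // lin_char1 ?lin // mulr1 index_cent1.
have ge1 y : y \in W -> (1 <= #|[set q in cusp_pairs | y \in (q.2 ^: W)%g]|)%N.
  move=> yW; have [L [z [Lrep zW cusp]]] := cuspidal_rep yW.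
  have zL : (y ^ z)%g \in <<L>>%g by case/andP: cusp.
  have [_ tr] := transv Lrep.
  have /tr /eqP/cards1P[r rE] : (y ^ z)%g \in [set w in <<L>>%g | cuspidal rG (coxB S) L w].
    by rewrite inE zL.
  have : r \in [set r] by rewrite inE.
  rewrite -rE in_set => /andP[rR /imsetP[h hL yzE]].
  apply/card_gt0P; exists (L, r); rewrite in_set in_set Lrep rR /=.
  have hW := mem_genS (repS Lrep) hL.
  by rewrite -[y](conjgK z) yzE -conjgM memJ_class // groupM ?groupV.
have lif y : y \in W -> (1 <= #|[set q in cusp_pairs | y \in (q.2 ^: W)%g]|
    ?= iff (1 == #|[set q in cusp_pairs | y \in (q.2 ^: W)%g]|))%N.
  by move=> yW; apply: leqif_eq; apply: ge1.
have := (leqif_sum lif).2; rewrite sumW eqxx => /esym/forall_inP/(_ x xW)/eqP.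
by move=> <-.
Qed.

End Refinement.

(** Cuspidality replaces alpha_L by alpha_w on C_W(w); alpha_w and the sign are both compatible with
    the conjugation that moves [w] to [r]. *)
Lemma conjugate_pair L w r (phi psi : 'CF('C_W[w]%G)) :
    L \subset S -> cuspidal rG (coxB S) L w -> (r \in w ^: W)%g ->
    phi \is a linear_char -> psi \is a linear_char ->
    {in ('C_W[w])%g, forall c, psi c = phi c * sgnW S c * alpha_L rG L c} ->
  exists f : 'CF('C_W[r]%G) * 'CF('C_W[r]%G),
    [/\ f.1 \is a linear_char /\ f.2 \is a linear_char,
        'Ind[W] f.1 = 'Ind[W] phi, 'Ind[W] f.2 = 'Ind[W] psi &
        {in ('C_W[r])%g, forall c, f.2 c = f.1 c * sgnW S c * alpha_w rG r c}].
Proof.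
move=> sLS cusp /imsetP[x xW ->] lphi lpsi psiE.
have wW : w \in W by case/andP: cusp => wL _; apply: mem_genS wL.
have Cx : ('C_W[w] :^ x)%g = 'C_W[w ^ x]%g by apply: cent1_conj.
have [f [f_lin fE f_Ind]] := @cfun_conj _ W 'C_W[w]%G 'C_W[w ^ x]%G x phi xW (subsetIl _ _) Cx.
have [h [h_lin hE h_Ind]] := @cfun_conj _ W 'C_W[w]%G 'C_W[w ^ x]%G x psi xW (subsetIl _ _) Cx.
exists (f, h); split=> /=; rewrite ?f_lin ?h_lin // => c cC.
have /imsetP[d dC ->] : c \in ('C_W[w] :^ x)%g by rewrite Cx.
have dW : d \in W by case/setIP: dC.
by rewrite fE hE psiE // sgnW_conj // alpha_w_conj // (alpha_L_w sLS cusp dC).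
Qed.

Theorem coxeter_characters
  (hyp : forall L, L \subset S ->
     exists RL : {set gT},
       class_transversal <<L>>%g [set w in <<L>>%g | cuspidal rG (coxB S) L w] RL /\
       exists phi psi : forall w : gT, 'CF('C_W[w]%G),
         [/\ forall w, w \in RL -> phi w \is a linear_char /\ psi w \is a linear_char,
             {in ('N_W(<<L>>))%g, forall g,
                PhiL W S L g = (\sum_(w in RL) 'Ind['N_W(<<L>>)%G] (phi w)) g},
             {in ('N_W(<<L>>))%g, forall g,
                PsiL W S rG L g = (\sum_(w in RL) 'Ind['N_W(<<L>>)%G] (psi w)) g}
           & forall w, w \in RL ->
               {in ('C_W[w])%g, forall c, psi w c = phi w c * sgnW S c * alpha_L rG L c}])
  (R : {set gT}) : class_transversal W W R ->
  exists phi psi : forall w : gT, 'CF('C_W[w]%G),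
    [/\ forall w, w \in R -> phi w \is a linear_char /\ psi w \is a linear_char,
        cfReg W = \sum_(w in R) 'Ind[W] (phi w),
        {in W, forall g, omegaW W S rG g = (\sum_(w in R) 'Ind[W] (psi w)) g}
      & forall w, w \in R ->
          {in ('C_W[w])%g, forall c, psi w c = phi w c * sgnW S c * alpha_w rG w c}].
Proof.
case=> sRW Rtr.
pose data := ({set gT} * ((forall w : gT, 'CF('C_W[w]%G)) * (forall w : gT, 'CF('C_W[w]%G))))%type.
pose good L (u : data) := let: (RL, (phi, psi)) := u in
  class_transversal <<L>>%g [set w in <<L>>%g | cuspidal rG (coxB S) L w] RL /\
  [/\ forall w, w \in RL -> phi w \is a linear_char /\ psi w \is a linear_char,
      {in ('N_W(<<L>>))%g, forall g,
         PhiL W S L g = (\sum_(w in RL) 'Ind['N_W(<<L>>)%G] (phi w)) g},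
      {in ('N_W(<<L>>))%g, forall g,
         PsiL W S rG L g = (\sum_(w in RL) 'Ind['N_W(<<L>>)%G] (psi w)) g}
    & forall w, w \in RL ->
        {in ('C_W[w])%g, forall c, psi w c = phi w c * sgnW S c * alpha_L rG L c}].
(* The data for all [L] are chosen at once; sets outside [S] receive a dummy value. *)
have [u uP] : exists u : {set gT} -> data, forall L, L \subset S -> good L (u L).
  apply: (@fin_all_exists _ (fun _ => data) (fun L v => L \subset S -> good L v)) => L.
  have [/hyp[RL [tr [phi [psi H]]]]|_] := boolP (L \subset S); first by exists (RL, (phi, psi)).
  by exists (set0, (fun _ => 0, fun _ => 0)).
pose R_ L := (u L).1; pose phi L := (u L).2.1; pose psi L := (u L).2.2.
have repS L : L \in parab_reps -> L \subset S by rewrite in_set powersetE => /andP[].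
have uP' L : L \in parab_reps -> good L (R_ L, (phi L, psi L)).
  by move/repS/uP; rewrite /R_ /phi /psi; case: (u L) => [? []].
have transv L : L \in parab_reps ->
  class_transversal <<L>>%g [set w in <<L>>%g | cuspidal rG (coxB S) L w] (R_ L).
  by case/uP'.
pose Q := cusp_pairs R_.
have regE : cfReg W = \sum_(q in Q) 'Ind[W] (phi q.1 q.2).
  apply/cfun_inP=> g gW; rewrite cfReg_chiU //; apply: (Ind_cusp_pairs transv) gW.
    exact: chiU_conj.
  by move=> L h Lrep hN; rewrite -PhiL_chiU ?repS //; have [_ [_ PhiE _ _]] := uP' L Lrep; apply: PhiE.
have omE g : g \in W -> omegaW W S rG g = (\sum_(q in Q) 'Ind[W] (psi q.1 q.2)) g.
  move=> gW; rewrite omegaW_chiE //; apply: (Ind_cusp_pairs transv) gW.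
    exact: chiE_conj.
  by move=> L h Lrep hN; rewrite -PsiL_chiE ?repS //; have [_ [_ _ PsiE _]] := uP' L Lrep; apply: PsiE.
have lin L w : L \in parab_reps -> w \in R_ L -> phi L w \is a linear_char /\ psi L w \is a linear_char.
  by move=> Lrep wR; have [_ [linL _ _ _]] := uP' L Lrep; apply: linL.
have card1 := card_cusp_pairs transv (fun L w Lrep wR => (lin L w Lrep wR).1) regE.
have cuspQ q : q \in Q ->
    [/\ q.1 \in parab_reps, q.2 \in R_ q.1, cuspidal rG (coxB S) q.1 q.2 & q.2 \in W].
  rewrite in_set => /andP[Lrep qR]; have [sR _] := transv _ Lrep.
  have := subsetP sR _ qR; rewrite inE => /andP[qL cusp]; split=> //.
  by apply: mem_genS qL; apply: repS.
pose spec r (v : ({set gT} * gT) * ('CF('C_W[r]%G) * 'CF('C_W[r]%G))) :=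
  [/\ v.1 \in Q, (r \in v.1.2 ^: W)%g, v.2.1 \is a linear_char /\ v.2.2 \is a linear_char,
      'Ind[W] v.2.1 = 'Ind[W] (phi v.1.1 v.1.2) /\ 'Ind[W] v.2.2 = 'Ind[W] (psi v.1.1 v.1.2) &
      {in ('C_W[r])%g, forall c, v.2.2 c = v.2.1 c * sgnW S c * alpha_w rG r c}].
have [v vP] : exists v : forall r, ({set gT} * gT) * ('CF('C_W[r]%G) * 'CF('C_W[r]%G)),
    forall r, r \in R -> spec r (v r).
  apply: (@fin_all_exists _ _ (fun r v => r \in R -> spec r v)) => r.
  have [rR|_] := boolP (r \in R); last by exists ((set0, 1%g), (0, 0)).
  have /eqP/cards1P[q qE] := card1 r (subsetP sRW _ rR).
  have : q \in [set q] by rewrite inE.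
  rewrite -qE in_set => /andP[qQ rq]; have [Lrep qR cusp qW] := cuspQ q qQ.
  have [lphi lpsi] := lin _ _ Lrep qR; have [_ [_ _ _ /(_ _ qR) psiE]] := uP' _ Lrep.
  have [f [flin fI hI fE]] := conjugate_pair (repS _ Lrep) cusp rq lphi lpsi psiE.
  by exists (q, f).
pose qof r := (v r).1.
have qQ r : r \in R -> qof r \in Q by case/vP.
have qr r : r \in R -> (r \in (qof r).2 ^: W)%g by case/vP.
(* Each class of [W] meets [R] once and contains [q.2] for exactly one [q] in [Q], so [qof] is a
   bijection from [R] onto [Q], along which both sums are reindexed. *)
have QE : Q = qof @: R.
  apply/setP=> q; apply/idP/imsetP=> [qQ'|[r rR ->]]; last exact: qQ.
  have [_ _ _ qW] := cuspQ q qQ'; have /eqP/cards1P[r rE] := Rtr _ qW.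
  have : r \in [set r] by rewrite inE.
  rewrite -rE in_set class_sym => /andP[rR rq]; exists r => //.
  by apply: (card1_uniq (card1 r (subsetP sRW _ rR))); rewrite in_set ?qQ' ?qQ ?qr.
have qinj : {in R &, injective qof}.
  move=> r r' rR rR' e; apply: (card1_uniq (Rtr r (subsetP sRW _ rR)));
    rewrite in_set ?rR ?class_refl //.
  by rewrite rR' /= (class_eqP (qr r' rR')) -e -(class_eqP (qr r rR)) class_refl.
exists (fun r => (v r).2.1), (fun r => (v r).2.2); split.
- by move=> r /vP[].
- rewrite regE QE big_imset //=; apply: eq_bigr => r /vP[_ _ _ [-> _] _] //.
- move=> g gW; rewrite omE // QE big_imset //=; congr (fun_of_cfun _ g).
  by apply: eq_bigr => r /vP[_ _ _ [_ ->] _].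
- by move=> r /vP[].
Qed.

End CharacterTransfer.

End CoxeterGroup.

Theorem theorem4p5 (gT : finGroupType) (W : {group gT}) (S : {set gT})
  (hcox : coxeter_system W S)
  (rG : mx_representation algC W #|S|)
  (hrG : forall i : 'I_#|S|, rG (enum_val i) = refl_mx i)
  (hyp : forall L : {set gT}, L \subset S ->
     exists RL : {set gT},
       class_transversal <<L>>%g [set w in <<L>>%g | cuspidal rG (coxB S) L w] RL /\
       exists phi psi : forall w : gT, 'CF('C_W[w]%G),
         [/\ forall w, w \in RL -> phi w \is a linear_char /\ psi w \is a linear_char,
             {in ('N_W(<<L>>))%g, forall g,
                PhiL W S L g = (\sum_(w in RL) 'Ind['N_W(<<L>>)%G] (phi w)) g},
             {in ('N_W(<<L>>))%g, forall g,
                PsiL W S rG L g = (\sum_(w in RL) 'Ind['N_W(<<L>>)%G] (psi w)) g}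
           & forall w, w \in RL ->
               {in ('C_W[w])%g, forall c, psi w c = phi w c * sgnW S c * alpha_L rG L c}]) :
  forall R : {set gT}, class_transversal W W R ->
  exists phi psi : forall w : gT, 'CF('C_W[w]%G),
    [/\ forall w, w \in R -> phi w \is a linear_char /\ psi w \is a linear_char,
        cfReg W = \sum_(w in R) 'Ind[W] (phi w),
        {in W, forall g, omegaW W S rG g = (\sum_(w in R) 'Ind[W] (psi w)) g}
      & forall w, w \in R ->
          {in ('C_W[w])%g, forall c, psi w c = phi w c * sgnW S c * alpha_w rG w c}].

Proof.
case: hcox => sSW genS invS _; have hG : coxeter_rep rG by split.
exact: (@coxeter_characters gT W S rG hG hyp).
Qed.
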